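(* Let $(X,\mu)$ be a standard probability space and let $T$ be a type III ergodic non-singular automorphism of $(X,\mu)$. Then the full group $[T]$ has ample generics.
   Context: A probability space is standard if it is isomorphic to $[0,1]$ with Lebesgue measure. A non-singular automorphism of $(X,\mu)$ is a Borel bijection $T$ of $X$ such that for every Borel $A\subseteq X$, $\mu(A)=0$ if and only if $\mu(T(A))=0$; two such are identified if they coincide on a set of full measure. $T$ is ergodic if every $T$-invariant Borel set has measure $0$ or $1$. A non-singular ergodic automorphism is type III if it preserves no $\sigma$-finite measure equivalent to $\mu$ (i.e. having the same null sets as $\mu$). The full group $[T]$ is the group of all non-singular automorphisms $S$ of $(X,\mu)$ which preserve every $T$-orbit, i.e. for (almost) every $x\in X$ there is $n\in\mathbb Z$ with $S(x)=T^n(x)$. It is a Polish group for the topology induced by the uniform metric $d_u(S,S')=\mu(\{x\in X:S(x)\neq S'(x)\})$. A Polish group $G$ has ample generics if for every $n\in\mathbb N$, the diagonal conjugacy action of $G$ on $G^n$, given by $g\cdot(g_1,\dots,g_n)=(gg_1g^{-1},\dots,gg_ng^{-1})$, has a comeager orbit (comeager: containing a dense countable intersection of open sets). *)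

(* Defs.v *)
From HB Require Import structures.
From mathcomp Require Import all_boot all_order all_algebra generic_quotient.
From mathcomp Require Import all_classical all_reals all_analysis.
From mathcomp Require Import measurable_realfun borel_hierarchy zify.

Set Implicit Arguments.
Unset Strict Implicit.
Unset Printing Implicit Defensive.

Import Order.TTheory GRing.Theory Num.Theory.
Import numFieldNormedType.Exports.

Local Open Scope classical_set_scope.
Local Open Scope ring_scope.
Local Open Scope quotient_scope.

Section topology.

Definition comeager (T : topologicalType) (A : set T) :=
  exists D : set T, [/\ Gdelta D, dense D & D `<=` A].

(* [rho] is an arbitrary compatible complete metric; the uniform metric on a
   full group is in general not complete. *)
Definition polish (R : realType) (T : topologicalType) :=
  (exists2 D : set T, countable D & dense D) /\
  exists rho : T -> T -> R,
  [/\ forall x y, rho x y = 0 <-> x = y,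
      forall x y, rho x y = rho y x,
      forall x y z, rho x z <= rho x y + rho y z,
      forall x (U : set T),
        nbhs x U <-> exists2 e, 0 < e & [set y | rho x y < e] `<=` U &
      forall u : nat -> T,
        (forall e, 0 < e -> exists N, forall m n,
           (N <= m)%N -> (N <= n)%N -> rho (u m) (u n) < e) ->
        exists l : T, u @ \oo --> l].

End topology.

(* No compatibility between the group law and the topology is imposed here:
   it is part of [polish_group]. *)
#[short(type="groupWithTopologyType")]
HB.structure Definition GroupWithTopology := {G of Topological G & Group G}.

Section ample_generics.
Local Open Scope group_scope.

Definition polish_group (R : realType) (G : groupWithTopologyType) :=
  [/\ polish R G, continuous (fun p : G * G => p.1 * p.2) &
      continuous (fun g : G => g^-1)].

Definition conj_orbit (G : groupWithTopologyType) (n : nat)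
    (x : {ptws 'I_n -> G}) : set {ptws 'I_n -> G} :=
  [set y | exists g : G, y = (fun i => g * x i * g^-1)].

Definition ample_generics (R : realType) (G : groupWithTopologyType) :=
  polish_group R G /\
  forall n : nat, exists x : {ptws 'I_n -> G}, comeager (conj_orbit x).

End ample_generics.

(* An everywhere defined, bimeasurable bijection onto the Borel space [0, 1]. *)
Definition standard_probability (R : realType) (d : measure_display)
    (X : measurableType d) (mu : probability X R) :=
  exists phi : X -> R,
  [/\ set_bij setT `[0, 1] phi,
      measurable_fun setT phi,
      forall A : set X, measurable A -> measurable (phi @` A) &
      forall B : set R, measurable B ->
        mu (phi @^-1` B) = lebesgue_measure (B `&` `[0, 1])].

Section automorphisms.
Context {R : realType} {d : measure_display} {X : measurableType d}.
Variable mu : probability X R.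

(* On a standard Borel space a Borel bijection has a Borel inverse
   (Lusin-Souslin), so that measurability of [autV] is no restriction there. *)
Record nsaut := NsAut {
  aut :> X -> X;
  autV : X -> X;
  autK : cancel aut autV;
  autVK : cancel autV aut;
  measurable_aut : measurable_fun setT aut;
  measurable_autV : measurable_fun setT autV;
  aut_nonsingular : forall A : set X, measurable A ->
    mu A = 0%E <-> mu (aut @` A) = 0%E }.

HB.instance Definition _ := gen_eqMixin nsaut.
HB.instance Definition _ := gen_choiceMixin nsaut.

Implicit Types S T : nsaut.

Definition aut_iter T (n : int) : X -> X :=
  match n with Posz k => iter k T | Negz k => iter k.+1 (autV T) end.

Definition ergodic T := forall A : set X,
  measurable A -> T @` A = A -> mu A = 0%E \/ mu A = 1%E.

Definition type_III T := ~ exists nu : {measure set X -> \bar R},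
  [/\ sigma_finite setT nu, nu `<< mu, mu `<< nu &
      forall A : set X, measurable A -> nu (T @` A) = nu A].

Lemma image_aut T (A : set X) : T @` A = autV T @^-1` A.
Proof.
apply/seteqP; split=> [_ [x Ax <-]|x Ax] /=; first by rewrite autK.
by exists (autV T x) => //; rewrite autVK.
Qed.

Lemma image_autV T (A : set X) : autV T @` A = T @^-1` A.
Proof.
apply/seteqP; split=> [_ [x Ax <-]|x Ax] /=; first by rewrite autVK.
by exists (T x) => //; rewrite autK.
Qed.

Lemma measurable_preimage_aut T (A : set X) :
  measurable A -> measurable (T @^-1` A).
Proof. by move=> mA; rewrite -[_ @^-1` _]setTI; exact: measurable_aut. Qed.

Lemma measurable_preimage_autV T (A : set X) :
  measurable A -> measurable (autV T @^-1` A).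
Proof. by move=> mA; rewrite -[_ @^-1` _]setTI; exact: measurable_autV. Qed.

Lemma preimage_aut_null T (A : set X) :
  measurable A -> mu (T @^-1` A) = 0%E <-> mu A = 0%E.
Proof.
move=> mA; rewrite (aut_nonsingular T (measurable_preimage_aut T mA)).
rewrite image_aut -comp_preimage (_ : _ \o _ = id) //.
by apply/funext => x /=; rewrite autVK.
Qed.

Lemma preimage_autV_null T (A : set X) :
  measurable A -> mu (autV T @^-1` A) = 0%E <-> mu A = 0%E.
Proof. by move=> mA; rewrite -image_aut -aut_nonsingular. Qed.

Lemma ae_aut T (P : X -> Prop) :
  (\forall x \ae mu, P x) -> \forall x \ae mu, P (T x).
Proof.
move=> [N [mN N0 PN]]; exists (T @^-1` N); split.
- exact: measurable_preimage_aut.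
- exact/preimage_aut_null.
- by move=> x /= nPx; exact: PN.
Qed.

Lemma ae_autV T (P : X -> Prop) :
  (\forall x \ae mu, P x) -> \forall x \ae mu, P (autV T x).
Proof.
move=> [N [mN N0 PN]]; exists (autV T @^-1` N); split.
- exact: measurable_preimage_autV.
- exact/preimage_autV_null.
- by move=> x /= nPx; exact: PN.
Qed.

Definition aut_id : nsaut.
Proof.
exists id id => //; by [exact: measurable_id|move=> A _; rewrite image_id].
Defined.

Definition aut_inv T : nsaut.
Proof.
exists (autV T) T; [exact: autVK|exact: autK|exact: measurable_autV
  |exact: measurable_aut|].
by move=> A mA; rewrite image_autV preimage_aut_null.
Defined.

Definition aut_comp S T : nsaut.
Proof.
exists (S \o T) (autV T \o autV S).
- by move=> x /=; rewrite !autK.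
- by move=> x /=; rewrite !autVK.
- by apply: measurableT_comp; exact: measurable_aut.
- by apply: measurableT_comp; exact: measurable_autV.
- move=> A mA; rewrite /= -image_comp.
  rewrite -aut_nonsingular; first by rewrite -aut_nonsingular.
  by rewrite image_aut; exact: measurable_preimage_autV.
Defined.

Definition aut_ae_eq S T := `[< \forall x \ae mu, S x = T x >].

Let aut_ae_eq_refl : reflexive aut_ae_eq.
Proof. by move=> S; apply/asboolP; exact: aeW. Qed.

Let aut_ae_eq_sym : symmetric aut_ae_eq.
Proof.
by move=> S T; apply/asboolP/asboolP; apply: filterS => x ->.
Qed.

Let aut_ae_eq_trans : transitive aut_ae_eq.
Proof.
move=> T S U /asboolP ST /asboolP TU; apply/asboolP.
by apply: filterS2 ST TU => x -> ->.
Qed.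

Canonical aut_ae_eq_equiv :=
  EquivRel aut_ae_eq aut_ae_eq_refl aut_ae_eq_sym aut_ae_eq_trans.

Definition Aut := {eq_quot aut_ae_eq}.
HB.instance Definition _ := Choice.on Aut.
HB.instance Definition _ := EqQuotient.on Aut.

Lemma AutP S T : \pi_Aut S = \pi_Aut T <-> \forall x \ae mu, S x = T x.
Proof. by split=> [/eqmodP/asboolP|?]; last apply/eqmodP/asboolP. Qed.

Lemma repr_piE S : \forall x \ae mu, (repr (\pi_Aut S) : nsaut) x = S x.
Proof. by apply/AutP; rewrite reprK. Qed.

Definition Aut_mul (s t : Aut) : Aut := \pi_Aut (aut_comp (repr s) (repr t)).
Definition Aut_inv (s : Aut) : Aut := \pi_Aut (aut_inv (repr s)).
Definition Aut_one : Aut := \pi_Aut aut_id.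

Lemma pi_mul S T : Aut_mul (\pi_Aut S) (\pi_Aut T) = \pi_Aut (aut_comp S T).
Proof.
apply/AutP => /=.
have /= hT := repr_piE T; have /(ae_aut T) /= hS := repr_piE S.
by apply: filterS2 hT hS => x -> ->.
Qed.

Lemma pi_inv S : Aut_inv (\pi_Aut S) = \pi_Aut (aut_inv S).
Proof.
apply/AutP => /=.
have /(ae_autV S) := repr_piE S; apply: filterS => x /=.
by rewrite autVK => e; rewrite -{1}e autK.
Qed.

Let Aut_mulA : associative Aut_mul.
Proof.
move=> s t u; elim/quotW: s => s; elim/quotW: t => t; elim/quotW: u => u.
rewrite (pi_mul t u) (pi_mul s t) !pi_mul.
by apply/AutP; apply: aeW => x.
Qed.

Let Aut_mul1 : left_id Aut_one Aut_mul.
Proof.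
by move=> s; rewrite -[s]reprK pi_mul; apply/AutP; apply: aeW => x.
Qed.

Let Aut_mulr1 : right_id Aut_one Aut_mul.
Proof.
by move=> s; rewrite -[s]reprK pi_mul; apply/AutP; apply: aeW => x.
Qed.

Let Aut_mulV : left_inverse Aut_one Aut_inv Aut_mul.
Proof.
move=> s; rewrite -[s]reprK pi_inv pi_mul; apply/AutP; apply: aeW => x /=.
by rewrite autK.
Qed.

Let Aut_mulrV : right_inverse Aut_one Aut_inv Aut_mul.
Proof.
move=> s; rewrite -[s]reprK pi_inv pi_mul; apply/AutP; apply: aeW => x /=.
by rewrite autVK.
Qed.

HB.instance Definition _ := isGroup.Build Aut
  Aut_mulA Aut_mul1 Aut_mulr1 Aut_mulV Aut_mulrV.

Definition preserves_orbits T S :=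
  \forall x \ae mu, exists n : int, S x = aut_iter T n x.

(* Independent of the representative chosen by [repr], see
   [in_full_groupP]. *)
Definition in_full_group T : pred Aut :=
  fun s => `[< preserves_orbits T (repr s) >].

Lemma in_full_groupP T S :
  (\pi_Aut S \in in_full_group T) <-> preserves_orbits T S.
Proof.
rewrite unfold_in; split=> [/asboolP h|h].
  by apply: filterS2 h (repr_piE S) => x [n hn] e; exists n; rewrite -e.
by apply/asboolP; apply: filterS2 h (repr_piE S) => x [n hn] e; exists n;
  rewrite e.
Qed.

Lemma aut_iterD T (m n : int) x :
  aut_iter T m (aut_iter T n x) = aut_iter T (m + n) x.
Proof.
have iS k y : aut_iter T (k + 1) y = T (aut_iter T k y).
  case: k => [k|[|k]].
  - by rewrite -PoszD addn1.
  - by rewrite /= autVK.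
  - have -> : Negz k.+1 + 1 = Negz k by rewrite !NegzE; lia.
    by rewrite /= autVK.
have iP k y : aut_iter T (k - 1) y = autV T (aut_iter T k y).
  by rewrite -[k in RHS](subrK 1) iS autK.
elim/int_ind: m => [|m IH|m IH]; first by rewrite add0r.
- by rewrite -addn1 PoszD iS IH addrAC iS.
- have -> : - m.+1%:Z = - m%:Z - 1 by rewrite -addn1 PoszD opprD.
  by rewrite iP IH addrAC iP.
Qed.

Lemma full_group_closed T : group_closed (in_full_group T).
Proof.
split.
  by apply/in_full_groupP; apply: aeW => x; exists 0.
move=> s t; elim/quotW: s => s; elim/quotW: t => t.
move=> /in_full_groupP hs /in_full_groupP ht.
have -> : (\pi_Aut s / \pi_Aut t)%g = \pi_Aut (aut_comp s (aut_inv t)).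
  by rewrite -pi_mul -pi_inv.
apply/in_full_groupP.
have /(ae_autV t) hs' := hs; have /(ae_autV t) ht' := ht.
apply: filterS2 hs' ht' => x /= [n ->] [m]; rewrite autVK => e.
exists (n - m); rewrite {2}e aut_iterD subrK //.
Qed.

(* Independent of the representatives chosen by [repr], see [uniform_distE]. *)
Definition uniform_dist (s t : Aut) : R :=
  fine (mu [set x | repr s x <> repr t x]).

Lemma measurable_aut_neq S T : standard_probability mu ->
  measurable [set x | S x <> T x].
Proof.
move=> [phi [[_ phi_inj _] mphi _ _]].
have -> : [set x | S x <> T x] =
    ~` ((fun x => phi (S x) - phi (T x)) @^-1` [set 0]).
  apply/seteqP; split=> x /=; apply: contra_not; last by move->; rewrite subrr.
  by move=> /eqP; rewrite subr_eq0 => /eqP /phi_inj; apply; rewrite inE.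
apply: measurableC; rewrite -[_ @^-1` _]setTI.
have mphiA U : measurable_fun setT (fun x => phi (aut U x)).
  by apply: (measurableT_comp mphi); exact: measurable_aut.
by apply: (measurable_funB (mphiA S) (mphiA T)) => //; exact: measurable_set1.
Qed.

Lemma uniform_distE S T : standard_probability mu ->
  uniform_dist (\pi_Aut S) (\pi_Aut T) = fine (mu [set x | S x <> T x]).
Proof.
move=> hmu; congr fine.
have [N [mN N0 hN]] : \forall x \ae mu,
    (repr (\pi_Aut S) : nsaut) x = S x /\ (repr (\pi_Aut T) : nsaut) x = T x.
  by apply: filterS2 (repr_piE S) (repr_piE T) => x.
have nullN (U V : nsaut) : mu [set x | U x <> V x] =
    mu ([set x | U x <> V x] `|` N).
  apply/esym; move: (mN) => /null_setU => /(_ _ mu) h.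
  apply h; last exact: measurable_aut_neq.
  by apply/measure0_null_setP.
rewrite nullN [RHS]nullN; congr (mu _).
have {}hN x : ~ N x -> (repr (\pi_Aut S) : nsaut) x = S x /\
    (repr (\pi_Aut T) : nsaut) x = T x.
  by move=> nNx; apply: contrapT => h; apply: nNx; exact: hN.
apply/predeqP => x /=; have [Nx|nNx] := pselect (N x).
  by split=> _; right.
by have [-> ->] := hN x nNx.
Qed.

End automorphisms.

(* The standardness hypothesis makes [set x | S x <> T x] measurable, hence
   [uniform_dist] a metric. *)
Definition full_group (R : realType) (d : measure_display)
    (X : measurableType d) (mu : probability X R)
    (hmu : standard_probability mu) (T : nsaut mu) :=
  {s : Aut mu | in_full_group T s}.

Section full_group.
Context {R : realType} {d : measure_display} {X : measurableType d}.
Context {mu : probability X R} (hmu : standard_probability mu) (T : nsaut mu).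
Local Notation fg := (full_group hmu T).

HB.instance Definition _ := SubChoice.on fg.
HB.instance Definition _ :=
  SubChoice_isSubGroup.Build (Aut mu) (in_full_group T) fg
    (full_group_closed T).

Let dist (s t : fg) : R := uniform_dist (val s) (val t).

Let distxx s : dist s s = 0.
Proof.
by rewrite /dist /uniform_dist (_ : [set _ | _] = set0) ?measure0//; apply/seteqP; split.
Qed.

Let dist_eq0 s t : dist s t = 0 -> s = t.
Proof.
move=> st; apply: val_inj; rewrite -[LHS]reprK -[RHS]reprK; apply/AutP.
exists [set x | repr (val s) x <> repr (val t) x]; split => //.
- exact: measurable_aut_neq.
- by apply/eqP; rewrite -fine_eq0 ?fin_num_measure//; [exact/eqP|exact: measurable_aut_neq].
Qed.

Let dist_sym s t : dist s t = dist t s.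
Proof.
by congr (fine (mu _)); apply/seteqP; split=> x /= h e; exact/h/esym.
Qed.

Let dist_triangle t s u : dist s u <= dist s t + dist t u.
Proof.
have mneq := fun S T' => measurable_aut_neq S T' hmu.
rewrite -fineD ?fin_num_measure//; try exact: mneq.
apply: fine_le; rewrite ?fin_numD ?fin_num_measure//; try exact: mneq.
apply: le_trans (measureU2 _ _ _); try exact: mneq.
apply: le_measure; rewrite ?inE; try exact: measurableU; try exact: mneq.
move=> x /= su; have [st|] := pselect (repr (val s) x = repr (val t) x).
  by right; rewrite -st.
by left.
Qed.

HB.instance Definition _ :=
  isMetric.Build R fg distxx dist_eq0 dist_sym dist_triangle.

End full_group.

(* Main.v *)
From HB Require Import structures.
Require Import Defs.
From mathcomp Require Import all_boot all_order all_algebra generic_quotient.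
From mathcomp Require Import all_classical all_reals all_analysis.
From mathcomp Require Import measurable_realfun borel_hierarchy perm zify lra.

(* Two tuples of the full group both of whose generated groups have a.e. finite
   orbits, and both of which realize every finite pointed permutation action on
   a set of positive measure, are conjugate: choose a Borel transversal of the
   orbits of each isomorphism type and match the two transversals by a partial
   isomorphism preserving the T-orbits. Such a partial isomorphism exists
   because in type III any two non-null sets A, B are equidecomposable: by a
   measurable Schroder-Bernstein argument it is enough that each of them
   contains infinitely many disjoint equidecomposable copies of a non-null set.
   A weakly wandering set of the transformation induced on A (Hajian-Kakutani)
   provides these copies; if there were none, an invariant mean would have a
   countably additive part equivalent to the measure on A, which would spread
   over the orbits to a sigma-finite T-invariant measure.

   Tuples of this kind form a G-delta set, since the type of a finite orbit is
   decided by finitely many values of the generators. They are dense: by means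
   of markers A_k decreasing to the empty set, cutting each T-orbit at its visits
   to A_k gives finite pieces, whose permutations approximate the tuple, and then
   all types can be installed on a small invariant set. *)

Set Implicit Arguments.
Unset Strict Implicit.
Unset Printing Implicit Defensive.

Import Order.TTheory GRing.Theory Num.Theory.
Import numFieldNormedType.Exports.

Local Open Scope classical_set_scope.
Local Open Scope ring_scope.
Local Open Scope quotient_scope.

(** Type III removes measures as invariants: the full group would preserve an equivalent T-invariant
    measure, and then the measure of the set of points of each finite type would be unchanged by
    conjugacy. Without one, being null or not is all that has to match. The countably additive part
    of the mean cannot vanish on a non-null set: the mean itself would then be zero on some non-null
    subset, whereas, when no weakly wandering set exists, the iterated preimages of a non-null set
    have measures bounded below. The technical obstacle is null sets: elements of the full group are
    classes, while orbits and words need actual maps. Constructions therefore use Borel bijections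
    preserving the T-orbit of every point; an exceptional set is removed with its saturation, and
    the map is the identity there. Such bijections are automatically non-singular. Words contain no
    inverses of generators, since on a finite orbit an inverse is a positive power. As an orbit has
    one type per base point, the type of least index in an enumeration is kept. *)

Section countable_measurability.
Context d (X : measurableType d).
Implicit Types (f g : X -> X) (A B : set X).

Lemma measurable_preimage f A :
  measurable_fun setT f -> measurable A -> measurable (f @^-1` A).
Proof. by move=> mf mA; rewrite -[_ @^-1` _]setTI; exact: mf. Qed.

Lemma measurable_bigcup_count (I : countType) (F : I -> set X) :
  (forall i, measurable (F i)) -> measurable (\bigcup_i F i).
Proof. exact/countable_bigcupT_measurable. Qed.

Lemma measurable_bigcap_count (I : countType) (F : I -> set X) :
  (forall i, measurable (F i)) -> measurable (\bigcap_i F i).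
Proof.
move=> mF; rewrite -[X in measurable X]setCK setC_bigcap; apply: measurableC.
by apply: measurable_bigcup_count => i; exact: measurableC.
Qed.

Lemma measurable_exists (I : countType) (P : I -> X -> Prop) :
  (forall i, measurable [set x | P i x]) ->
  measurable [set x | exists i, P i x].
Proof.
move=> /measurable_bigcup_count; congr measurable.
by apply/seteqP; split=> [x [i _ Pi]|x [i Pi]]; exists i.
Qed.

Lemma measurable_forall (I : countType) (P : I -> X -> Prop) :
  (forall i, measurable [set x | P i x]) ->
  measurable [set x | forall i, P i x].
Proof.
move=> /measurable_bigcap_count; congr measurable.
by apply/seteqP; split=> [x Px i|x Px i _]; exact: Px.
Qed.

(** The pieces may overlap as long as the maps agree there: overlapping pieces arise when a map is
    extended along words and when a sequence of maps stabilizes. Outside the pieces the value is the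
    point itself, so that gluing keeps orbits. *)
Lemma measurable_glue (I : countType) (C : I -> set X) (f : I -> X -> X) :
  (forall i, measurable (C i)) -> (forall i, measurable_fun setT (f i)) ->
  (forall i j x, C i x -> C j x -> f i x = f j x) ->
  exists F : X -> X, [/\ measurable_fun setT F,
    forall i x, C i x -> F x = f i x &
    forall x, (forall i, ~ C i x) -> F x = x].
Proof.
move=> mC mf compat.
have /choice[F FP] : forall x, exists y,
    (forall i, C i x -> y = f i x) /\ ((forall i, ~ C i x) -> y = x).
  move=> x; have [[i Ci]|nC] := pselect (exists i, C i x).
    by exists (f i x); split=> [j Cj|/(_ i)//]; exact: compat.
  by exists x; split=> // i Ci; case: nC; exists i.
exists F; split; [|by move=> i x; case: (FP x) => + _; apply
  |by move=> x; case: (FP x)].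
move=> _ B mB; rewrite setTI.
have -> : F @^-1` B = (\bigcup_i (C i `&` f i @^-1` B)) `|`
    ((\bigcap_i ~` C i) `&` B).
  apply/seteqP; split=> x /=.
    have [[i Ci]|nC] := pselect (exists i, C i x).
      by case: (FP x) => /(_ i Ci) -> _ fB; left; exists i.
    have nC' i : ~ C i x by move=> Ci; apply: nC; exists i.
    by case: (FP x) => _ /(_ nC') -> xB; right; split => // i _; exact: nC'.
  case=> [[i _ [Ci fB]]|[nC xB]]; first by case: (FP x) => /(_ i Ci) ->.
  by case: (FP x) => _ ->// i; exact: nC.
apply: measurableU.
  apply: measurable_bigcup_count => i; apply: measurableI => //.
  exact: measurable_preimage.
by apply: measurableI => //; apply: measurable_bigcap_count => i; exact: measurableC.
Qed.

End countable_measurability.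

(** * Orbits and everywhere defined orbit-preserving automorphisms *)

Section orbits.
Context {R : realType} {d : measure_display} {X : measurableType d}.
Context {mu : probability X R}.
Implicit Types (S : nsaut mu) (A B : set X).

Lemma null_bigcup (I : countType) (F : I -> set X) :
  (forall i, measurable (F i)) -> (forall i, mu (F i) = 0%E) ->
  mu (\bigcup_i F i) = 0%E.
Proof.
move=> mF F0; apply/negligibleP; first exact: measurable_bigcup_count.
apply: (@negligibleS _ _ _ _ (\bigcup_n (if unpickle n is Some i then F i else set0))).
  by move=> x [i _ Fi]; exists (pickle i) => //; rewrite pickleK.
apply: negligible_bigcup => n.
case: unpickle => [i|]; last exact: negligible_set0.
by apply/negligibleP; [exact: mF|exact: F0].
Qed.

Lemma null_subset A B : measurable A -> measurable B -> A `<=` B ->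
  mu B = 0%E -> mu A = 0%E.
Proof.
move=> mA mB AB B0; apply/eqP; rewrite eq_le measure_ge0 andbT -B0.
by apply: le_measure; rewrite ?inE.
Qed.

Lemma nullU A B : measurable A -> measurable B -> mu A = 0%E -> mu B = 0%E ->
  mu (A `|` B) = 0%E.
Proof.
by move=> mA mB A0 B0; rewrite -A0; exact: measureU0.
Qed.

Lemma measureDnull A B : measurable A -> measurable B -> mu B = 0%E ->
  mu (A `\` B) = mu A.
Proof.
move=> mA mB B0; rewrite -[in RHS](setDKU (@subIsetl _ A B)).
have mI : measurable (A `&` B) by exact: measurableI.
rewrite setDIr setDv set0U measureU0//; first exact: measurableD.
by apply: null_subset B0.
Qed.

Lemma aut_iterK S (n : int) : cancel (aut_iter S n) (aut_iter S (- n)).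
Proof. by move=> x; rewrite aut_iterD addNr. Qed.

Lemma aut_iterVK S (n : int) : cancel (aut_iter S (- n)) (aut_iter S n).
Proof. by move=> x; rewrite aut_iterD addrN. Qed.

Lemma measurable_iter (f : X -> X) k :
  measurable_fun setT f -> measurable_fun setT (iter k f).
Proof.
move=> mf; elim: k => [|k IH]; first exact: measurable_id.
exact: (measurableT_comp mf IH).
Qed.

Lemma measurable_aut_iter S n : measurable_fun setT (aut_iter S n).
Proof.
case: n => n; apply: measurable_iter; [exact: measurable_aut|exact: measurable_autV].
Qed.

Lemma measurable_preimage_iter S n A :
  measurable A -> measurable (aut_iter S n @^-1` A).
Proof. by move=> mA; apply: measurable_preimage => //; exact: measurable_aut_iter. Qed.

Lemma null_preimage_iter S n A : measurable A ->
  mu (aut_iter S n @^-1` A) = 0%E <-> mu A = 0%E.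
Proof.
move=> mA; case: n => n.
  elim: n => [|n IH] //; rewrite -IH.
  rewrite -(preimage_aut_null S (measurable_preimage_iter S (Posz n) mA)).
  rewrite -comp_preimage; suff -> : aut_iter S n.+1 = aut_iter S n \o S by [].
  by apply/funext => x; rewrite /= -iterSr.
elim: n => [|n IH]; first exact: preimage_autV_null.
rewrite -IH -(preimage_autV_null S (measurable_preimage_iter S (Negz n) mA)).
rewrite -comp_preimage; suff -> : aut_iter S (Negz n.+1) = aut_iter S (Negz n) \o autV S by [].
by apply/funext => x; rewrite /= -iterSr.
Qed.

Definition same_orbit S x y := exists n : int, y = aut_iter S n x.

Lemma same_orbit_refl S x : same_orbit S x x.
Proof. by exists 0. Qed.

Lemma same_orbit_sym S x y : same_orbit S x y -> same_orbit S y x.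
Proof. by move=> [n ->]; exists (- n); rewrite aut_iterK. Qed.

Lemma same_orbit_trans S x y z : same_orbit S x y -> same_orbit S y z -> same_orbit S x z.
Proof. by move=> [n ->] [m ->]; exists (m + n); rewrite aut_iterD. Qed.

Lemma same_orbit_iter S x n : same_orbit S x (aut_iter S n x).
Proof. by exists n. Qed.

Lemma same_orbit_aut S x : same_orbit S x (S x).
Proof. by exists 1. Qed.

Lemma same_orbit_autV S x : same_orbit S x (autV S x).
Proof. by exists (-1). Qed.

(** Null sets stay null under [saturation] and conull sets stay conull under [core]; exceptional
    sets are always removed in this invariant form. *)
Definition saturation S A : set X := [set x | exists n, A (aut_iter S n x)].
Definition core S A : set X := [set x | forall n, A (aut_iter S n x)].
Definition invariant_set S A := forall x y, same_orbit S x y -> A x -> A y.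

Lemma measurable_saturation S A : measurable A -> measurable (saturation S A).
Proof. by move=> mA; apply: measurable_exists => n; exact: measurable_preimage_iter. Qed.

Lemma measurable_core S A : measurable A -> measurable (core S A).
Proof. by move=> mA; apply: measurable_forall => n; exact: measurable_preimage_iter. Qed.

Lemma invariant_saturation S A : invariant_set S (saturation S A).
Proof.
by move=> x y [n ->] [m Am]; exists (m - n); rewrite aut_iterD subrK.
Qed.

Lemma invariant_core S A : invariant_set S (core S A).
Proof. by move=> x y [n ->] Ax m; rewrite aut_iterD. Qed.

Lemma invariant_setC S A : invariant_set S A -> invariant_set S (~` A).
Proof. by move=> iA x y xy nAx /iA Ax; apply/nAx/Ax/same_orbit_sym. Qed.

Lemma invariant_setI S A B : invariant_set S A -> invariant_set S B ->
  invariant_set S (A `&` B).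
Proof. by move=> iA iB x y xy [Ax Bx]; split; [exact: iA Ax|exact: iB Bx]. Qed.

Lemma sub_saturation S A : A `<=` saturation S A.
Proof. by move=> x Ax; exists 0. Qed.

Lemma core_sub S A : core S A `<=` A.
Proof. by move=> x /(_ 0). Qed.

Lemma null_saturation S A : measurable A -> mu A = 0%E -> mu (saturation S A) = 0%E.
Proof.
move=> mA A0; have -> : saturation S A = \bigcup_n (aut_iter S n @^-1` A).
  by apply/seteqP; split=> x; [move=> [n An]; exists n|move=> [n _ An]; exists n].
apply: null_bigcup => n; first exact: measurable_preimage_iter.
exact/null_preimage_iter.
Qed.

Lemma null_core S A : measurable A -> mu (~` A) = 0%E -> mu (~` (core S A)) = 0%E.
Proof.
move=> mA A0; have -> : ~` core S A = saturation S (~` A).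
  apply/seteqP; split=> x /=; first by move=> /existsNP.
  by move=> [n nA] /(_ n).
by apply: null_saturation => //; exact: measurableC.
Qed.

Definition orbital S (f : X -> X) := forall x, same_orbit S x (f x).

(** Non-singularity is free: the preimage of a null set under an orbital map lies in its saturation,
    a countable union of null sets. *)
Lemma aut_builder S (f g : X -> X) :
  measurable_fun setT f -> measurable_fun setT g -> orbital S f ->
  cancel f g -> cancel g f -> exists U : nsaut mu, aut U = f /\ autV U = g.
Proof.
move=> mf mg of_ fK gK.
have og : orbital S g.
  by move=> x; apply: same_orbit_sym; rewrite -{2}(gK x); exact: of_.
have image A : f @` A = g @^-1` A.
  apply/seteqP; split=> [_ [x Ax <-]|x Ax] /=; first by rewrite fK.
  by exists (g x) => //; rewrite gK.
have null (h : X -> X) A : measurable_fun setT h -> orbital S h ->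
    measurable A -> mu A = 0%E -> mu (h @^-1` A) = 0%E.
  move=> mh oh mA A0.
  apply: (@null_subset _ (saturation S A)); [exact: measurable_preimage
    |exact: measurable_saturation| |exact: null_saturation].
  by move=> x /= Ax; case: (oh x) => n e; exists n; rewrite -e.
have ns A : measurable A -> mu A = 0%E <-> mu (f @` A) = 0%E.
  move=> mA; rewrite image; split; first exact: null.
  move=> /(null f _ mf of_ (measurable_preimage mg mA)).
  by rewrite -comp_preimage (_ : g \o f = id)//; apply/funext => x /=.
by exists (NsAut fK gK mf mg ns).
Qed.

(** Conditions that hold only on an invariant set are enough, since the identity on its complement
    preserves orbits and bijectivity. *)
Lemma aut_builder_on S (G : set X) (f g : X -> X) :
  measurable G -> invariant_set S G ->
  measurable_fun setT f -> measurable_fun setT g ->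
  (forall x, G x -> same_orbit S x (f x)) ->
  (forall x, G x -> G (g x)) ->
  (forall x, G x -> g (f x) = x) -> (forall x, G x -> f (g x) = x) ->
  exists U : nsaut mu, [/\ orbital S U, forall x, G x -> U x = f x,
    forall x, G x -> autV U x = g x & forall x, ~ G x -> U x = x].
Proof.
move=> mG iG mf mg of_ Gg fK gK.
have ext (h : X -> X) : measurable_fun setT h -> exists h', [/\
    measurable_fun setT h', forall x, G x -> h' x = h x & forall x, ~ G x -> h' x = x].
  move=> mh; have [//|//||h' [mh' h1 h2]] := @measurable_glue _ X unit (fun=> G) (fun=> h).
    by [].
  exists h'; split=> // x; first exact: (h1 tt).
  by move=> nG; apply: h2.
have [f' [mf' f1 f2]] := ext f mf; have [g' [mg' g1 g2]] := ext g mg.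
have Gf x : G x -> G (f x) by move=> Gx; exact: iG (of_ x Gx) Gx.
have [|||U [Uf Ug]] := @aut_builder S f' g' mf' mg'.
- move=> x; have [Gx|nG] := pselect (G x); first by rewrite f1//; exact: of_.
  by rewrite f2//; exact: same_orbit_refl.
- move=> x; have [Gx|nG] := pselect (G x); last by rewrite f2// g2.
  by rewrite f1// g1 ?fK//; exact: Gf.
- move=> x; have [Gx|nG] := pselect (G x); last by rewrite g2// f2.
  by rewrite g1// f1 ?gK//; exact: Gg.
exists U; rewrite Uf Ug; split=> // x; have [Gx|nG] := pselect (G x).
- by rewrite f1//; exact: of_.
- by rewrite f2//; exact: same_orbit_refl.
Qed.

Lemma orbital_autV S (U : nsaut mu) : orbital S U -> orbital S (autV U).
Proof. by move=> oU x; apply: same_orbit_sym; rewrite -{2}(autVK U x); exact: oU. Qed.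

Lemma orbital_comp S (f g : X -> X) : orbital S f -> orbital S g -> orbital S (f \o g).
Proof. by move=> of_ og x; exact: same_orbit_trans (og x) (of_ _). Qed.

Lemma orbital_iter S (U : nsaut mu) n : orbital S U -> orbital S (aut_iter U n).
Proof.
move=> oU; case: n => n.
  elim: n => [|n IH] x; first exact: same_orbit_refl.
  exact: same_orbit_trans (IH x) (oU _).
elim: n => [|n IH] x; first exact: orbital_autV.
by apply: same_orbit_trans (IH x) _; exact: orbital_autV.
Qed.

End orbits.

(** * Equidecomposability *)

Section equidecomposability.
Context {R : realType} {d : measure_display} {X : measurableType d}.
Context {mu : probability X R} (T : nsaut mu).
Implicit Types (A B C : set X).

(** A partial isomorphism inside the orbits of [T]. Both maps are total, and nothing but
    measurability is asked of them outside [A] and [B], which makes composition and restriction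
    painless. *)
Record piso A B (f g : X -> X) : Prop := Piso {
  piso_mdom : measurable A;
  piso_mcod : measurable B;
  piso_mfun : measurable_fun setT f;
  piso_minv : measurable_fun setT g;
  piso_orbit : forall x, A x -> same_orbit T x (f x);
  piso_fun : forall x, A x -> B (f x);
  piso_inv : forall y, B y -> A (g y);
  pisoK : forall x, A x -> g (f x) = x;
  pisoVK : forall y, B y -> f (g y) = y }.

Definition equidec A B := exists f g, piso A B f g.

Lemma piso_sym A B f g : piso A B f g -> piso B A g f.
Proof.
move=> [mA mB mf mg o fA gB fK gK]; split=> // y By.
by apply: same_orbit_sym; rewrite -{2}(gK y By); exact/o/gB.
Qed.

Lemma equidec_sym A B : equidec A B -> equidec B A.
Proof. by move=> [f [g /piso_sym fg]]; exists g, f. Qed.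

Lemma equidec_refl A : measurable A -> equidec A A.
Proof.
by move=> mA; exists id, id; split=> // x _; exact: same_orbit_refl.
Qed.

Lemma piso_trans A B C f g f' g' : piso A B f g -> piso B C f' g' ->
  piso A C (f' \o f) (g \o g').
Proof.
move=> [mA mB mf mg o fA gB fK gK] [_ mC mf' mg' o' fA' gB' fK' gK'].
split=> //=.
- exact: measurableT_comp.
- exact: measurableT_comp.
- by move=> x Ax; apply: same_orbit_trans (o x Ax) (o' _ (fA _ Ax)).
- by move=> x /fA/fA'.
- by move=> y /gB'/gB.
- by move=> x Ax; rewrite fK' ?fK//; exact: fA.
- by move=> y Cy; rewrite gK ?gK'//; exact: gB'.
Qed.

Lemma equidec_trans A B C : equidec A B -> equidec B C -> equidec A C.
Proof.
by move=> [f [g fg]] [f' [g' fg']]; exists (f' \o f), (g \o g'); exact: piso_trans fg'.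
Qed.

Lemma piso_restrict A B C f g : measurable C -> C `<=` A ->
  piso A B f g -> piso C (B `&` g @^-1` C) f g.
Proof.
move=> mC CA [mA mB mf mg o fA gB fK gK]; split=> //.
- by apply: measurableI => //; exact: measurable_preimage.
- by move=> x /CA/o.
- by move=> x Cx; split=> /=; [exact/fA/CA|rewrite fK//; exact: CA].
- by move=> y [].
- by move=> x /CA/fK.
- by move=> y [By _]; exact: gK.
Qed.

Lemma equidec_bigcup (I : countType) (A B : I -> set X) :
  (forall i j x, A i x -> A j x -> i = j) ->
  (forall i j x, B i x -> B j x -> i = j) ->
  (forall i, equidec (A i) (B i)) -> equidec (\bigcup_i A i) (\bigcup_i B i).
Proof.
move=> dA dB /choice[f /choice[g fg]].
have [||i j x Ai Aj|F [mF Ff _]] := @measurable_glue _ X I A f.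
- by move=> i; exact: piso_mdom (fg i).
- by move=> i; exact: piso_mfun (fg i).
- by rewrite (dA _ _ _ Ai Aj).
have [||i j x Bi Bj|G [mG Gg _]] := @measurable_glue _ X I B g.
- by move=> i; exact: piso_mcod (fg i).
- by move=> i; exact: piso_minv (fg i).
- by rewrite (dB _ _ _ Bi Bj).
exists F, G; split=> //.
- by apply: measurable_bigcup_count => i; exact: piso_mdom (fg i).
- by apply: measurable_bigcup_count => i; exact: piso_mcod (fg i).
- by move=> x [i _ Ai]; rewrite (Ff i)//; exact: piso_orbit (fg i) _ Ai.
- by move=> x [i _ Ai]; exists i => //; rewrite (Ff i)//; exact: piso_fun (fg i) _ Ai.
- by move=> x [i _ Ai]; exists i => //; rewrite (Gg i)//; exact: piso_inv (fg i) _ Ai.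
- move=> x [i _ Ai]; rewrite (Ff i)// (Gg i) ?(pisoK (fg i))//.
  exact: piso_fun (fg i) _ Ai.
- move=> x [i _ Ai]; rewrite (Gg i)// (Ff i) ?(pisoVK (fg i))//.
  exact: piso_inv (fg i) _ Ai.
Qed.

Lemma piso_iter n A : measurable A ->
  piso (aut_iter T n @^-1` A) A (aut_iter T n) (aut_iter T (- n)).
Proof.
move=> mA; split=> //=; [exact: measurable_preimage_iter|exact: measurable_aut_iter
  |exact: measurable_aut_iter|by move=> x _; exact: same_orbit_iter
  |by move=> y; rewrite aut_iterVK|by move=> x _; rewrite aut_iterK
  |by move=> x _; rewrite aut_iterVK].
Qed.

Lemma equidec_saturation A B : equidec A B -> B `<=` saturation T A.
Proof.
move=> [f [g fg]] y By; have [n e] := piso_orbit (piso_sym fg) By.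
by exists n; rewrite -e; exact: piso_inv fg _ By.
Qed.

Lemma equidec_null A B : equidec A B -> mu A = 0%E -> mu B = 0%E.
Proof.
move=> AB A0; have BA := equidec_saturation AB; case: AB => f [g fg].
have mA := piso_mdom fg.
by apply: null_subset BA _; [exact: piso_mcod fg|exact: measurable_saturation
  |exact: null_saturation].
Qed.

Lemma equidec_schroder_bernstein A B A' B' : A' `<=` A -> B' `<=` B ->
  equidec A B' -> equidec B A' -> equidec A B.
Proof.
move=> AA BB [f [f' pf]] [g [g' pg]].
have [mA mB' mf mf' _ fA fB fK fVK] := pf.
have [mB mA' mg mg' _ gB gA gK gVK] := pg.
(* [C n] is the n-th image of [A \ A'] under [g] after [f], written with the inverses [g'] and [f']
   so that it is visibly measurable. *)
pose C := fix C n : set X := if n is n'.+1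
  then A' `&` (g' @^-1` B' `&` (f' \o g') @^-1` (C n')) else A `\` A'.
have mC n : measurable (C n).
  elim: n => [|n IH] /=; first exact: measurableD.
  apply: measurableI => //; apply: measurableI; first exact: measurable_preimage.
  by apply: measurable_preimage => //; exact: measurableT_comp.
pose D := \bigcup_n C n.
have mD : measurable D by exact: measurable_bigcup_count.
have DA : D `<=` A by move=> x [[|n] _ []] // /AA.
have mAD : measurable (A `\` D) by exact: measurableD.
have ADA' : A `\` D `<=` A'.
  move=> x [Ax nD]; apply: contrapT => nA'; apply: nD; exists 0%N => //; split=> //.
(* [f] is used on [D] and the inverse of [g] on [A \ D]; [F] lists the corresponding images in
   [B]. *)
pose E b : set X := if b then D else A `\` D.
pose F b : set X := if b then B' `&` f' @^-1` D else B `&` g @^-1` (A `\` D).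
have D_succ y : B' y -> D (f' y) -> D (g y).
  move=> B'y [n _ Cn]; exists n.+1 => //=; have By := BB _ B'y.
  split; first exact: gB.
  by rewrite gK//.
have -> : A = \bigcup_b E b.
  apply/seteqP; split=> [x Ax|x [[] _]]; [|exact: DA|by case].
  by have [Dx|nD] := pselect (D x); [exists true|exists false].
have -> : B = \bigcup_b F b.
  apply/seteqP; split=> [y By|y [[] _] [] // /BB//].
  have [[n _]|nD] := pselect (D (g y)); last by exists false => //; split=> //; split=> //; exact/AA/gB.
  case: n => [[_ []]|n /= [_]]; first exact: gB.
  by rewrite gK// => -[B'y Cn]; exists true => //; split=> //; exists n.
apply: equidec_bigcup.
- by move=> [] [] x //= => [Dx [_ /(_ Dx)]|[_ nD] /nD].
- move=> [] [] y //= => [[B'y Dy] [_ [_ []]]|[_ [_ nD]] [B'y Dy]].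
    exact: D_succ.
  by case: nD; exact: D_succ.
move=> [] /=; first by exists f, f'; exact: piso_restrict pf.
exists g', g; have := piso_restrict mAD ADA' (piso_sym pg).
by [].
Qed.

Lemma ergodic_invariant A : ergodic T -> measurable A -> invariant_set T A ->
  mu A <> 0%E -> mu (~` A) = 0%E.
Proof.
move=> erg mA iA; have [| |A1 _] := erg A mA; [|by []|].
  apply/seteqP; split=> [_ [x Ax <-]|x Ax]; first exact: iA (same_orbit_aut _ _) Ax.
  by exists (autV T x); [exact: iA (same_orbit_autV _ _) Ax|rewrite autVK].
by rewrite probability_setC// A1 subee.
Qed.

Lemma ergodic_saturation A : ergodic T -> measurable A -> mu A <> 0%E ->
  mu (~` saturation T A) = 0%E.
Proof.
move=> erg mA A0; apply: ergodic_invariant => //.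
- exact: measurable_saturation.
- exact: invariant_saturation.
- move=> sA0; apply: A0; apply: null_subset sA0 => //.
    exact: measurable_saturation.
  exact: sub_saturation.
Qed.

(** Infinitely many disjoint copies of a single non-null set leave room in [B] for any measurable
    set up to null sets, see [embed_wandering]. *)
Definition wandering_copies B := exists C : nat -> set X,
  [/\ forall i, C i `<=` B, forall i j x, C i x -> C j x -> i = j,
      mu (C 0%N) <> 0%E & forall i, equidec (C 0%N) (C i)].

(** By ergodicity the translates of [C 0] cover almost all of [A]. The piece of [A] first caught by
    the k-th translate is moved into [C 0] and from there into its own copy [C k]. Pieces may
    overlap inside [C 0], but the copies are disjoint, so the union of these moves is injective. *)
Lemma embed_wandering A B : ergodic T -> measurable A -> wandering_copies B ->
  exists A' B', [/\ A' `<=` A, mu (A `\` A') = 0%E, B' `<=` B & equidec A' B'].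
Proof.
move=> erg mA [C [CB dC C0 eC]].
have [f0 [g0 p0]] := eC 0%N; have mC0 := piso_mdom p0.
(* An enumeration of the integers with repetitions of the default 0; a repeated time contributes an
   empty [D k]. *)
pose z k : int := odflt 0 (unpickle k).
have zS n : exists k, z k = n by exists (pickle n); rewrite /z pickleK.
pose E k := [set x | C 0%N (aut_iter T (z k) x)].
have mE k : measurable (E k) by exact: measurable_preimage_iter.
pose D k := A `&` (E k `\` \bigcup_(j in [set j | (j < k)%N]) E j).
have mD k : measurable (D k).
  apply: measurableI => //; apply: measurableD => //.
  exact: bigcup_measurable.
have dD i j x : D i x -> D j x -> i = j.
  move=> [_ [Ei ni]] [_ [Ej nj]]; case: (ltngtP i j) => // ij.
    by case: nj; exists i.
  by case: ni; exists j.
have /choice[F FP] : forall k, exists F, F `<=` C k /\ equidec (D k) F.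
  move=> k; have [f [g pfg]] := eC k.
  have p1 := piso_iter (z k) mC0.
  have DE : D k `<=` aut_iter T (z k) @^-1` C 0%N by move=> x [_ []].
  have := piso_restrict (mD k) DE (piso_trans p1 pfg).
  set F := _ `&` _ => pF; exists F; split; first by move=> x [].
  by eexists; eexists; exact: pF.
exists (\bigcup_k D k), (\bigcup_k F k); split.
- by move=> x [k _ []].
- apply: null_subset (ergodic_saturation erg mC0 C0).
  + by apply: measurableD => //; exact: measurable_bigcup_count.
  + by apply: measurableC; exact: measurable_saturation.
  move=> x [Ax nD] [n]; have [k <-] := zS n => Ck.
  have exk : exists k, `[< E k x >] by exists k; apply/asboolP.
  apply: nD; exists (ex_minn exk) => //.
  case: ex_minnP => m /asboolP Em mmin; split=> //; split=> // -[j /= jm Ej].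
  by move: (mmin j); rewrite leqNgt jm => /(_ _)/negP; apply; [apply/asboolP|].
- by move=> x [k _] /(FP k).1/CB.
- apply: equidec_bigcup dD _ _ => [i j x /(FP i).1 Ci /(FP j).1|i].
    exact: dC Ci.
  exact: (FP i).2.
Qed.

(** Each set embeds in the other up to a null set. Removing the saturation [N] of both errors leaves
    an invariant set on which the embeddings are total, so that the Schroder-Bernstein argument
    applies. *)
Lemma equidec_wandering A B : ergodic T -> measurable A -> measurable B ->
  wandering_copies A -> wandering_copies B ->
  exists A' B', [/\ A' `<=` A, mu (A `\` A') = 0%E, B' `<=` B,
    mu (B `\` B') = 0%E & equidec A' B'].
Proof.
move=> erg mA mB wA wB.
have [A1 [B1 [A1A A10 B1B eA]]] := embed_wandering erg mA wB.
have [B2 [A2 [B2B B20 A2A eB]]] := embed_wandering erg mB wA.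
have [f [f' pf]] := eA; have [g [g' pg]] := eB.
have mA1 := piso_mdom pf; have mB2 := piso_mdom pg.
pose N := (A `\` A1) `|` (B `\` B2).
have mN : measurable N by apply: measurableU; exact: measurableD.
have N0 : mu N = 0%E by apply: nullU => //; exact: measurableD.
pose G := ~` saturation T N.
have mG : measurable G by apply: measurableC; exact: measurable_saturation.
have iG : invariant_set T G by apply: invariant_setC; exact: invariant_saturation.
have G0 : mu (~` G) = 0%E by rewrite setCK; exact: null_saturation.
have GN x : G x -> ~ N x by move=> Gx Nx; apply: Gx; exact: sub_saturation.
have conull C : measurable C -> mu (C `\` (C `&` G)) = 0%E.
  move=> mC; apply: null_subset G0; [|exact: measurableC|by move=> x [Cx nG] Gx; apply: nG].
  by apply: measurableD => //; exact: measurableI.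
exists (A `&` G), (B `&` G); split; [by move=> x []|exact: conull|by move=> x []
  |exact: conull|].
have AG : A `&` G `<=` A1.
  by move=> x [Ax /GN Nx]; apply: contrapT => nA; apply: Nx; left.
have BG : B `&` G `<=` B2.
  by move=> x [Ax /GN Nx]; apply: contrapT => nA; apply: Nx; right.
have mAG : measurable (A `&` G) by exact: measurableI.
have mBG : measurable (B `&` G) by exact: measurableI.
have pf' := piso_restrict mAG AG pf; have pg' := piso_restrict mBG BG pg.
apply: equidec_schroder_bernstein; last 2 first.
- by exists f, f'; exact: pf'.
- by exists g, g'; exact: pg'.
- move=> x [A2x /= [_ Gx]]; split; first exact: A2A.
  by apply: iG Gx; apply: same_orbit_sym; exact: (piso_orbit (piso_sym pg)).
- move=> x [B1x /= [_ Gx]]; split; first exact: B1B.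
  by apply: iG Gx; apply: same_orbit_sym; exact: (piso_orbit (piso_sym pf)).
Qed.

End equidecomposability.

(** * Induced transformations and recurrence *)

Section invariant_measures.
Context {R : realType} {d : measure_display} {X : measurableType d}.
Context {mu : probability X R}.
Implicit Types (A B C : set X) (S : nsaut mu).

Lemma measure_intro (nu : set X -> \bar R) : nu set0 = 0%E ->
  (forall A, (0 <= nu A)%E) -> semi_sigma_additive nu ->
  exists m : {measure set X -> \bar R}, forall A, m A = nu A.
Proof.
move=> nu0 nu_ge0 nu_sa.
pose mix := isMeasure.Build _ _ _ nu nu0 nu_ge0 nu_sa.
pose m : {measure set X -> \bar R} := HB.pack nu mix.
by exists m.
Qed.

Lemma measure_pushforward (lam : {measure set X -> \bar R}) (f : X -> X) (D : set X) :
  measurable_fun setT f -> measurable D ->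
  exists m : {measure set X -> \bar R}, forall A, m A = lam (f @^-1` (A `&` D)).
Proof.
move=> mf mD; apply: measure_intro => // [|F mF tF mUF].
  by rewrite set0I preimage_set0 measure0.
rewrite setI_bigcupl preimage_bigcup; apply: measure_semi_sigma_additive.
- by move=> n; apply: measurable_preimage => //; exact: measurableI.
- apply/trivIsetP => /= i j _ _ ij; rewrite -preimage_setI setIACA.
  by move/trivIsetP : tF => /(_ _ _ _ _ ij) ->//; rewrite set0I preimage_set0.
- rewrite -preimage_bigcup -setI_bigcupl; apply: measurable_preimage => //.
  exact: measurableI.
Qed.

Lemma first_return (S : X -> X) A :
  measurable_fun setT S -> measurable A ->
  (forall x, A x -> exists m, A (iter m.+1 S x)) ->
  exists F, [/\ measurable_fun setT F, forall x, ~ A x -> F x = x &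
    forall x, A x -> exists m, [/\ F x = iter m.+1 S x, A (F x) &
      forall j, (j < m)%N -> ~ A (iter j.+1 S x)]].
Proof.
move=> mS mA ret.
pose C m := A `&` (iter m.+1 S @^-1` A `\`
  \bigcup_(j in [set j | (j < m)%N]) (iter j.+1 S @^-1` A)).
have mit m : measurable (iter m.+1 S @^-1` A).
  by apply: measurable_preimage => //; exact: measurable_iter.
have mC m : measurable (C m).
  apply: measurableI => //; apply: measurableD => //.
  exact: bigcup_measurable.
have dC i j x : C i x -> C j x -> i = j.
  move=> [_ [Ei ni]] [_ [Ej nj]]; case: (ltngtP i j) => // ij.
    by case: nj; exists i.
  by case: ni; exists j.
have [//||i j x Ci Cj|F [mF FC Fn]] := @measurable_glue _ X nat C (fun m => iter m.+1 S).
- by move=> i; exact: measurable_iter.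
- by rewrite (dC _ _ _ Ci Cj).
exists F; split=> // [x nA|x Ax]; first by apply: Fn => m [].
have exm : exists m, `[< A (iter m.+1 S x) >].
  by have [m Am] := ret x Ax; exists m; apply/asboolP.
case: (ex_minnP exm) => m /asboolP Am mmin.
have mj j : (j < m)%N -> ~ A (iter j.+1 S x).
  by move=> jm Aj; have := mmin j; rewrite leqNgt jm => /(_ _)/negP; apply;
    first exact/asboolP.
have Cm : C m x by split=> //; split=> // -[j /mj].
by exists m; rewrite (FC _ _ Cm); split.
Qed.

Lemma iter_cancel (S S' : X -> X) i j x : cancel S S' ->
  iter i S' (iter (i + j) S x) = iter j S x.
Proof. by move=> SK; elim: i => // i IH; rewrite addSn iterSr /= SK. Qed.

(** The first return map of the inverse undoes the first return map of [S]: if the two return times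
    differed, the shorter one would yield a visit to [A] strictly before the longer one ends, as
    [key] shows. *)
Lemma induced_aut S A : measurable A ->
  (forall x, A x -> exists m, A (iter m.+1 S x)) ->
  (forall x, A x -> exists m, A (iter m.+1 (autV S) x)) ->
  exists U : nsaut mu, [/\ orbital S U, forall x, ~ A x -> U x = x &
    forall x, A x -> exists m, [/\ U x = iter m.+1 S x, A (U x) &
      forall j, (j < m)%N -> ~ A (iter j.+1 S x)]].
Proof.
move=> mA fwd bwd.
have [F [mF Fn FA]] := first_return (measurable_aut S) mA fwd.
have [G [mG Gn GA]] := first_return (measurable_autV S) mA bwd.
have key (f g : X -> X) m m' x : cancel f g -> A x -> A (iter m.+1 f x) ->
    (forall j, (j < m)%N -> ~ A (iter j.+1 f x)) ->
    A (iter m'.+1 g (iter m.+1 f x)) ->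
    (forall j, (j < m')%N -> ~ A (iter j.+1 g (iter m.+1 f x))) ->
    iter m'.+1 g (iter m.+1 f x) = x.
  move=> fK Ax Am mmin Am' mmin'.
  have e i k : iter i g (iter (i + k) f x) = iter k f x by exact: iter_cancel.
  case: (ltngtP m m') => [mm|mm|->]; last by have := e m'.+1 0%N; rewrite addn0.
    by case: (mmin' _ mm); have := e m.+1 0%N; rewrite addn0 => ->.
  case: (mmin (m - m'.+1)%N); first by rewrite -subSn// subSS leq_subr.
  have := e m'.+1 (m - m'.+1).+1; rewrite addnS subnKC// => <-.
  exact: Am'.
have [|||U [UF UG]] := @aut_builder _ _ _ mu S F G mF mG.
- move=> x; have [/FA[m [-> _ _]]|/Fn ->] := pselect (A x); last exact: same_orbit_refl.
  by exists m.+1%:Z.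
- move=> x; have [Ax|nA] := pselect (A x); last by rewrite Fn// Gn.
  have [m [e Am mmin]] := FA x Ax; have [m' [e' Am' mmin']] := GA _ Am.
  rewrite e' e; apply: key mmin _ _ => //; [exact: autK|by rewrite -e| |].
    by rewrite -e -e'.
  by rewrite -e.
- move=> x; have [Ax|nA] := pselect (A x); last by rewrite Gn// Fn.
  have [m [e Am mmin]] := GA x Ax; have [m' [e' Am' mmin']] := FA _ Am.
  rewrite e' e; apply: key mmin _ _ => //; [exact: autVK|by rewrite -e| |].
    by rewrite -e -e'.
  by rewrite -e.
exists U; rewrite UF; split=> // x; have [Ax|nA] := pselect (A x).
  have [m [e _ _]] := FA x Ax; rewrite e.
  by exists m.+1%:Z.
by rewrite Fn//; exact: same_orbit_refl.
Qed.

Lemma aut_iter_inv S n x : aut_iter (aut_inv S) n x = aut_iter S (- n) x.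
Proof. by case: n => [[|n]|n]. Qed.

(** The known visit may lie far in the past; each visit is followed by a later one, so after
    [|n0| + 1] further visits the time is positive. *)
Lemma later_return S A x : (exists n, A (aut_iter S n x)) ->
  (forall n, A (aut_iter S n x) -> exists m, A (iter m.+1 S (aut_iter S n x))) ->
  exists m, A (iter m.+1 S x).
Proof.
move=> [n0 A0] ret.
have step k : exists n : int, n0 + k%:Z <= n /\ A (aut_iter S n x).
  elim: k => [|k [n [kn An]]]; first by exists n0; rewrite addr0.
  have [m Am] := ret n An; exists (m.+1%:Z + n); split; last by rewrite -aut_iterD.
  by lia.
have [n [kn An]] := step (absz n0).+1.
have n_gt0 : 0 < n by lia.
by case: n n_gt0 An {kn} => [[|n]|n]// _ An; exists n.
Qed.

(** * Recurrence from the absence of invariant measures *)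

Section type_III_measures.
Variable T : nsaut mu.
Hypothesis hIII : type_III T.

(* The orbits of a measure on [A] invariant under the partial maps T^n between
   subsets of [A] add up to a sigma-finite T-invariant measure on [X]. *)
Lemma no_locally_invariant_measure A (lam : {measure set X -> \bar R}) :
  ergodic T -> measurable A -> mu A <> 0%E -> (lam A < +oo)%E ->
  (forall B, measurable B -> B `<=` A -> lam B = 0%E <-> mu B = 0%E) ->
  (forall (n : nat) C, measurable C -> C `<=` A -> aut_iter T n @^-1` C `<=` A ->
    lam (aut_iter T n @^-1` C) = lam C) -> False.
Proof.
move=> erg mA A0 lamA lam_mu lam_inv; apply: hIII.
(* Negative powers reduce to positive ones by applying the hypothesis to the preimage of [C]. *)
have {}lam_inv (n : int) C : measurable C -> C `<=` A ->
    aut_iter T n @^-1` C `<=` A -> lam (aut_iter T n @^-1` C) = lam C.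
  case: n => n mC CA TCA; first exact: lam_inv.
  pose m := n.+1.
  have e : aut_iter T m @^-1` (aut_iter T (Negz n) @^-1` C) = C.
    rewrite -comp_preimage (_ : _ \o _ = id)//.
    by apply/funext => x; exact: (aut_iterK T m x).
  by rewrite -[in RHS]e lam_inv//; [exact: measurable_preimage_iter|rewrite e].
pose z k : int := odflt 0 (unpickle k).
have zS n : exists k, z k = n by exists (pickle n); rewrite /z pickleK.
pose E k := aut_iter T (z k) @^-1` A.
have mE k : measurable (E k) by exact: measurable_preimage_iter.
pose D k := E k `\` \bigcup_(j in [set j | (j < k)%N]) E j.
have mD k : measurable (D k) by apply: measurableD => //; exact: bigcup_measurable.
have dD i j x : D i x -> D j x -> i = j.
  move=> [Ei ni] [Ej nj]; case: (ltngtP i j) => // ij.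
    by case: nj; exists i.
  by case: ni; exists j.
pose Y := saturation T A.
have mY : measurable Y by exact: measurable_saturation.
have YD x : Y x -> exists k, D k x.
  case=> n; have [k <-] := zS n => Ek.
  have exk : exists k, `[< E k x >] by exists k; apply/asboolP.
  exists (ex_minn exk).
  case: ex_minnP => m /asboolP Em mmin; split=> // -[j /= jm Ej].
  by move: (mmin j); rewrite leqNgt jm => /(_ _)/negP; apply; [apply/asboolP|].
(* [m k] carries the part of a set in [D k] into [A] by the power [z k] of [T] and measures it
   there; [nu] is the sum of these. *)
have /choice[m mP] : forall k, exists m : {measure set X -> \bar R},
    forall B, m B = lam (aut_iter T (- z k) @^-1` (B `&` D k)).
  by move=> k; apply: measure_pushforward => //; exact: measurable_aut_iter.
pose nu : {measure set X -> \bar R} := mseries m 0.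
have nuE B : nu B = (\sum_(k <oo) m k B)%E by [].
have DA k B : aut_iter T (- z k) @^-1` (B `&` D k) `<=` A.
  by move=> x /= [_ [+ _]]; rewrite /E /= aut_iterVK.
have measure_DA k B : measurable B ->
    lam (aut_iter T (- z k) @^-1` (B `&` D k)) = 0%E <-> mu (B `&` D k) = 0%E.
  move=> mB; have mBD : measurable (B `&` D k) by exact: measurableI.
  rewrite lam_mu; [exact: null_preimage_iter|exact: measurable_preimage_iter|exact: DA].
have nu0 B : nu B = 0%E <-> forall k, m k B = 0%E.
  rewrite nuE; split=> [|m0]; last by rewrite eseries0.
  move=> s0 k; apply/eqP; rewrite eq_le measure_ge0 andbT -s0.
  by rewrite (@nneseriesD1 _ _ k)// leeDl// nneseries_ge0.
have nu_mu B : measurable B -> nu B = 0%E <-> mu B = 0%E.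
  move=> mB; split=> [/nu0 m0|B0]; last first.
    apply/nu0 => k; rewrite mP; apply/measure_DA => //.
    by apply: null_subset B0 => //; exact: measurableI.
  have sub : B `<=` (\bigcup_k (B `&` D k)) `|` ~` Y.
    move=> x Bx; have [/YD[k Dk]|] := pselect (Y x); last by right.
    by left; exists k.
  have mBD k : measurable (B `&` D k) by exact: measurableI.
  apply: null_subset sub _ => //.
    by apply: measurableU; [exact: measurable_bigcup_count|exact: measurableC].
  apply: nullU; [exact: measurable_bigcup_count|exact: measurableC| |
    exact: ergodic_saturation].
  by apply: null_bigcup => // k; apply/measure_DA => //; rewrite -mP.
have nuD k : nu (D k) = m k (D k).
  rewrite nuE (@nneseriesD1 _ _ k)// eseries0 ?adde0// => i _ /= ik.
  rewrite mP (_ : _ `&` _ = set0) ?preimage_set0 ?measure0//.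
  by apply/seteqP; split=> // x [Dk Di]; case/eqP: ik; exact: dD Di Dk.
have Y0 : mu (~` Y) = 0%E by exact: ergodic_saturation.
have piece k B (F : nat -> set X) : measurable B -> (forall j, measurable (F j)) ->
    (forall i j x, F i x -> F j x -> i = j) -> B `&` D k `<=` \bigcup_j F j ->
    m k B = (\sum_(j <oo) lam (aut_iter T (- z k) @^-1` (B `&` D k `&` F j)))%E.
  move=> mB mF dF BF; rewrite mP -measure_semi_bigcup.
  - by rewrite -preimage_bigcup -setI_bigcupr (setIidl BF).
  - move=> j; apply: measurable_preimage_iter; apply: measurableI => //.
    exact: measurableI.
  - apply/trivIsetP => i j _ _ ij; apply/seteqP; split=> // x [[_ Fi] [_ Fj]].
    by case/eqP: ij; exact: dF Fi Fj.
  - apply: measurable_bigcup_count => j; apply: measurable_preimage_iter.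
    by apply: measurableI => //; exact: measurableI.
exists nu; split.
(* The cover consists of the null complement of [Y] at index 0, then of the [D k], each of measure
   at most [lam A]. *)
- exists (fun k => if k is k'.+1 then D k' else ~` Y).
    apply/seteqP; split=> // x _; have [/YD[k Dk]|nY] := pselect (Y x).
      by exists k.+1.
    by exists 0%N.
  case=> [|k]; first by split; [exact: measurableC|rewrite (nu_mu _ _).2//; exact: measurableC].
  split=> //; rewrite nuD mP; apply: le_lt_trans lamA.
  apply: le_measure; rewrite ?inE//.
  by apply: measurable_preimage_iter; exact: measurableI.
- by apply/null_content_dominatesP => B mB /(nu_mu B mB).
- by apply/null_content_dominatesP => B mB /(nu_mu B mB).
move=> B mB; rewrite image_aut.
have mTB : measurable (autV T @^-1` B) by exact: measurable_preimage_autV.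
(* The points of [B] in [D j] that [T] sends into [D k]. Both [nu B] and the measure of the image of
   [B] are double sums over these pieces: a piece is carried into [A] in two ways, which differ by a
   power of [T] between subsets of [A]. *)
pose Q k j := B `&` D j `&` (T @^-1` D k).
have mQ k j : measurable (Q k j).
  apply: measurableI; first exact: measurableI.
  exact: measurable_preimage_aut.
have T1 k x : aut_iter T k (T x) = aut_iter T (k + 1) x by rewrite -aut_iterD.
have V1 k x : aut_iter T k (autV T x) = aut_iter T (k - 1) x by rewrite -aut_iterD.
transitivity (\sum_(k <oo) \sum_(j <oo)
    lam (aut_iter T (- z j) @^-1` (Q k j)))%E; last first.
  rewrite nneseries_interchange// nuE; apply: eq_eseriesr => j _.
  apply/esym/piece => //.
  - by move=> k; exact: measurable_preimage_aut.
  - by move=> i k x; exact: dD.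
  - move=> x [Bx [Ex _]]; have /YD[k Dk] : Y (T x); last by exists k.
    by exists (z j - 1); rewrite T1 subrK.
rewrite nuE; apply: eq_eseriesr => k _.
rewrite (piece k _ (fun j => autV T @^-1` D j))//; first last.
- move=> x [Bx [Ex _]]; have /YD[j Dj] : Y (autV T x); last by exists j.
  by exists (z k + 1); rewrite V1 addrK.
- by move=> i j x; exact: dD.
- by move=> j; exact: measurable_preimage_autV.
apply: eq_eseriesr => j _.
have mQj : measurable (aut_iter T (- z j) @^-1` Q k j) by exact: measurable_preimage_iter.
have e : aut_iter T (- z k) @^-1` (autV T @^-1` B `&` D k `&` autV T @^-1` D j) =
   aut_iter T (z j - z k - 1) @^-1` (aut_iter T (- z j) @^-1` Q k j).
  have VE y : autV T y = aut_iter T (- 1) y by [].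
  have TE y : T y = aut_iter T 1 y by [].
  have e1 : - z j + (z j - z k - 1) = - z k - 1 by lia.
  have e2 : - 1 + - z k = - z k - 1 by lia.
  have e3 : 1 + (- z k - 1) = - z k by lia.
  apply/seteqP; split=> x; rewrite /Q /= !VE TE !aut_iterD e1 e2 e3.
    by move=> [[]].
  by move=> [[]].
rewrite e lam_inv//.
  by move=> x /= [[_ [+ _]] _]; rewrite /E /= aut_iterVK.
by rewrite -e => x /= [[_ [+ _]] _]; rewrite /E /= aut_iterVK.
Qed.

(** On a wandering set local invariance is vacuous: no positive power of [T] joins two of its
    points. The restriction of [mu] to a non-null one would therefore contradict type III. *)
Lemma wandering_null W : ergodic T -> measurable W ->
  (forall x m, W x -> ~ W (iter m.+1 T x)) -> mu W = 0%E.
Proof.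
move=> erg mW wW; apply: contrapT => W0.
have [lam lamE] := measure_pushforward mu (@measurable_id _ X setT) mW.
have {}lamE B : lam B = mu (B `&` W) by rewrite lamE.
apply: (@no_locally_invariant_measure W lam) => //.
- rewrite lamE; apply: le_lt_trans (ltry 1).
  by apply: probability_le1; exact: measurableI.
- by move=> B mB BW; rewrite lamE (setIidl BW).
move=> [//|n] C mC CW TC; have C0 x : ~ C (aut_iter T n.+1 x).
  by move=> Cx; exact: (wW _ n (TC x Cx) (CW _ Cx)).
have -> : aut_iter T n.+1 @^-1` C = set0 by apply/seteqP; split=> // x /C0.
suff -> : C = set0 by [].
apply/seteqP; split=> // x; rewrite -(aut_iterVK T n.+1 x); exact: C0.
Qed.

(** Poincare recurrence, with [wandering_null] in place of an invariant measure. Points of [A] that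
    never return, and points of [A] that were never in [A] before, form wandering sets; the
    saturation of both is discarded. *)
Lemma recurrence A : ergodic T -> measurable A -> mu A <> 0%E ->
  exists G, [/\ measurable G, invariant_set T G, mu (~` G) = 0%E,
    forall x, G x -> exists m, A (iter m.+1 T x) &
    forall x, G x -> exists m, A (iter m.+1 (autV T) x)].
Proof.
move=> erg mA A0.
pose W (S : X -> X) := A `&` [set x | forall m, ~ A (iter m.+1 S x)].
have mW (f : X -> X) : measurable_fun setT f -> measurable (W f).
  move=> mS; apply: measurableI => //; apply: measurable_forall => m.
  apply: measurableC; apply: measurable_preimage => //.
  exact: measurable_iter.
have mWT : measurable (W T) by apply: mW; exact: measurable_aut.
have mWV : measurable (W (autV T)) by apply: mW; exact: measurable_autV.
have W0 : mu (W T) = 0%E.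
  by apply: wandering_null => // x m [_ nA] [Am _]; exact: nA Am.
have V0 : mu (W (autV T)) = 0%E.
  apply: wandering_null => // x m [Ax _] [_ /(_ m)].
  by have := iter_cancel m.+1 0 x (autK T); rewrite addn0 /= => ->; apply.
pose N := W T `|` W (autV T).
have mN : measurable N by exact: measurableU.
exists (saturation T A `&` ~` saturation T N); split.
- apply: measurableI; first exact: measurable_saturation.
  by apply: measurableC; exact: measurable_saturation.
- apply: invariant_setI; first exact: invariant_saturation.
  by apply: invariant_setC; exact: invariant_saturation.
- rewrite setCI setCK; apply: nullU; [apply: measurableC| |exact: ergodic_saturation|].
  + exact: measurable_saturation.
  + exact: measurable_saturation.
  + by apply: null_saturation => //; exact: nullU.
- move=> x [[n An] nN]; apply: later_return; first by exists n.
  move=> {An}n An; apply: contrapT => nm; apply: nN; exists n; left; split=> //.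
  by move=> m Am; apply: nm; exists m.
- move=> x [[n An] nN]; apply: (@later_return (aut_inv T)).
    by exists (- n); rewrite aut_iter_inv opprK.
  move=> {An}n; rewrite aut_iter_inv => An; apply: contrapT => nm; apply: nN.
  by exists (- n); right; split=> // m Am; apply: nm; exists m.
Qed.

End type_III_measures.
End invariant_measures.

(** * Weakly wandering sets in type III *)

Section small_sets.
Context {R : realType} {d : measure_display} {X : measurableType d}.
Context (mu : probability X R).
Implicit Types (A B : set X).

Lemma probability_lty A : measurable A -> (mu A < +oo)%E.
Proof. by move=> mA; apply: le_lt_trans (ltry 1); exact: probability_le1. Qed.

Lemma decreasing_small (F : nat -> set X) (e : R) :
  (forall n, measurable (F n)) -> (forall m n, (m <= n)%N -> F n `<=` F m) ->
  mu (\bigcap_n F n) = 0%E -> 0 < e ->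
  exists N, forall n, (N <= n)%N -> (mu (F n) < e%:E)%E.
Proof.
move=> mF dF F0 e0.
have mI : measurable (\bigcap_n F n) by exact: bigcapT_measurable.
have cv : mu \o F @ \oo --> 0%E.
  rewrite -F0; apply: nonincreasing_cvg_mu => //; first exact: probability_lty.
  by move=> m n mn; apply/subsetPset; exact: dF.
have [|N _ NP] := cv [set x | (x < e%:E)%E].
  by apply: open_nbhs_nbhs; split; [exact: open_ereal_lt_ereal|rewrite /= lte_fin].
by exists N => n Nn; exact: NP.
Qed.

Lemma geometric_cover (F : nat -> set X) A (e : R) :
  0 <= e ->
  measurable A -> (forall n, measurable (F n)) -> A `<=` \bigcup_n F n ->
  (forall n, (mu (F n) <= (e / (2 ^ n.+1)%:R)%:E)%E) -> (mu A <= e%:E)%E.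
Proof.
move=> e0 mA mF AF Fe.
have h := @measure_sigma_subadditive _ _ _ mu A F mF mA AF.
apply: (le_trans h); apply: le_trans (epsilon_trick0 xpredT e0).
by apply: lee_nneseries => // n *; exact: Fe.
Qed.

Lemma limsup_null (F : nat -> set X) : (forall n, measurable (F n)) ->
  (forall n, (mu (F n) <= (1 / (2 ^ n.+1)%:R)%:E)%E) ->
  mu (lim_sup_set F) = 0%E.
Proof.
move=> mF Fe; apply: lim_sup_set_cvg0 => //.
apply: le_lt_trans (ltry 1).
apply: le_trans (epsilon_trick0 xpredT ler01).
by apply: lee_nneseries => // n *; exact: Fe.
Qed.

(** The epsilon-delta form of absolute continuity. Otherwise there are sets with summable measures
    whose preimages have measure at least [e]; their upper limit is null by Borel-Cantelli, while
    its preimage has measure at least [e]. *)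
Lemma null_preserving_small (f : X -> X) (e : R) : measurable_fun setT f ->
  (forall A, measurable A -> mu A = 0%E -> mu (f @^-1` A) = 0%E) -> 0 < e ->
  exists2 r : R, 0 < r &
    forall A, measurable A -> (mu A < r%:E)%E -> (mu (f @^-1` A) < e%:E)%E.
Proof.
move=> mf f0 e0; apply: contrapT => nr.
have /choice[F FP] : forall n, exists A, [/\ measurable A,
    (mu A < (1 / (2 ^ n.+1)%:R)%:E)%E & (e%:E <= mu (f @^-1` A))%E].
  move=> n; apply: contrapT => nA; apply: nr.
  exists (1 / (2 ^ n.+1)%:R); first by rewrite divr_gt0// ltr0n expn_gt0.
  move=> A mA Ae; rewrite ltNge; apply/negP => eA.
  by apply: nA; exists A.
have mF n : measurable (F n) by case: (FP n).
have L0 : mu (lim_sup_set F) = 0%E.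
  by apply: limsup_null => // n; case: (FP n) => _ /ltW.
have mL : measurable (lim_sup_set F).
  by apply: bigcap_measurable => // k _; exact: bigcup_measurable.
have [|m n mn x [k /= nk Fk]||N NP] := @decreasing_small
    (fun n => f @^-1` (\bigcup_(k in [set k | (n <= k)%N]) F k)) e _ _ _ e0.
- by move=> n; apply: measurable_preimage => //; exact: bigcup_measurable.
- by exists k => //=; exact: leq_trans nk.
- rewrite -preimage_bigcap; exact: f0.
have := NP N (leqnn _); apply/negP; rewrite -leNgt.
have [_ _ /le_trans] := FP N; apply.
apply: le_measure; rewrite ?inE; [exact: measurable_preimage| |].
  by apply: measurable_preimage => //; exact: bigcup_measurable.
by move=> x Fx; exists N => //=.
Qed.

End small_sets.

(** * Generalized limits of bounded sequences *)

Section banach_limit.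
Context {R : realType}.
Implicit Types (u v : nat -> R).

Definition bounded_seq u := exists M, forall n, `|u n| <= M.

(** The limit along an ultrafilter containing the cofinite sets. Shift invariance is not claimed; in
    [invariant_mean] it comes from averaging. *)
Lemma banach_limit : exists L : (nat -> R) -> R,
  [/\ forall u v, bounded_seq u -> bounded_seq v ->
        L (fun n => u n + v n) = L u + L v,
      forall u (a : R), bounded_seq u -> (forall n, a <= u n) -> a <= L u &
      forall u (l : R), u @ \oo --> l -> L u = l].
Proof.
have [U [UU sU]] := ultraFilterLemma (@eventually_filter).
have PU : ProperFilter U by exact: ultra_proper.
have cvgU u : bounded_seq u -> exists l : R, u @ U --> l.
  move=> [M uM]; have := @segment_compact R (- M) M.
  rewrite compact_ultra => /(_ (u @ U)) [].
  - split; first exact: fmap_proper_filter.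
    move=> G PG UG; rewrite predeqE => A; split=> [GA|]; last exact: UG.
    have [//|nA] := in_ultra_setVsetC (u @^-1` A) UU.
    by have [x []] := filter_ex (@filterI _ G _ _ _ GA (UG (~` A) nA)).
  - by apply: sU; exists 0%N => // n _ /=; rewrite in_itv/= -ler_norml.
  - by move=> l [_ ul]; exists l.
exists (fun u => lim (u @ U)); split.
- move=> u v /cvgU[l ul] /cvgU[k vk].
  rewrite (cvg_lim _ ul)// (cvg_lim _ vk)//; apply/cvg_lim => //.
  exact: cvgD.
- move=> u a /cvgU[l ul] au; apply: limr_ge; first by apply/cvg_ex; exists l.
  exact: nearW.
- move=> u l ul; apply/cvg_lim => //.
  by apply: cvg_trans ul; exact: cvg_app.
Qed.

End banach_limit.

(** * The countably additive part of a finitely additive measure *)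

Section countably_additive_part.
Context {R : realType} {d : measure_display} {X : measurableType d}.
Context (mu : probability X R).
Implicit Types (A B : set X).
Variable c : set X -> R.
Hypothesis c0 : c set0 = 0.
Hypothesis c_ge0 : forall A, measurable A -> 0 <= c A.
Hypothesis cU : forall A B, measurable A -> measurable B ->
  A `&` B = set0 -> c (A `|` B) = c A + c B.

(** The value on non-measurable sets is a placeholder: the outer measure [mu_ext] only looks at
    covers by measurable sets. *)
Let ce A : \bar R := if `[< measurable A >] then (c A)%:E else 0%E.

Let ceE A : measurable A -> ce A = (c A)%:E.
Proof. by move=> mA; rewrite /ce asboolT. Qed.

Let ce0 : ce set0 = 0%E.
Proof. by rewrite ceE// c0. Qed.

Let ce_ge0 A : (0 <= ce A)%E.
Proof. by rewrite /ce; case: asboolP => // mA; rewrite lee_fin; exact: c_ge0. Qed.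

Lemma additive_le A B : measurable A -> measurable B -> A `<=` B -> c A <= c B.
Proof.
move=> mA mB AB; rewrite -(setDUK AB) cU//; last by rewrite setDIK.
  by rewrite lerDl; apply: c_ge0; exact: measurableD.
exact: measurableD.
Qed.

Lemma additive_leU A B : measurable A -> measurable B -> c (A `|` B) <= c A + c B.
Proof.
move=> mA mB; have -> : A `|` B = A `|` (B `\` A).
  by rewrite setDE setUIr setUv setIT.
rewrite cU//; last by rewrite setDIK.
  by rewrite lerD2l; apply: additive_le => //; exact: measurableD.
exact: measurableD.
Qed.

Lemma additive_bigcup_le (F : nat -> set X) N : (forall n, measurable (F n)) ->
  ((c (\big[setU/set0]_(i < N) F i))%:E <= \sum_(i <oo) ce (F i))%E.
Proof.
move=> mF; apply: (@le_trans _ _ (\sum_(0 <= i < N) ce (F i))%E); last first.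
  by apply: nneseries_lim_ge.
elim: N => [|N IH]; first by rewrite big_ord0 c0 big_geq.
rewrite big_ord_recr big_nat_recr//= ceE//; apply: le_trans (leeD IH (lexx _)).
rewrite -EFinD lee_fin; apply: additive_leU => //.
exact: bigsetU_measurable.
Qed.

(** [m] is the outer measure generated by [c]. Finite additivity of [c] already makes measurable
    sets Caratheodory measurable, hence [m] countably additive. If [m A = 0], then [A] has countable
    covers of arbitrarily small total [c]; finite parts of such covers miss only a small part of
    [A], and intersecting a sequence of them gives [B]. *)
Lemma countably_additive_part : exists m : {measure set X -> \bar R},
  [/\ forall A, measurable A -> (m A <= (c A)%:E)%E,
      forall f, measurable_fun setT f ->
        (forall A, measurable A -> c (f @^-1` A) = c A) ->
        forall A, measurable A -> (m (f @^-1` A) <= m A)%E &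
      forall A, measurable A -> mu A <> 0%E -> m A = 0%E ->
        exists B, [/\ measurable B, B `<=` A, mu B <> 0%E & c B = 0]].
Proof.
pose mixo := isOuterMeasure.Build R X (mu_ext ce) (mu_ext0 ce0 ce_ge0)
  (mu_ext_ge0 ce_ge0) (le_mu_ext ce) (mu_ext_sigma_subadditive ce_ge0).
pose O : {outer_measure set X -> \bar R} := HB.pack (mu_ext ce) mixo.
have cara A : measurable A -> caratheodory_measurable O A.
  move=> mA; apply: le_caratheodory_measurable => Y.
  apply: le_ereal_inf_tmp => _ [B [mB YB] <-].
  have mBA k : measurable (B k `&` A) by exact: measurableI.
  have mBC k : measurable (B k `&` ~` A).
    by apply: measurableI => //; exact: measurableC.
  have -> : (\sum_(k <oo) ce (B k) =
      \sum_(k <oo) ce (B k `&` A) + \sum_(k <oo) ce (B k `&` ~` A))%E.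
    rewrite -nneseriesD//; apply: eq_eseriesr => k _.
    rewrite !ceE// -EFinD -cU//; first by rewrite setUIDK.
    by rewrite setIACA setICr setI0.
  apply: leeD; apply: ereal_inf_lbound.
    exists (fun k => B k `&` A) => //; split=> //.
    by rewrite -setI_bigcupl; exact: setSI.
  exists (fun k => B k `&` ~` A) => //; split=> //.
  by rewrite -setI_bigcupl; exact: setSI.
have [m mE] : exists m : {measure set X -> \bar R}, forall A, m A = mu_ext ce A.
  apply: measure_intro; [exact: (outer_measure0 O)|exact: (outer_measure_ge0 O)|].
  move=> F mF tF mUF; apply: (@caratheodory_measure_sigma_additive R X O) => //.
    by move=> i; exact: cara.
  exact: cara.
exists m; split.
- move=> A mA; rewrite mE -(ceE mA).
  have -> : ce A = (\sum_(k <oo) ce (if k is 0%N then A else set0))%E.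
    rewrite (@nneseriesD1 _ _ 0%N)// eseries0 ?adde0// => -[|k] _ //=.
  apply: ereal_inf_lbound; exists (fun k => if k is 0%N then A else set0) => //.
  split; first by case.
  by move=> x Ax; exists 0%N.
- move=> f mf cf A mA; rewrite !mE; apply: le_ereal_inf_tmp => _ [B [mB AB] <-].
  have mfB k : measurable (f @^-1` B k) by exact: measurable_preimage.
  apply: ereal_inf_lbound; exists (fun k => f @^-1` B k).
    by split=> // x /= /AB [k _ Bk]; exists k.
  by apply: eq_eseriesr => k _; rewrite !ceE// cf.
move=> A mA A0; rewrite mE => mA0.
have approx (e r : R) : 0 < e -> 0 < r -> exists D, [/\ measurable D, c D <= e &
    (mu (A `\` D) < r%:E)%E].
  move=> e0 r0; have : (mu_ext ce A < e%:E)%E by rewrite mA0 lte_fin.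
  move=> /ereal_inf_lt[_ [F [mF AF] <-] Fe].
  pose D n := \big[setU/set0]_(i < n) F i.
  have mD n : measurable (D n) by exact: bigsetU_measurable.
  have [|m' n mn x [Ax nD]||N NP] := @decreasing_small _ _ _ mu (fun n => A `\` D n) r _ _ _ r0.
  - by move=> n; exact: measurableD.
  - split=> // Dx; apply: nD; move: Dx; rewrite /D -!bigcup_mkord.
    by move=> [i /= im Fi]; exists i => //=; exact: leq_trans mn.
  - suff -> : \bigcap_n (A `\` D n) = set0 by [].
    apply/seteqP; split=> // x AD; have [Ax _] := AD 0%N I.
    have [k _ Fk] := AF x Ax; have [_] := AD k.+1 I; apply.
    by rewrite /D -bigcup_mkord; exists k => //=.
  exists (D N); split => //; last exact: NP.
  by rewrite -lee_fin; apply: le_trans (ltW Fe); exact: additive_bigcup_le.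
have muA_gt0 : 0 < fine (mu A).
  by apply: fine_gt0; rewrite probability_lty// andbT lt0e measure_ge0 andbT; exact/eqP.
have muAE : mu A = (fine (mu A))%:E.
  by rewrite fineK// fin_num_measure.
set a := fine (mu A) in muA_gt0 muAE.
(* The losses [(a / 2) / 2 ^ k.+1] add up to [a / 2], less than the measure [a] of [A], so the
   intersection keeps positive measure while [c] is at most every [k.+1%:R^-1] on it. *)
have /choice[D DP] : forall k : nat, exists D, [/\ measurable D,
    c D <= k.+1%:R^-1 & (mu (A `\` D) < ((a / 2) / (2 ^ k.+1)%:R)%:E)%E].
  by move=> k; apply: approx; rewrite ?invr_gt0// !divr_gt0// ltr0n expn_gt0.
have mD k : measurable (D k) by case: (DP k).
pose B := A `&` \bigcap_k D k.
have mB : measurable B by apply: measurableI => //; exact: bigcapT_measurable.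
exists B; split=> //; first by move=> x [].
  move=> B0; have mAD k : measurable (A `\` D k) by exact: measurableD.
  have sub : A `\` B `<=` \bigcup_k (A `\` D k).
    move=> x [Ax nB]; have /existsNP[k nD] : ~ forall k, D k x.
      by move=> Dx; apply: nB; split=> // k _; exact: Dx.
    by exists k.
  have : (mu (A `\` B) <= (a / 2)%:E)%E.
    apply: geometric_cover sub _ => //; [by rewrite ltW// divr_gt0//
      |exact: measurableD|by move=> n; case: (DP n) => _ _ /ltW].
  rewrite (measureDnull mA mB B0) muAE lee_fin leNgt => /negP; apply.
  by rewrite ltr_pdivrMr// ltr_pMr// ltr1n.
apply/eqP; rewrite eq_le c_ge0// andbT leNgt; apply/negP => cB.
have [k kP] : exists k : nat, k.+1%:R^-1 < c B.
  exists (Num.bound (c B)^-1); rewrite invf_plt ?posrE//.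
  by apply: lt_trans (archi_boundP _) _; rewrite ?invr_ge0 ?ltW// ltr_nat.
move: kP; apply/negP; rewrite -leNgt; have [_ + _] := DP k; apply: le_trans.
by apply: additive_le => // x [_ /(_ k I)].
Qed.

End countably_additive_part.

Section weakly_wandering.
Context {R : realType} {d : measure_display} {X : measurableType d}.
Context {mu : probability X R}.
Implicit Types (A B : set X) (U : nsaut mu).

(** Forward images of [A] under the powers of [U] in [s], written as preimages by the inverse. *)
Let images U (s : seq nat) A := \big[setU/set0]_(m <- s) (iter m (autV U) @^-1` A).

Lemma measurable_preimage_iterV U m A :
  measurable A -> measurable (iter m (autV U) @^-1` A).
Proof. exact: (measurable_preimage_iter (aut_inv U) m). Qed.

Lemma measurable_images U s A : measurable A -> measurable (images U s A).
Proof.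
move=> mA; rewrite /images; elim/big_ind : _ => //; first exact: measurableU.
by move=> m _; exact: measurable_preimage_iterV.
Qed.

Lemma images_small U s (e : R) : 0 < e -> exists2 r : R, 0 < r &
  forall A, measurable A -> (mu A < r%:E)%E -> (mu (images U s A) < e%:E)%E.
Proof.
elim: s e => [|m s IH] e e0.
  by exists 1 => // A _ _; rewrite /images big_nil measure0 lte_fin.
have e20 : 0 < e / 2 by rewrite divr_gt0.
have [r r0 rP] := IH _ e20.
have [||r' r'0 r'P] := @null_preserving_small _ _ _ mu (iter m (autV U)) _ _ _ e20.
- exact: (measurable_aut_iter (aut_inv U) m).
- by move=> A mA A0; exact/(null_preimage_iter (aut_inv U) m).
exists (Num.min r r'); first by rewrite lt_min r0.
move=> A mA; rewrite EFin_min lt_min => /andP[Ar Ar'].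
rewrite /images big_cons -/(images U s A).
have mI := measurable_images U s mA.
have mV := measurable_preimage_iterV U m mA.
apply: (@le_lt_trans _ _ (mu (iter m (autV U) @^-1` A) + mu (images U s A))%E).
  exact: measureU2.
by rewrite [e]splitr EFinD; apply: lteD; [exact: r'P|exact: rP].
Qed.

(* Hajian-Kakutani: the times [n_ i] are chosen inductively so that the points
   of [B] whose translates at two of these times overlap have small measure. *)
Lemma weakly_wandering U B : measurable B -> mu B <> 0%E ->
  (forall e : R, 0 < e -> exists n, (mu (iter n U @^-1` B) < e%:E)%E) ->
  exists W (n_ : nat -> nat), [/\ measurable W, W `<=` B, mu W <> 0%E &
    forall i j x, W (iter (n_ i) U x) -> W (iter (n_ j) U x) -> i = j].
Proof.
move=> mB B0 small.
have mpre n : measurable (iter n U @^-1` B) := measurable_preimage_iter U n mB.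
have b_gt0 : 0 < fine (mu B).
  by apply: fine_gt0; rewrite probability_lty// andbT lt0e measure_ge0 andbT; exact/eqP.
have bE : mu B = (fine (mu B))%:E by rewrite fineK// fin_num_measure.
set b := fine (mu B) in b_gt0 bE.
have b2_gt0 : 0 < b / 2 by rewrite divr_gt0.
have /choice[N NP] : forall s : seq nat, exists n,
    (mu (images U s (iter n U @^-1` B)) < (b / 2 / (2 ^ (size s).+1)%:R)%:E)%E.
  move=> s; have e0 : 0 < b / 2 / (2 ^ (size s).+1)%:R.
    by rewrite divr_gt0// ltr0n expn_gt0.
  have [r r0 rP] := images_small U s e0; have [n nr] := small r r0.
  by exists n; exact: rP.
(* [h k] lists the first [k] times, latest first; its length supplies the exponent in the bound of
   [NP]. *)
pose h := fix h k := if k is k'.+1 then N (h k') :: h k' else [::].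
have size_h k : size (h k) = k by elim: k => //= k ->.
have mem_h i j : (i < j)%N -> N (h i) \in h j.
  elim: j => //= j IH; rewrite ltnS leq_eqVlt => /orP[/eqP ->|ij].
    by rewrite inE eqxx.
  by rewrite inE IH ?orbT.
(* If [W] met the orbit of [x] at the times of index [i < j], the point at the earlier time would
   lie in [Q j]. The measures of the [Q k] add up to at most half of that of [B]. *)
pose Q k := images U (h k) (iter (N (h k)) U @^-1` B).
have mQ k : measurable (Q k) by exact: measurable_images.
have mUQ : measurable (\bigcup_k Q k) by exact: bigcupT_measurable.
have mW : measurable (B `\` \bigcup_k Q k) by exact: measurableD.
exists (B `\` \bigcup_k Q k), (fun k => N (h k)); split=> //.
- move=> W0; have : (mu (B `\` (B `\` \bigcup_k Q k)) <= (b / 2)%:E)%E.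
    apply: (@geometric_cover _ _ _ _ Q) => //; first exact: ltW.
    + exact: measurableD.
    + by move=> x [Bx nW]; apply: contrapT => nQ; apply: nW.
    + by move=> n; have := NP (h n); rewrite size_h => /ltW.
  rewrite (measureDnull mB mW W0) bE lee_fin leNgt => /negP; apply.
  by rewrite ltr_pdivrMr// ltr_pMr// ltr1n.
suff key i j x : (i < j)%N -> ~ ((B `\` \bigcup_k Q k) (iter (N (h i)) U x) /\
    (B `\` \bigcup_k Q k) (iter (N (h j)) U x)).
  move=> i j x Wi Wj; case: (ltngtP i j) => // ij; first by case: (key _ _ x ij).
  by case: (key _ _ x ij).
move=> ij [[_ nQ] [Bj _]]; apply: nQ; exists j => //.
rewrite /Q /images -bigcup_seq; exists (N (h i)); first exact: mem_h.
by rewrite /=; have := iter_cancel (N (h i)) 0 x (autK U); rewrite addn0 => ->.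
Qed.

Lemma same_orbit_orbital (S U : nsaut mu) x y : orbital S U ->
  same_orbit U x y -> same_orbit S x y.
Proof. by move=> oU [n ->]; exact: (orbital_iter n oU). Qed.

Lemma piso_orbital (S U : nsaut mu) A B f g : orbital S U ->
  piso U A B f g -> piso S A B f g.
Proof.
move=> oU [mA mB mf mg o fA gB fK gK]; split=> // x Ax.
exact: same_orbit_orbital (o x Ax).
Qed.

End weakly_wandering.

(** * An invariant mean from Cesaro averages *)

Section averages.
Context {R : realType} {d : measure_display} {X : measurableType d}.
Context {mu : probability X R} (U : nsaut mu).
Implicit Types (A B : set X).

Let p i B := fine (mu (iter i U @^-1` B)).
Let avg B n : R := n.+1%:R^-1 * \sum_(i < n.+1) p i B.

Let p_ge0 i B : 0 <= p i B. Proof. exact: fine_ge0. Qed.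

Let mpre i B : measurable B -> measurable (iter i U @^-1` B).
Proof. exact: (measurable_preimage_iter U i). Qed.

Let p_le1 i B : measurable B -> p i B <= 1.
Proof.
move=> mB; rewrite -lee_fin fineK ?fin_num_measure//; last exact: mpre.
by apply: probability_le1; exact: mpre.
Qed.

Let avg_ge B (e : R) : (forall i, e <= p i B) -> forall n, e <= avg B n.
Proof.
move=> ep n; rewrite /avg mulrC ler_pdivlMr ?ltr0n// mulr_natr.
rewrite -[X in _ *+ X](card_ord n.+1) -sumr_const.
by apply: ler_sum => i _.
Qed.

Let avg_le1 B : measurable B -> forall n, avg B n <= 1.
Proof.
move=> mB n; rewrite /avg mulrC ler_pdivrMr ?ltr0n// mul1r.
rewrite -[X in _ <= X%:R](card_ord n.+1) -sumr_const.
by apply: ler_sum => i _; exact: p_le1.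
Qed.

Let avg_bounded B : measurable B -> bounded_seq (avg B).
Proof.
move=> mB; exists 1 => n; rewrite ger0_norm; first exact: avg_le1.
by apply: avg_ge => i; exact: p_ge0.
Qed.

(** A generalized limit of the averages of [mu] over the first preimages under [U]. Replacing [B] by
    its preimage changes the n-th average by the boundary term [D n], of size at most [n.+1%:R^-1],
    which the limit does not see. *)
Lemma invariant_mean : exists c : set X -> R, [/\
  forall B, measurable B -> 0 <= c B,
  forall A B, measurable A -> measurable B -> A `&` B = set0 ->
    c (A `|` B) = c A + c B,
  forall B, measurable B -> mu B = 0%E -> c B = 0,
  forall B, measurable B -> c (U @^-1` B) = c B &
  forall B (e : R), measurable B ->
    (forall i, (e%:E <= mu (iter i U @^-1` B))%E) -> e <= c B].
Proof.
have [L [LD Lge Llim]] := @banach_limit R.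
exists (fun B => L (avg B)); split.
- move=> B mB; apply: Lge; first exact: avg_bounded.
  by apply: avg_ge => i; exact: p_ge0.
- move=> A B mA mB AB; rewrite -LD; [|exact: avg_bounded|exact: avg_bounded].
  congr L; apply/funext => n; rewrite /avg -mulrDr -big_split /=; congr (_ * _).
  apply: eq_bigr => i _; rewrite /p preimage_setU measureU; [|exact: mpre|exact: mpre|].
    by rewrite fineD// fin_num_measure//; exact: mpre.
  by rewrite -preimage_setI AB preimage_set0.
- move=> B mB B0; apply: Llim; rewrite (_ : avg B = cst 0); first exact: cvg_cst.
  apply/funext => n; rewrite /avg big1 ?mulr0// => i _.
  by rewrite /p (null_preimage_iter U i mB).2.
- move=> B mB; have mUB : measurable (U @^-1` B) by exact: measurable_preimage_aut.
  pose D n : R := n.+1%:R^-1 * (p n.+1 B - p 0 B).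
  have pS i : p i (U @^-1` B) = p i.+1 B by [].
  have -> : avg (U @^-1` B) = (fun n => avg B n + D n).
    apply/funext => n; rewrite /avg /D -mulrDr; congr (_ * _).
    rewrite [X in X + _]big_ord_recl.
    under [in LHS]eq_bigr do rewrite pS.
    rewrite big_ord_recr /=; under [in RHS]eq_bigr do rewrite /bump /= add1n.
    rewrite addrC [p 0 B + _]addrC addrACA subrr addr0 addrC //.
  rewrite LD; [|exact: avg_bounded|]; last first.
    exists 1 => n; rewrite normrM ger0_norm ?invr_ge0//.
    rewrite mulrC ler_pdivrMr ?ltr0n// mul1r; apply: (@le_trans _ _ 1).
      by rewrite ler_norml; apply/andP; split;
        have := p_ge0 n.+1 B; have := p_ge0 0 B; have := p_le1 n.+1 mB;
        have := p_le1 0 mB; lra.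
    by rewrite ler1n.
  rewrite (Llim D 0) ?addr0//.
  apply/cvgrPdist_le => e e0; near=> n.
  rewrite sub0r normrN normrM ger0_norm ?invr_ge0// mulrC ler_pdivrMr ?ltr0n//.
  apply: (@le_trans _ _ 1).
    by rewrite ler_norml; apply/andP; split;
      have := p_ge0 n.+1 B; have := p_ge0 0 B; have := p_le1 n.+1 mB;
      have := p_le1 0 mB; lra.
  rewrite -ler_pdivrMl// mulr1; near: n; exists (Num.bound e^-1) => // n /= bn.
  apply: le_trans (ltW (archi_boundP _)) _; first by rewrite invr_ge0 ltW.
  by rewrite ler_nat; exact: leq_trans bn _.
- move=> B e mB eB; apply: Lge; first exact: avg_bounded.
  apply: avg_ge => i; rewrite -lee_fin fineK ?fin_num_measure//.
  exact: mpre.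
Unshelve. all: by end_near. Qed.

End averages.

(** * Wandering copies inside every non-null set *)

Section type_III_wandering.
Context {R : realType} {d : measure_display} {X : measurableType d}.
Context {mu : probability X R} (T : nsaut mu).
Implicit Types (A B C : set X).
Hypotheses (erg : ergodic T) (hIII : type_III T).

Lemma wandering_copies_intro (U : nsaut mu) A B : orbital T U ->
  (forall x, U x \in A = (x \in A)) -> measurable B -> B `<=` A ->
  mu B <> 0%E ->
  (forall e : R, 0 < e -> exists n, (mu (iter n U @^-1` B) < e%:E)%E) ->
  wandering_copies T A.
Proof.
move=> oU UA mB BA B0 /(weakly_wandering mB B0)[W [n_ [mW WB W0 Wd]]].
have eW i : equidec T (iter (n_ i) U @^-1` W) W.
  eexists; eexists; apply: piso_orbital oU _.
  exact: (@piso_iter _ _ _ _ U (n_ i) W mW).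
have UAn n x : A (iter n U x) -> A x.
  by elim: n => //= n IH; rewrite -in_setE UA in_setE.
exists (fun i => iter (n_ i) U @^-1` W); split.
- by move=> i x /= /WB/BA/UAn.
- by move=> i j x /= Wi Wj; exact: Wd Wi Wj.
- by move=> C0; apply: W0; exact: equidec_null (eW 0%N) C0.
- by move=> i; exact: equidec_trans (eW 0%N) (equidec_sym (eW i)).
Qed.

(* Otherwise the countably additive part of an invariant mean of the
   transformation induced on [A] would be an equivalent invariant measure. *)
Lemma type_III_wandering A : measurable A -> mu A <> 0%E -> wandering_copies T A.
Proof.
move=> mA A0; have [G [mG iG G0 fwd bwd]] := recurrence hIII erg mA A0.
pose A' := A `&` G; have mA' : measurable A' by exact: measurableI.
have A'0 : mu A' <> 0%E.
  move=> A'0; apply: A0; rewrite -(@measureDnull _ _ _ mu A (~` G))//; last exact: measurableC.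
  by rewrite setDE setCK.
have G_iter m x : G x -> G (iter m T x).
  exact: iG (same_orbit_iter T x m).
have G_iterV m x : G x -> G (iter m.+1 (autV T) x).
  exact: iG (same_orbit_iter T x (Negz m)).
have [||U [oU Un UA]] := @induced_aut _ _ _ mu T A' mA'.
- by move=> x [Ax Gx]; have [m Am] := fwd x Gx; exists m; split=> //; exact: G_iter.
- by move=> x [Ax Gx]; have [m Am] := bwd x Gx; exists m; split=> //; exact: G_iterV.
have UA' x : A' (U x) <-> A' x.
  split=> [AUx|/UA[m []//]]; apply: contrapT => nA; apply: (nA).
  by rewrite -(Un _ nA).
apply: contrapT => nw.
(* If the preimages of [B] had arbitrarily small measure, a weakly wandering subset would provide
   the copies that are assumed not to exist. *)
have bounded B : measurable B -> B `<=` A' -> mu B <> 0%E ->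
    exists2 e : R, 0 < e & forall n, (e%:E <= mu (iter n U @^-1` B))%E.
  move=> mB BA B0; apply: contrapT => ne; apply: nw.
  have [C [CA dC C0 eC]] : wandering_copies T A'.
    apply: (wandering_copies_intro oU _ mB BA B0) => [x|e e0].
      by apply/idP/idP; rewrite !inE UA'.
    apply: contrapT => nn; apply: ne; exists e => // n; rewrite leNgt.
    by apply/negP => lt; apply: nn; exists n.
  by exists C; split=> // i x /CA[].
have [c [c_ge0 cU c_null c_inv c_gt]] := invariant_mean U.
have c0 : c set0 = 0 by apply: c_null => //; exact: measure0.
have [m [m_le m_inv m_pos]] := countably_additive_part mu c0 c_ge0 cU.
have c_invV B : measurable B -> c (autV U @^-1` B) = c B.
  move=> mB; rewrite -c_inv; last exact: measurable_preimage_autV.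
  rewrite -comp_preimage (_ : _ \o _ = id)//.
  by apply/funext => x /=; rewrite autK.
(* The countably additive part only comes with an inequality; using it for [U] and for its inverse
   gives equality. *)
have mU B : measurable B -> m (autV U @^-1` B) = m B.
  move=> mB; apply/eqP; rewrite eq_le; apply/andP; split.
    by apply: m_inv => //; exact: measurable_autV.
  have mVB : measurable (autV U @^-1` B) by exact: measurable_preimage_autV.
  have := m_inv U (measurable_aut U) c_inv _ mVB.
  rewrite -comp_preimage (_ : _ \o _ = id)//.
  by apply/funext => x /=; rewrite autK.
apply: (no_locally_invariant_measure hIII erg mA' A'0 (lam := m)).
- by apply: le_lt_trans (m_le _ mA') _; exact: ltry.
- move=> B mB BA; split=> [mB0|B0]; last first.
    apply/eqP; rewrite eq_le measure_ge0 andbT.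
    by have := m_le B mB; rewrite (c_null B mB B0).
  apply: contrapT => B0; have [C [mC CB C0 cC]] := m_pos B mB B0 mB0.
  have [e e0 eC] := bounded C mC (subset_trans CB BA) C0.
  by have := c_gt C e mC eC; rewrite cC leNgt e0.
move=> n C mC CA PA.
(* Invariance under the induced map is turned into invariance under powers of [T]. The set is split
   by first return time [r.+1]. A piece with [r >= n1] is empty, since time [n1] is itself a return;
   on the others [U] performs the first [r.+1] steps and induction the remaining ones. *)
elim/ltn_ind: n C mC CA PA => n IH C mC CA PA.
case: n IH PA => [//|n] IH PA; set n1 := n.+1 in IH PA *.
pose P := aut_iter T n1 @^-1` C.
have mP : measurable P by exact: measurable_preimage_iter.
pose ret r := [set x | A' (iter r.+1 T x) /\ forall j : 'I_r, ~ A' (iter j.+1 T x)].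
have mret r : measurable (ret r).
  apply: measurableI; first exact: (measurable_preimage_iter T r.+1).
  apply: measurable_forall => j; apply: measurableC.
  exact: (measurable_preimage_iter T j.+1).
pose Q r := P `&` ret r.
have mQ r : measurable (Q r) by exact: measurableI.
have dret i j x : ret i x -> ret j x -> i = j.
  move=> [Ai ni] [Aj nj]; case: (ltngtP i j) => // ij.
    by case: (nj (Ordinal ij)).
  by case: (ni (Ordinal ij)).
have UQ r x : Q r x -> U x = iter r.+1 T x.
  move=> [Px ret_r]; have [k [e Ak kmin]] := UA x (PA _ Px).
  suff -> : r = k by [].
  apply: (dret _ _ x) => //; split; first by rewrite -e.
  by move=> j; exact: kmin.
have PQ : P = \bigcup_r Q r.
  apply/seteqP; split=> [x Px|x [r _ []//]].
  have [k [e Ak kmin]] := UA x (PA _ Px); exists k => //; split=> //.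
  by split; [rewrite -e|move=> j; exact: kmin].
pose D r := aut_iter T (- n1%:Z) @^-1` Q r.
have mD r : measurable (D r) by exact: measurable_preimage_iter.
have CD : C = \bigcup_r D r.
  rewrite /D -preimage_bigcup -PQ /P -comp_preimage (_ : _ \o _ = id)//.
  by apply/funext => x; exact: (aut_iterVK T n1).
rewrite -/P PQ CD !measure_semi_bigcup//; last 4 first.
- apply/trivIsetP => i j _ _ ij; apply/seteqP; split=> // x [[_ Ri] [_ Rj]].
  by case/eqP: ij; exact: dret Ri Rj.
- by rewrite -CD.
- apply/trivIsetP => i j _ _ ij; apply/seteqP; split=> // x [[_ Ri] [_ Rj]].
  by case/eqP: ij; exact: dret Ri Rj.
- by rewrite -PQ.
apply: eq_eseriesr => r _; have [rn|nr] := ltnP r n1; last first.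
  have Q0 : Q r = set0.
    apply/seteqP; split=> // x [Px [_ /(_ (Ordinal nr))]]; apply.
    exact: CA Px.
  by rewrite /D Q0 preimage_set0 !measure0.
have UQD : autV U @^-1` Q r = aut_iter T (n1 - r.+1)%N @^-1` D r.
  have shift (y : X) : aut_iter T (- n1%:Z) (iter (n1 - r.+1) T y) =
      aut_iter T (- r.+1%:Z) y.
    rewrite -[iter _ _ _]/(aut_iter T (n1 - r.+1)%N y) aut_iterD; congr (aut_iter T _ y); lia.
  have DE y : D r (iter (n1 - r.+1) T y) = Q r (aut_iter T (- r.+1%:Z) y).
    by rewrite -shift.
  apply/seteqP; split=> y Qy.
    rewrite -[_ y]/(D r (iter (n1 - r.+1) T y)) DE -[y in aut_iter _ _ y](autVK U).
    by rewrite (UQ _ _ Qy) (aut_iterK T r.+1).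
  move: Qy; rewrite -[_ y]/(D r (iter (n1 - r.+1) T y)) DE => Qy.
  have := UQ _ _ Qy; rewrite -[iter _ _ _]/(aut_iter T r.+1 _) (aut_iterVK T r.+1).
  by move=> e; rewrite /= -e autK.
rewrite -(mU _ (mQ r)) UQD IH//; first by lia.
- by move=> x [Px _]; apply: CA; rewrite -(aut_iterVK T n1 x).
- rewrite -UQD => y /= [Py _]; rewrite -(autVK U y); apply/UA'; exact: PA.
Qed.

End type_III_wandering.

(** * What standardness provides: measurable equality sets and markers *)

Section standard_spaces.
Context {R : realType} {d : measure_display} {X : measurableType d}.
Context {mu : probability X R} (hmu : standard_probability mu).

Lemma measurable_eqset (f g : X -> X) : measurable_fun setT f ->
  measurable_fun setT g -> measurable [set x | f x = g x].
Proof.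
move=> mf mg; have [phi [[_ phi_inj _] mphi _ _]] := hmu.
have -> : [set x | f x = g x] = (fun x => phi (f x) - phi (g x)) @^-1` [set 0].
  apply/seteqP; split=> x /=; first by move->; rewrite subrr.
  by move=> /eqP; rewrite subr_eq0 => /eqP /phi_inj; apply; rewrite inE.
rewrite -[_ @^-1` _]setTI; apply: measurable_funB => //;
  exact: measurableT_comp.
Qed.

(** Intervals shrinking to 0, pulled back by the isomorphism with [[0, 1]]. They omit 0 so that the
    intersection is empty and not merely null. *)
Lemma vanishing_markers : exists A : nat -> set X, [/\
  forall k, measurable (A k), forall k, mu (A k) <> 0%E,
  forall j k, (j <= k)%N -> A k `<=` A j & forall x, exists k, ~ A k x].
Proof.
have [phi [_ mphi _ mu_phi]] := hmu.
pose I k : set R := `]0, k.+1%:R^-1[%classic.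
exists (fun k => phi @^-1` I k); split.
- by move=> k; rewrite -[_ @^-1` _]setTI; apply: mphi => //; exact: measurable_itv.
- move=> k; rewrite mu_phi; last exact: measurable_itv.
  rewrite setIidl; last first.
    move=> x; rewrite /I /= !in_itv /= => /andP[x0 xk]; rewrite ltW//=.
    by apply: le_trans (ltW xk) _; rewrite invf_le1// ler1n.
  rewrite /I lebesgue_measure_itv /= lte_fin invr_gt0 ltr0Sn oppr0 adde0.
  by move=> [] /eqP; rewrite invr_eq0 pnatr_eq0.
- move=> j k jk x; rewrite /I /= !in_itv /= => /andP[-> xk] /=.
  by apply: lt_le_trans xk _; rewrite lef_pV2 ?posrE// ler_nat.
move=> x; exists (Num.bound (phi x)^-1); rewrite /I /= in_itv /= => /andP[x0].
rewrite invf_pgt ?posrE// ltNge => /negP; apply; apply/ltW.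
by apply: lt_trans (archi_boundP _) _; rewrite ?invr_ge0 ?ltW// ltr_nat.
Qed.

End standard_spaces.

(** Positive words only; [act_back] recovers inverses on finite orbits. *)
Definition act (X : Type) n (g : 'I_n -> X -> X) (w : seq 'I_n) (x : X) : X :=
  foldr (fun i => g i) x w.

Definition finite_orbit (X : Type) n (g : 'I_n -> X -> X) (x : X) :=
  finite_set [set y | exists w, y = act g w x].

(** * Approximation by tuples with finite orbits *)

Section finite_approximation.
Context {R : realType} {d : measure_display} {X : measurableType d}.
Context {mu : probability X R} (T : nsaut mu).
Implicit Types (A B C : set X).

(** [p x] labels the stretch of the orbit of [x] between consecutive visits to [A]. The value
    [m = 0] is allowed, so a point of [A] opens its own stretch. *)
Lemma last_visit A : measurable A -> exists p : X -> X, measurable_fun setT p /\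
  forall x m, A (iter m (autV T) x) ->
    (forall j, (j < m)%N -> ~ A (iter j (autV T) x)) -> p x = iter m (autV T) x.
Proof.
move=> mA.
pose C m := [set x | A (iter m (autV T) x) /\ forall j : 'I_m, ~ A (iter j (autV T) x)].
have mC m : measurable (C m).
  apply: measurableI; first exact: measurable_preimage_iterV.
  by apply: measurable_forall => j; apply: measurableC; exact: measurable_preimage_iterV.
have dC i j x : C i x -> C j x -> i = j.
  move=> [Ai ni] [Aj nj]; case: (ltngtP i j) => // ij.
    by case: (nj (Ordinal ij)).
  by case: (ni (Ordinal ij)).
have [//||i j x Ci Cj|p [mp pC _]] := @measurable_glue _ X nat C (fun m => iter m (autV T)).
- by move=> i; exact: (measurable_aut_iter (aut_inv T) i).
- by rewrite (dC _ _ _ Ci Cj).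
by exists p; split=> // x m Am nm; apply: pC; split=> // j; exact: nm.
Qed.

Lemma periodic_in_finite_set (h h' : X -> X) (F : set X) x : cancel h h' ->
  finite_set F -> (forall m, F (iter m.+1 h x)) -> exists m, iter m.+1 h x = x.
Proof.
move=> hK /finite_seqP[s Fs] Fx; apply: contrapT => np.
have inj : injective (fun m => iter m.+1 h x).
  suff key i j : (i < j)%N -> iter i.+1 h x <> iter j.+1 h x.
    by move=> i j e; case: (ltngtP i j) => // ij; [case: (key _ _ ij)|case: (key _ _ ij)].
  move=> ij e; apply: np; exists (j - i.+1)%N.
  have := iter_cancel i.+1 (j - i.+1).+1 x hK.
  have -> : (i.+1 + (j - i.+1).+1 = j.+1)%N by rewrite addnS subnKC.
  rewrite -e => <-; have := iter_cancel i.+1 0 x hK.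
  by rewrite addn0.
have := uniq_leq_size (s1 := map (fun m => iter m.+1 h x) (iota 0 (size s).+1)) (s2 := s).
rewrite map_inj_uniq// iota_uniq size_map size_iota ltnn => /(_ isT).
have sub y : y \in map (fun m => iter m.+1 h x) (iota 0 (size s).+1) -> y \in s.
  by move=> /mapP[m _ ->]; have := Fx m; rewrite Fs.
by move=> /(_ sub).
Qed.

(* The partial injection of a class-preserving part of [g] is completed to a
   permutation of each finite class by composing [g] with the inverse of its
   first return map to the set where it leaves the class. *)
Lemma class_preserving_aut (g : nsaut mu) (G : set X) (p : X -> X) :
  standard_probability mu ->
  measurable G -> invariant_set T G -> orbital T g -> measurable_fun setT p ->
  (forall x, G x -> finite_set [set y | G y /\ p y = p x]) ->
  exists g' : nsaut mu, [/\ orbital T g', forall x, G x -> p (g' x) = p x,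
    forall x, ~ G x -> g' x = x &
    forall x, G x -> p (g x) = p x -> g' x = g x].
Proof.
move=> hmu mG iG og mp fin.
have GV x : G x -> G (autV g x) by exact: iG (orbital_autV og x).
have [g0 [og0 g0E g0VE g0n]] := aut_builder_on mG iG (measurable_aut g)
  (measurable_autV g) (fun x _ => og x) GV (fun x _ => autK g x) (fun x _ => autVK g x).
(* The points of [G] that leave their class under [g0], which is [g] on [G] and the identity
   elsewhere. *)
pose U := G `&` ~` [set x | p (g0 x) = p x].
have mU : measurable U.
  apply: measurableI => //; apply: measurableC; apply: (measurable_eqset hmu) => //.
  exact: (measurableT_comp mp (measurable_aut g0)).
have Ug0 x : G x -> ~ U x -> p (g0 x) = p x.
  by move=> Gx nU; apply: contrapT => ne; apply: nU.
have G0 x : G x -> G (g0 x) by exact: iG (og0 x).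
have G0V x : G x -> G (autV g0 x) by exact: iG (orbital_autV og0 x).
have Giter m x : G x -> G (iter m g0 x) by move=> Gx; elim: m => //= m; exact: G0.
have GiterV m x : G x -> G (iter m (autV g0) x).
  by move=> Gx; elim: m => //= m; exact: G0V.
have p_iter m x : G x -> (forall j, (j < m)%N -> ~ U (iter j.+1 g0 x)) ->
    p (iter m.+1 g0 x) = p (g0 x).
  move=> Gx; elim: m => // m IH nU.
  rewrite -[RHS]IH; last by move=> j jm; apply: nU; exact: ltnW.
  by rewrite iterS Ug0//; [exact: Giter|exact: nU].
have [||U' [oU' U'n U'A]] := @induced_aut _ _ _ mu g0 U mU.
(* A point of [U] that never came back would remain in one finite class from its first step on,
   hence be periodic and come back. *)
- move=> x Ux; apply: contrapT => nU; have [Gx _] := Ux.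
  have {}nU m : ~ U (iter m.+1 g0 x) by move=> Um; apply: nU; exists m.
  have [||m e] := @periodic_in_finite_set g0 (autV g0) _ x _ (fin _ (G0 x Gx)).
  + exact: autK.
  + by move=> m; split; [exact: (Giter m.+1)|exact: p_iter].
  by apply: (nU m); rewrite e.
- move=> x Ux; apply: contrapT => nU; have [Gx _] := Ux.
  have {}nU m : ~ U (iter m.+1 (autV g0) x) by move=> Um; apply: nU; exists m.
  have [||m e] := @periodic_in_finite_set (autV g0) g0 _ x _ (fin _ Gx).
  + exact: autVK.
  + move=> m; split; first exact: (GiterV m.+1).
    have step k : p (iter k (autV g0) x) = p (iter k.+1 (autV g0) x).
      by have := Ug0 _ (GiterV k.+1 x Gx) (nU k); rewrite /= autVK.
    by elim: m => [|m <-]; rewrite -step.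
  by apply: (nU m); rewrite e.
have oTU' : orbital T U'.
  by move=> x; exact: same_orbit_orbital (oU' x).
have fixV x : ~ U x -> autV U' x = x.
  by move=> nU; rewrite -{1}(U'n x nU) autK.
exists (aut_comp g0 (aut_inv U')); split.
- by apply: orbital_comp => //; exact: orbital_autV.
- move=> y Gy /=; set x := autV U' y.
  have Gx : G x by apply: iG Gy; exact: orbital_autV.
  have ye : y = U' x by rewrite autVK.
  have [Ux|nU] := pselect (U x); last by rewrite ye (U'n _ nU); exact: Ug0.
  have [m [e _ mmin]] := U'A x Ux.
  by rewrite ye e; apply/esym/p_iter.
- move=> x nG /=; have nU : ~ U x by move=> [].
  by rewrite fixV// g0n.
- move=> x Gx e /=; have nU : ~ U x by move=> [_]; apply; rewrite /= g0E.
  by rewrite fixV// g0E.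
Qed.

End finite_approximation.

Section finite_approximation.
Context {R : realType} {d : measure_display} {X : measurableType d}.
Context {mu : probability X R} (hmu : standard_probability mu) (T : nsaut mu).
Hypotheses (erg : ergodic T) (hIII : type_III T).
Implicit Types (A B C : set X).

Lemma same_orbit_iterV (S : nsaut mu) x m : same_orbit S x (iter m (autV S) x).
Proof. by case: m => [|m]; [exact: same_orbit_refl|exists (Negz m)]. Qed.

(** Since the markers vanish, the finite stretch of orbit joining [x] to its image contains no
    marker of high level. Hence each point of [G] is in [E i k] for finitely many [k] only, and the
    measure of [E i k] tends to 0. *)
Lemma finite_approximation n (g : 'I_n -> nsaut mu) (e : R) :
  (forall i, orbital T (g i)) -> 0 < e ->
  exists g' : 'I_n -> nsaut mu, [/\ forall i, orbital T (g' i),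
    forall i, (mu [set x | g i x <> g' i x] < e%:E)%E &
    forall x, finite_orbit g' x].
Proof.
move=> og e0; have [A [mA A0 Adecr Avan]] := vanishing_markers hmu.
have /choice[Gk GkP] := fun k => recurrence hIII erg (mA k) (A0 k).
pose G := \bigcap_k Gk k.
have mG : measurable G by apply: bigcapT_measurable => k; case: (GkP k).
have iG : invariant_set T G.
  by move=> x y xy Gx k _; case: (GkP k) => _ + _ _ _; apply; [exact: xy|exact: Gx].
have G0 : mu (~` G) = 0%E.
  rewrite setC_bigcap; apply: null_bigcup => k; last by case: (GkP k).
  by apply: measurableC; case: (GkP k).
have /choice[p pP] := fun k => last_visit T (mA k).
have mp k : measurable_fun setT (p k) by case: (pP k).
have hit k x : G x -> exists m, p k x = iter m (autV T) x /\ A k (iter m (autV T) x) /\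
    forall j, (j < m)%N -> ~ A k (iter j (autV T) x).
  move=> Gx; have exm : exists m, `[< A k (iter m (autV T) x) >].
    case: (GkP k) => _ _ _ _ /(_ x (Gx k I))[m Am].
    by exists m.+1; apply/asboolP.
  case: (ex_minnP exm) => m /asboolP Am mmin; exists m.
  have nA j : (j < m)%N -> ~ A k (iter j (autV T) x).
    by move=> jm Aj; have := mmin j; rewrite leqNgt jm => /(_ _)/negP; apply;
      first exact/asboolP.
  by split=> //; exact: (pP k).2 Am nA.
have p_pred k x : G x -> ~ A k x -> p k x = p k (autV T x).
  move=> Gx nA; have [[|m] [pE [Am mmin]]] := hit k x Gx; first by [].
  rewrite pE iterSr; apply/esym; apply: (pP k).2; first by rewrite -iterSr.
  by move=> j jm; rewrite -iterSr; exact: mmin.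
have p_iter m x : G x -> exists K, forall k, (K <= k)%N -> p k (iter m T x) = p k x.
  move=> Gx; elim: m => [|m [K KP]]; first by exists 0%N.
  have [K' nA] := Avan (iter m.+1 T x); exists (maxn K K') => k.
  rewrite geq_max => /andP[Kk K'k]; rewrite p_pred /= ?autK; first exact: KP.
    exact: iG (same_orbit_iter T x m.+1) Gx.
  by move=> Ak; apply: nA; exact: Adecr K'k _ Ak.
have p_orbit x y : G x -> same_orbit T x y ->
    exists K, forall k, (K <= k)%N -> p k y = p k x.
  move=> Gx [[m|m] ->]; first exact: p_iter.
  have Gy : G (aut_iter T (Negz m) x) by exact: iG (same_orbit_iter _ _ _) Gx.
  have [K KP] := p_iter m.+1 _ Gy; exists K => k /KP.
  have -> : iter m.+1 T (aut_iter T (Negz m) x) = x by exact: (aut_iterVK T m.+1).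
  by move=> ->.
(* All points of a class are images of the same marker [p k x] by powers of [T] below the time
   [M.+1] of a later visit. *)
have fin k x : G x -> finite_set [set y | G y /\ p k y = p k x].
  move=> Gx; have [m0 [px _]] := hit k x Gx.
  have Ga : G (p k x) by rewrite px; exact: iG (same_orbit_iterV T x m0) Gx.
  have [M AM] : exists m, A k (iter m.+1 T (p k x)).
    by case: (GkP k) => _ _ _ + _; apply; exact: Ga.
  apply: (@sub_finite_set _ _ ((fun m => iter m T (p k x)) @` `I_M.+1)); last first.
    exact/finite_image/finite_II.
  move=> y [Gy yx]; have [m [py [Am mmin]]] := hit k y Gy.
  have ye : y = iter m T (p k x).
    rewrite -yx py; have := iter_cancel m 0 y (autVK T).
    by rewrite addn0 => ->.
  exists m => //=; rewrite ltnNge; apply/negP => mM.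
  apply: (mmin (m - M.+1)%N); first by rewrite ltn_subrL; case: (m) mM.
  rewrite ye; have := iter_cancel (m - M.+1) M.+1 (p k x) (autK T).
  by rewrite subnK// => ->.
pose E i k := G `&` ~` [set x | p k (g i x) = p k x].
have mE i k : measurable (E i k).
  apply: measurableI => //; apply: measurableC; apply: (measurable_eqset hmu) => //.
  exact: (measurableT_comp (mp k) (measurable_aut (g i))).
have /choice[N NP] : forall i, exists N, forall k, (N <= k)%N -> (mu (E i k) < e%:E)%E.
  move=> i; pose F m := \bigcup_(k in [set k | (m <= k)%N]) E i k.
  have mF m : measurable (F m) by exact: bigcup_measurable.
  have [m m' mm' x [k /= mk Ek]||N NP] := @decreasing_small _ _ _ mu F e mF _ _ e0.
  - by exists k => //=; exact: leq_trans mk.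
  - suff -> : \bigcap_m F m = set0 by exact: measure0.
    apply/seteqP; split=> // x Fx; have [k0 _ [Gx _]] := Fx 0%N I.
    have [K KP] := p_orbit x (g i x) Gx (og i x).
    by have [k /= Kk [_]] := Fx K I; apply; exact: KP.
  exists N => k Nk; apply: le_lt_trans (NP k Nk).
  by apply: le_measure; rewrite ?inE// => x Ex; exists k => /=.
pose k := \max_i N i.
have /choice[g' g'P] := fun i => class_preserving_aut hmu mG iG (og i) (mp k) (fin k).
exists g'; split=> [i|i|x].
- by case: (g'P i).
- apply: le_lt_trans (NP i k (leq_bigmax i)).
  have mneq := measurable_aut_neq (g i) (g' i) hmu.
  have -> : mu (E i k) = mu (E i k `|` ~` G).
    by rewrite measureU0//; exact: measurableC.
  apply: le_measure; rewrite ?inE//.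
    by apply: measurableU => //; exact: measurableC.
  move=> x /= ne; have [Gx|] := pselect (G x); last by right.
  left; split=> // pe; apply: ne; case: (g'P i) => _ _ _ h.
  by rewrite h.
have [Gx|nG] := pselect (G x); last first.
  apply: (@sub_finite_set _ _ [set x]); last exact: finite_set1.
  move=> _ [w ->] /=; elim: w => //= i w ->; case: (g'P i) => _ _ h _.
  exact: h.
apply: sub_finite_set (fin k x Gx) => _ [w ->]; elim: w => //= i w [Gy py].
case: (g'P i) => oi pi _ _; split; first exact: iG (oi _) Gy.
by rewrite pi.
Qed.

End finite_approximation.

(* A code is a finite set ['I_k.+1] pointed at [ord0] on which the free group
   acts through the permutations attached to its generators. *)
Definition code n := {k : nat & {ffun 'I_n -> {perm 'I_k.+1}}}.

Definition code_act n (c : code n) (w : seq 'I_n) : 'I_(tag c).+1 -> 'I_(tag c).+1 :=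
  act (fun i => tagged c i : 'I_(tag c).+1 -> 'I_(tag c).+1) w.

Arguments code_act {n} c w _ : rename.

Lemma act_cat (X : Type) n (g : 'I_n -> X -> X) w u x :
  act g (w ++ u) x = act g w (act g u x).
Proof. exact: foldr_cat. Qed.

Section codes.
Context {X : choiceType} (n : nat).
Implicit Types (g h : 'I_n -> X -> X) (c : code n) (w u : seq 'I_n) (x y : X).

(** Pointed orbits are compared through the pairs of words they identify: no bijection has to be
    chosen, and the set is a countable intersection of measurable ones. Only the points of the code
    reachable from [ord0] matter. *)
Definition has_code c g : set X := [set x | forall w w',
  act g w x = act g w' x <-> code_act c w ord0 = code_act c w' ord0].

Lemma has_code_finite c g x : has_code c g x -> finite_orbit g x.
Proof.
move=> gx; have /choice[r rP] : forall a : 'I_(tag c).+1, exists y,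
    forall w, code_act c w ord0 = a -> y = act g w x.
  move=> a; have [[w wa]|na] := pselect (exists w, code_act c w ord0 = a).
    by exists (act g w x) => w' w'a; apply/gx; rewrite wa w'a.
  by exists x => w wa; case: na; exists w.
apply: (@sub_finite_set _ _ (r @` setT)); last exact/finite_image/finite_finset.
by move=> _ [w ->]; exists (code_act c w ord0) => //; exact: rP.
Qed.

Lemma finite_orbit_act g x u : finite_orbit g x -> finite_orbit g (act g u x).
Proof. by apply: sub_finite_set => _ [w ->]; exists (w ++ u); rewrite act_cat. Qed.

(** By the pigeonhole principle two powers of a generator agree at a point of a finite orbit;
    injectivity cancels the smaller one, so the generator is periodic there and its inverse is a
    positive power. *)
Lemma act_back g x u : (forall i, injective (g i)) -> finite_orbit g x ->
  exists u', act g u' (act g u x) = x.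
Proof.
move=> ginj; elim: u x => [|i u IH] x fx; first by exists [::].
have [u' u'x] := IH x fx.
pose y := act g u x; have fy := finite_orbit_act u fx.
have iterE m z : iter m (g i) z = act g (nseq m i) z by elim: m => //= m ->.
have [a [b [ab e]]] : exists a b, (a < b)%N /\ iter a (g i) y = iter b (g i) y.
  have /finite_seqP[s sE] := fy.
  apply: contrapT => ne.
  have inj : injective (fun m => iter m (g i) y).
    move=> a b e; case: (ltngtP a b) => // ab; case: ne; last by exists b, a.
    by exists a, b.
  have := uniq_leq_size (s1 := map (fun m => iter m (g i) y) (iota 0 (size s).+1)) (s2 := s).
  rewrite map_inj_uniq// iota_uniq size_map size_iota ltnn => /(_ isT) h.
  suff : false by []; apply: h => _ /mapP[m _ ->]; have : [set` s] (iter m (g i) y).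
    by rewrite -sE; exists (nseq m i).
  by [].
have e1 : iter (b - a) (g i) y = y.
  have iter_inj : injective (iter a (g i)).
    by elim: (a) => [z1 z2 //|k IHk z1 z2 /= /ginj/IHk].
  by apply: iter_inj; rewrite -iterD subnKC ?e// ltnW.
exists (u' ++ nseq (b - a).-1 i); rewrite act_cat -iterE /= -/y -iterSr.
by rewrite prednK ?subn_gt0// e1.
Qed.

Lemma code_exists g x : (forall i, injective (g i)) -> finite_orbit g x ->
  exists c, has_code c g x.
Proof.
move=> ginj fx; have /finite_seqP[s0 sE0] := fx.
(* [x] is put at the head of the list so that it gets the number [ord0]. *)
pose s := x :: rem x (undup s0).
have xs0 : x \in undup s0.
  by rewrite mem_undup; have : [set` s0] x by rewrite -sE0; exists [::].
have ps : perm_eq (undup s0) s by exact: perm_to_rem.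
have us : uniq s by rewrite -(perm_uniq ps) undup_uniq.
have sP w : act g w x \in s.
  rewrite -(perm_mem ps) mem_undup.
  by have : [set` s0] (act g w x) by rewrite -sE0; exists w.
have sV y : y \in s -> exists w, y = act g w x.
  rewrite -(perm_mem ps) mem_undup => ys.
  by have : [set` s0] y by []; rewrite -sE0.
pose k := size (rem x (undup s0)).
pose pt (a : 'I_k.+1) := nth x s a.
have ptP a : pt a \in s by exact: mem_nth.
have pt_inj : injective pt.
  by move=> a b /eqP; rewrite nth_uniq// => /eqP/val_inj.
have [ix ixK] : exists ix : X -> 'I_k.+1, forall y, y \in s -> pt (ix y) = y.
  exists (fun y => inord (index y s)) => y ys.
  by rewrite /pt inordK ?nth_index// index_mem.
have gs i a : g i (pt a) \in s.
  by have [w ->] := sV _ (ptP a); exact: (sP (i :: w)).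
have s_inj i : injective (fun a => ix (g i (pt a))).
  move=> a b /(congr1 pt); rewrite !ixK// => /ginj; exact: pt_inj.
pose c : code n := existT _ k [ffun i => perm (s_inj i)].
have actE w : pt (code_act c w ord0) = act g w x.
  elim: w => [|i w IH]; first by rewrite /pt.
  by rewrite /code_act /= -/(code_act c w ord0) ffunE permE ixK// IH.
exists c => w w'; rewrite -!actE; split=> [|->//]; exact: pt_inj.
Qed.

End codes.
(** * Conjugacy of generic tuples *)

Section code_classes.
Context (n : nat).
Implicit Types (c : code n).

(* Some point of the orbit of a point with code [c] has code [c']. *)
Definition shifted_code c c' := exists u, forall w w',
  code_act c' w ord0 = code_act c' w' ord0 <->
  code_act c (w ++ u) ord0 = code_act c (w' ++ u) ord0.

(** An orbit has a code for each base point and each presentation. The least index in the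
    enumeration [pickle] singles out one of them, so that an orbit is counted under a single
    code. *)
Definition minimal_code c := forall c', shifted_code c c' -> (pickle c <= pickle c')%N.

Lemma minimal_code_eq c c' : minimal_code c -> minimal_code c' ->
  shifted_code c c' -> shifted_code c' c -> c = c'.
Proof.
move=> mc mc' cc' c'c; apply: (pcan_inj (@pickleK (code n))).
by apply/eqP; rewrite eqn_leq; apply/andP; split; [exact: mc|exact: mc'].
Qed.

Context {X : choiceType}.
Implicit Types (g : 'I_n -> X -> X) (x : X).

Lemma has_code_shift c c' g x : has_code c g x -> shifted_code c c' ->
  exists u, has_code c' g (act g u x).
Proof.
move=> cx [u cc']; exists u => w w'; rewrite -!act_cat.
exact: iff_trans (cx _ _) (iff_sym (cc' w w')).
Qed.

Lemma shift_has_code c c' g x u : has_code c g x -> has_code c' g (act g u x) ->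
  shifted_code c c'.
Proof.
move=> cx c'x; exists u => w w'; have := c'x w w'; rewrite -!act_cat => c'w.
exact: iff_trans (iff_sym c'w) (cx _ _).
Qed.

End code_classes.

(** * Borel transversals of the finite orbits *)

Section transversals.
Context {R : realType} {X : choiceType} (phi : X -> R) (n : nat).
Hypothesis phi_inj : injective phi.
Implicit Types (g h : 'I_n -> X -> X) (c : code n) (w u : seq 'I_n) (x y : X).

(* One point of each orbit: [phi] is only used to choose it in a Borel way. *)
Definition transversal c g : set X := [set x | minimal_code c /\ has_code c g x /\
  forall w, has_code c g (act g w x) -> phi x <= phi (act g w x)].

(** Take the least code occurring on the orbit, then the point with least [phi] among those having
    it. This point is reached from [x] by a word [v], and [act_back] supplies the word leading
    back. *)
Lemma transversal_cover g x : (forall i, injective (g i)) -> finite_orbit g x ->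
  exists c w y, transversal c g y /\ x = act g w y.
Proof.
move=> ginj fx.
have [c0 c0x] := code_exists ginj fx.
have exk : exists k, `[< exists c u, pickle c = k /\ has_code c g (act g u x) >].
  by exists (pickle c0); apply/asboolP; exists c0, [::].
case: (ex_minnP exk) => k /asboolP[c [u [ck cu]]] kmin.
have mc : minimal_code c.
  move=> c' /(has_code_shift cu)[u' cu']; rewrite ck; apply: kmin.
  by apply/asboolP; exists c', (u' ++ u); rewrite act_cat.
have /finite_seqP[s sE] := fx.
have sP w : act g w x \in s.
  by have : [set` s] (act g w x) by rewrite -sE; exists w.
have [v cv vmin] : exists2 v, has_code c g (act g v x) &
    forall w, has_code c g (act g w x) -> phi (act g v x) <= phi (act g w x).
  suff min (r : seq X) : (exists2 v, has_code c g (act g v x) & act g v x \in r) ->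
      exists2 v, has_code c g (act g v x) & forall w, act g w x \in r ->
        has_code c g (act g w x) -> phi (act g v x) <= phi (act g w x).
    have [|v cv vmin] := min s; first by exists u.
    by exists v => // w; exact: vmin.
  elim: r => [[v _]//|y r IH] [v cv vyr].
  have [[v1 c1 v1r]|none] := pselect (exists2 v, has_code c g (act g v x) & act g v x \in r).
    have [|v2 c2 v2min] := IH; first by exists v1.
    have [yv|vy] := leP (phi (act g v2 x)) (phi y).
      exists v2 => // w; rewrite inE => /orP[/eqP -> //|]; exact: v2min.
    have [[v3 c3 v3y]|ny] := pselect (exists2 v, has_code c g (act g v x) & act g v x = y).
      exists v3 => // w; rewrite v3y inE => /orP[/eqP -> //|wr cw].
      by apply: le_trans (ltW vy) _; exact: v2min.
    exists v2 => // w; rewrite inE => /orP[/eqP wy cw|]; last exact: v2min.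
    by case: ny; exists w.
  move: vyr; rewrite inE => /orP[/eqP vy|vr]; last by case: none; exists v.
  exists v => // w; rewrite inE => /orP[/eqP wy|wr cw]; first by rewrite wy vy.
  by case: none; exists w.
have [v' v'x] := act_back v ginj fx.
exists c, v', (act g v x); split=> //; split=> //; split=> // w.
by rewrite -act_cat; exact: vmin.
Qed.

Lemma transversal_unique g c c' y y' w w' : (forall i, injective (g i)) ->
  transversal c g y -> transversal c' g y' -> act g w y = act g w' y' ->
  c = c' /\ y = y'.
Proof.
move=> ginj [mc [cy ymin]] [mc' [cy' y'min]] e.
have [u uy] := act_back w ginj (has_code_finite cy).
have [u' uy'] := act_back w' ginj (has_code_finite cy').
have yy' : act g (u' ++ w) y = y' by rewrite act_cat e.
have y'y : act g (u ++ w') y' = y by rewrite act_cat -e.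
have cc' : c = c'.
  apply: minimal_code_eq => //.
    by apply: (@shift_has_code _ _ c c' g y (u' ++ w)) => //; rewrite yy'.
  by apply: (@shift_has_code _ _ c' c g y' (u ++ w')) => //; rewrite y'y.
split=> //; subst c'; apply: phi_inj; apply/eqP; rewrite eq_le; apply/andP; split.
  by have := ymin (u' ++ w); rewrite yy'; apply.
by have := y'min (u ++ w'); rewrite y'y; apply.
Qed.

End transversals.

Section conjugacy.
Context {R : realType} {d : measure_display} {X : measurableType d}.
Context {mu : probability X R} (hmu : standard_probability mu) (T : nsaut mu).
Hypotheses (erg : ergodic T) (hIII : type_III T).
Context (n : nat).
Implicit Types (g h : 'I_n -> nsaut mu) (c : code n) (w u : seq 'I_n).

Lemma act_aut g w : exists U : nsaut mu, aut U = act g w.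
Proof.
elim: w => [|i w [U UE]]; first by exists (aut_id mu).
by exists (aut_comp (g i) U) => /=; rewrite UE.
Qed.

Lemma measurable_act g w : measurable_fun setT (act g w).
Proof. by have [U <-] := act_aut g w; exact: measurable_aut. Qed.

Lemma orbital_act g w : (forall i, orbital T (g i)) -> orbital T (act g w).
Proof.
move=> og; elim: w => [|i w IH] x; first exact: same_orbit_refl.
exact: same_orbit_trans (IH x) (og i _).
Qed.

Lemma measurable_has_code c g : measurable (has_code c g).
Proof.
apply: measurable_forall => w; apply: measurable_forall => w'.
have mE : measurable [set x | act g w x = act g w' x].
  by apply: (measurable_eqset hmu); exact: measurable_act.
have [e|ne] := pselect (code_act c w ord0 = code_act c w' ord0).
  move: mE; congr measurable; apply/seteqP.
  by split=> x /= => [->//|[_]]; exact.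
move/measurableC : mE; congr measurable; apply/seteqP.
by split=> x /= => [xn|[h _] hx]; [split|exact/ne/h].
Qed.

Lemma measurable_transversal (phi : X -> R) c g : measurable_fun setT phi ->
  measurable (transversal phi c g).
Proof.
move=> mphi; have [mc|nmc] := pselect (minimal_code c); last first.
  by rewrite (_ : transversal _ _ _ = set0)//; apply/seteqP; split=> // x [].
rewrite (_ : transversal _ _ _ = has_code c g `&`
    [set x | forall w, has_code c g (act g w x) -> phi x <= phi (act g w x)]); last first.
  by apply/seteqP; split=> [x []|].
apply: measurableI; first exact: measurable_has_code.
apply: measurable_forall => w.
have mw := measurable_act g w.
have m1 : measurable (act g w @^-1` has_code c g).
  by apply: measurable_preimage => //; exact: measurable_has_code.
have m2 : measurable [set x | phi x <= phi (act g w x)].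
  rewrite (_ : [set _ | _] = (fun x => phi (act g w x) - phi x) @^-1` `[0, +oo[%classic).
    rewrite -[_ @^-1` _]setTI.
    have mD := measurable_funB (measurableT_comp mphi mw) mphi.
    by apply: mD => //; exact: measurable_itv.
  by apply/seteqP; split=> x /=; rewrite in_itv /= andbT subr_ge0.
rewrite (_ : [set _ | _] = ~` (act g w @^-1` has_code c g) `|`
    [set x | phi x <= phi (act g w x)]).
  by apply: measurableU => //; exact: measurableC.
apply/seteqP; split=> x /=.
  by move=> h; have [/h|] := pselect (has_code c g (act g w x)); [right|left].
by case=> // nh /nh.
Qed.

(** A point with the minimal code [c] lies on the orbit of a point of the transversal of that same
    code, so [has_code c g] is inside the saturation of the transversal. *)
Lemma transversal_nonnull (phi : X -> R) c g : measurable_fun setT phi ->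
  injective phi -> (forall i, orbital T (g i)) -> minimal_code c ->
  mu (has_code c g) <> 0%E -> mu (transversal phi c g) <> 0%E.
Proof.
move=> mphi phi_inj og mc c0 Y0; apply: c0.
have mY := measurable_transversal c g mphi.
apply: (null_subset (measurable_has_code c g) _ _ (null_saturation T mY Y0)).
  exact: measurable_saturation.
move=> x cx; have ginj i : injective (g i) by exact: can_inj (autK _).
have [c' [w [y [Yy xE]]]] := transversal_cover phi ginj (has_code_finite cx).
have [mc' [c'y _]] := Yy.
have [u ux] := act_back w ginj (has_code_finite c'y).
have e : c = c'.
  apply: minimal_code_eq => //.
    by apply: (@shift_has_code _ _ c c' g x u) => //; rewrite xE ux.
  by apply: (@shift_has_code _ _ c' c g y w) => //; rewrite -xE.
have /same_orbit_sym[m ym] : same_orbit T y x by rewrite xE; exact: orbital_act.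
by exists m; rewrite -ym e.
Qed.

(** Well defined because [y] and [theta c y] have the same code: words that agree at one agree at
    the other. Different base points never compete, by [transversal_unique]. *)
Lemma equivariant_extension (phi : X -> R) g h (A : code n -> set X)
    (theta : code n -> X -> X) : injective phi ->
  (forall c, measurable (A c)) -> (forall c, measurable_fun setT (theta c)) ->
  (forall c, A c `<=` transversal phi c g) ->
  (forall c x, A c x -> has_code c h (theta c x)) ->
  exists F, measurable_fun setT F /\
    forall c w y, A c y -> F (act g w y) = act h w (theta c y).
Proof.
move=> phi_inj mA mt Ag th.
have /choice[U UE] := fun w => act_aut g w.
pose C (i : code n * seq 'I_n) := autV (U i.2) @^-1` A i.1.
pose f (i : code n * seq 'I_n) := act h i.2 \o (theta i.1 \o autV (U i.2)).
have CE i x : C i x -> exists2 y, A i.1 y & x = act g i.2 y /\ autV (U i.2) x = y.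
  by move=> Cx; exists (autV (U i.2) x) => //; rewrite -UE autVK.
have [|||F [mF FC _]] := @measurable_glue _ X _ C f.
- by move=> i; exact: measurable_preimage_autV.
- move=> i; apply: measurableT_comp; first exact: measurable_act.
  by apply: measurableT_comp => //; exact: measurable_autV.
- move=> [c w] [c' w'] x /CE[/= y Ay [xy ey]] /CE[/= y' Ay' [xy' ey']].
  have ginj i : injective (g i) by exact: can_inj (autK _).
  have e : act g w y = act g w' y' by rewrite -xy.
  have [cc' yy'] := transversal_unique phi_inj ginj (Ag _ _ Ay) (Ag _ _ Ay') e.
  rewrite /f /= ey ey' -yy'; rewrite -yy' in e; subst c'.
  by have [_ [cy _]] := Ag _ _ Ay; exact: (th _ _ Ay w w').2 ((cy w w').1 e).
exists F; split=> // c w y Ay.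
have e : autV (U w) (act g w y) = y by rewrite -UE autK.
by rewrite (FC (c, w)) /C /f /= ?e.
Qed.

Lemma generic_conjugate g h :
  (forall i, orbital T (g i)) -> (forall i, orbital T (h i)) ->
  mu (~` [set x | exists c, has_code c g x]) = 0%E ->
  mu (~` [set x | exists c, has_code c h x]) = 0%E ->
  (forall c, mu (has_code c g) <> 0%E) -> (forall c, mu (has_code c h) <> 0%E) ->
  exists U : nsaut mu, orbital T U /\
    exists G, [/\ measurable G, mu (~` G) = 0%E &
      forall x i, G x -> U (g i x) = h i (U x)].
Proof.
move=> og oh fg fh cg ch; have [phi [[_ phi_inj' _] mphi _ _]] := hmu.
have phi_inj : injective phi by move=> x y; apply: phi_inj'; rewrite inE.
have mYg c := measurable_transversal c g mphi.
have mYh c := measurable_transversal c h mphi.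
have /choice[A /choice[B AB]] : forall c, exists A B, [/\ A `<=` transversal phi c g,
    mu (transversal phi c g `\` A) = 0%E, B `<=` transversal phi c h,
    mu (transversal phi c h `\` B) = 0%E & equidec T A B].
  move=> c; have [mc|nmc] := pselect (minimal_code c).
    apply: equidec_wandering => //; apply: type_III_wandering => //;
      exact: transversal_nonnull.
  (* A non-minimal code has an empty transversal for every tuple; its orbits are represented under
     their minimal code. *)
  have Y0 k : transversal phi c k = set0.
    by apply/seteqP; split=> // x [].
  exists set0, set0; rewrite !Y0 set0D measure0; split=> //.
  exact: equidec_refl.
have /choice[f /choice[f' ff]] : forall c, exists f f', piso T (A c) (B c) f f'.
  by move=> c; case: (AB c).
have mA c : measurable (A c) by exact: piso_mdom (ff c).
have mB c : measurable (B c) by exact: piso_mcod (ff c).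
pose N := (\bigcup_c (transversal phi c g `\` A c)) `|`
  (\bigcup_c (transversal phi c h `\` B c)).
have mN : measurable N.
  by apply: measurableU; apply: measurable_bigcup_count => c; exact: measurableD.
have N0 : mu N = 0%E.
  apply: nullU; do ?[by apply: measurable_bigcup_count => c; exact: measurableD].
    by apply: null_bigcup => c; [exact: measurableD|case: (AB c)].
  by apply: null_bigcup => c; [exact: measurableD|case: (AB c)].
have mF (k : 'I_n -> nsaut mu) : measurable [set x | exists c, has_code c k x].
  by apply: measurable_exists => c; exact: measurable_has_code.
(* An invariant conull set where both tuples have codes and every transversal point is matched.
   Invariance keeps [F] and [F'] inside it, where they are mutually inverse. *)
pose G := core T ([set x | exists c, has_code c g x] `&`
  ([set x | exists c, has_code c h x] `&` ~` N)).
have mG0 : measurable ([set x | exists c, has_code c g x] `&`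
  ([set x | exists c, has_code c h x] `&` ~` N)).
  by do 2 apply: measurableI => //; exact: measurableC.
have mG : measurable G by exact: measurable_core.
have iG : invariant_set T G by exact: invariant_core.
have G0 : mu (~` G) = 0%E.
  apply: null_core => //; rewrite !setCI setCK.
  have mC k : measurable (~` [set x | exists c, has_code c (k : 'I_n -> nsaut mu) x]).
    exact: measurableC.
  by apply: nullU => //; [exact: measurableU|exact: nullU].
have GP x : G x -> (exists c, has_code c g x) /\ (exists c, has_code c h x) /\ ~ N x.
  by move=> /core_sub[? [? ?]].
have mAG c : measurable (A c `&` G) by exact: measurableI.
have mBG c : measurable (B c `&` G) by exact: measurableI.
have Afun c x : A c x -> B c (f c x) := piso_fun (ff c) (x := x).
have Binv c x : B c x -> A c (f' c x) := piso_inv (ff c) (y := x).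
have [|||F [mF' FE]] := @equivariant_extension phi g h (fun c => A c `&` G) f phi_inj mAG.
- by move=> c; exact: piso_mfun (ff c).
- by move=> c x [Ax _]; case: (AB c) => + _ _ _ _; apply.
- move=> c x [/Afun Bx _]; case: (AB c) => _ _ /(_ _ Bx)[_ [] //].
have [|||F' [mF'' FE']] := @equivariant_extension phi h g (fun c => B c `&` G) f' phi_inj mBG.
- by move=> c; exact: piso_minv (ff c).
- by move=> c x [Bx _]; case: (AB c) => _ _ + _ _; apply.
- move=> c x [/Binv Ax _]; case: (AB c) => /(_ _ Ax)[_ [] //].
have repr_g x : G x -> exists c w y, [/\ A c y, G y & x = act g w y].
  move=> Gx; have [[c cx] _] := GP x Gx.
  have [c' [w [y [Yy xE]]]] := transversal_cover phi (fun i => can_inj (autK (g i)))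
    (has_code_finite cx).
  have Gy : G y by apply: iG Gx; apply: same_orbit_sym; rewrite xE; exact: orbital_act.
  exists c', w, y; split=> //; apply: contrapT => nA.
  have [_ [_ nN]] := GP y Gy; apply: nN; left; exists c' => //.
have repr_h x : G x -> exists c w y, [/\ B c y, G y & x = act h w y].
  move=> Gx; have [_ [[c cx] _]] := GP x Gx.
  have [c' [w [y [Yy xE]]]] := transversal_cover phi (fun i => can_inj (autK (h i)))
    (has_code_finite cx).
  have Gy : G y by apply: iG Gx; apply: same_orbit_sym; rewrite xE; exact: orbital_act.
  exists c', w, y; split=> //; apply: contrapT => nA.
  have [_ [_ nN]] := GP y Gy; apply: nN; right; exists c' => //.
have of_ x : G x -> same_orbit T x (F x).
  move=> Gx; have [c [w [y [Ay Gy ->]]]] := repr_g x Gx; rewrite (FE c)//.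
  apply: (same_orbit_trans _ (orbital_act w oh _)).
  apply: (same_orbit_trans _ (piso_orbit (ff c) Ay)).
  by apply: same_orbit_sym; exact: orbital_act.
have of' x : G x -> same_orbit T x (F' x).
  move=> Gx; have [c [w [y [By Gy ->]]]] := repr_h x Gx; rewrite (FE' c)//.
  apply: (same_orbit_trans _ (orbital_act w og _)).
  apply: (same_orbit_trans _ (piso_orbit (piso_sym (ff c)) By)).
  by apply: same_orbit_sym; exact: orbital_act.
have FK x : G x -> F' (F x) = x.
  move=> Gx; have [c [w [y [Ay Gy ->]]]] := repr_g x Gx; rewrite (FE c)// (FE' c).
    by rewrite (pisoK (ff c)).
  by split; [exact: Afun|exact: iG (piso_orbit (ff c) Ay) Gy].
have FVK x : G x -> F (F' x) = x.
  move=> Gx; have [c [w [y [By Gy ->]]]] := repr_h x Gx; rewrite (FE' c)// (FE c).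
    by rewrite (pisoVK (ff c)).
  by split; [exact: Binv|exact: iG (piso_orbit (piso_sym (ff c)) By) Gy].
have GF' x : G x -> G (F' x) by move=> Gx; exact: iG (of' x Gx) Gx.
have [U [oU UF _ _]] := aut_builder_on mG iG mF' mF'' of_ GF' FK FVK.
exists U; split=> //; exists G; split=> // x i Gx.
rewrite UF; last exact: iG (og i x) Gx.
rewrite UF//; have [c [w [y [Ay Gy ->]]]] := repr_g x Gx.
by rewrite -[g i _]/(act g (i :: w) y) !(FE c).
Qed.

End conjugacy.

(** * Installing all finite types *)

Section generic_perturbation.
Context {R : realType} {d : measure_display} {X : measurableType d}.
Context {mu : probability X R} (hmu : standard_probability mu) (T : nsaut mu).
Hypotheses (erg : ergodic T) (hIII : type_III T).
Context (n : nat).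
Implicit Types (g : 'I_n -> nsaut mu) (c : code n) (w u : seq 'I_n).

Let forward_saturation g (A : set X) := [set x | exists w, A (act g w x)].

Let measurable_forward g A : measurable A -> measurable (forward_saturation g A).
Proof.
move=> mA; apply: measurable_exists => w; apply: measurable_preimage => //.
exact: measurable_act.
Qed.

Let forward_invariant g A : (forall x, finite_orbit g x) ->
  forall i x, forward_saturation g A (g i x) <-> forward_saturation g A x.
Proof.
move=> fin i x; split=> -[w Aw].
  by exists (w ++ [:: i]); rewrite act_cat.
have [u ux] := act_back [:: i] (fun i => can_inj (autK (g i))) (fin x).
by exists (w ++ u); rewrite act_cat; rewrite /= in ux; rewrite ux.
Qed.

(** Saturating the markers under [g] keeps them decreasing to the empty set: a finite orbit leaves
    them entirely from some level on. *)
Lemma small_invariant_set g (e : R) : (forall x, finite_orbit g x) -> 0 < e ->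
  exists Z, [/\ measurable Z, mu Z <> 0%E, (mu Z < e%:E)%E &
    forall i x, Z (g i x) <-> Z x].
Proof.
move=> fin e0; have [A [mA A0 Adecr Avan]] := vanishing_markers hmu.
pose F k := forward_saturation g (A k).
have mF k : measurable (F k) by exact: measurable_forward.
have [j k jk x [w Aw]||N NP] := @decreasing_small _ _ _ mu F e mF _ _ e0.
- by exists w; exact: Adecr jk _ Aw.
- suff -> : \bigcap_k F k = set0 by exact: measure0.
  apply/seteqP; split=> // x Fx.
  have /finite_seqP[s sE] := fin x.
  have /choice[K KP] := Avan.
  have [w Aw] := Fx (\max_(y <- s) K y)%N I.
  apply: (KP (act g w x)); apply: Adecr Aw.
  have ws : act g w x \in s by have : [set` s] (act g w x) by rewrite -sE; exists w.
  by rewrite (big_rem _ ws) /= leq_maxl.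
exists (F N); split => //; last exact: forward_invariant.
  move=> F0; apply: (A0 N); apply: null_subset F0 => // x Ax.
  by exists [::].
exact: NP.
Qed.

(** Inside a small invariant [Z], disjoint copies of one non-null set serve as the points of all
    codes at once, and each generator permutes these copies as its code prescribes. The rest of [Z]
    is fixed, and outside [Z] the old generators remain. *)
Lemma generic_perturbation g (e : R) : (forall i, orbital T (g i)) ->
  (forall x, finite_orbit g x) -> 0 < e ->
  exists g' : 'I_n -> nsaut mu, [/\ forall i, orbital T (g' i),
    forall i, (mu [set x | g i x <> g' i x] < e%:E)%E,
    forall x, exists c, has_code c g' x &
    forall c, mu (has_code c g') <> 0%E].
Proof.
move=> og fin e0; have [Z [mZ Z0 Ze Zg]] := small_invariant_set fin e0.
have [C [CZ dC C0 eC]] := type_III_wandering erg hIII mZ Z0.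
have /choice[f /choice[f' ff]] := eC.
(* An index is a code with one of its points. A move from copy [j] to copy [sg i j] passes through
   [C 0], so composing moves causes no drift. *)
pose J := {c : code n & 'I_(tag c).+1}.
pose j0 (c : code n) a : J := existT _ c a.
pose sg i (j : J) : J := j0 (tag j) (tagged (tag j) i (tagged j)).
pose sgV i (j : J) : J := j0 (tag j) ((tagged (tag j) i)^-1%g (tagged j)).
have sgK i : cancel (sg i) (sgV i).
  by move=> [c a]; rewrite /sg /sgV /j0 /= permK.
have sgVK i : cancel (sgV i) (sg i).
  by move=> [c a]; rewrite /sg /sgV /j0 /= permKV.
pose B (j : J) := C (pickle j).
pose q (j : J) := f (pickle j).
pose q' (j : J) := f' (pickle j).
have pq j : piso T (C 0%N) (B j) (q j) (q' j) by exact: ff.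
have mB j : measurable (B j) := piso_mcod (pq j).
have BZ j x : B j x -> Z x by exact: CZ.
have dB j k x : B j x -> B k x -> j = k.
  by move=> Bj Bk; apply: (pcan_inj (@pickleK J)); exact: dC Bj Bk.
(* [None] stands for the complement of [Z], where [g] is kept. *)
pose D (k : option J) := if k is Some j then B j else ~` Z.
have mD k : measurable (D k) by case: k => [j|]; [exact: mB|exact: measurableC].
have dD j k x : D j x -> D k x -> j = k.
  case: j => [j|]; case: k => [k|] //= Dj Dk.
  - by rewrite (dB _ _ _ Dj Dk).
  - by case: Dk; exact: BZ Dj.
  - by case: Dj; exact: BZ Dk.
pose move (s : J -> J) (h : X -> X) (k : option J) : X -> X :=
  if k is Some j then q (s j) \o q' j else h.
have movable s h : measurable_fun setT h -> exists F : X -> X,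
    [/\ measurable_fun setT F, forall x, ~ Z x -> F x = h x,
      forall j x, B j x -> F x = q (s j) (q' j x) &
      forall x, Z x -> (forall j, ~ B j x) -> F x = x].
  move=> mh; have [||i j x Di Dj|F [mF FD Fn]] := @measurable_glue _ X _ D (move s h).
  - exact: mD.
  - case=> [j|] //=; apply: measurableT_comp; [exact: piso_mfun (pq _)|exact: piso_minv (pq _)].
  - by rewrite (dD _ _ _ Di Dj).
  exists F; split=> // [x nZ|j x Bj|x Zx nB].
  - exact: (FD None).
  - exact: (FD (Some j)).
  - by apply: Fn => -[j|] //=; exact: nB.
have qB s j x : B j x -> B s (q s (q' j x)).
  by move=> Bj; apply: (piso_fun (pq s)); exact: (piso_inv (pq j)).
have q'q s j x : B j x -> q' s (q s (q' j x)) = q' j x.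
  by move=> Bj; apply: (pisoK (pq s)); exact: (piso_inv (pq j)).
have cases x : ~ Z x \/ (exists j, B j x) \/ (Z x /\ forall j, ~ B j x).
  have [Zx|] := pselect (Z x); last by left.
  have [[j Bj]|nB] := pselect (exists j, B j x); first by right; left; exists j.
  by right; right; split=> // j Bj; apply: nB; exists j.
have moveK s s' h h' (F F' : X -> X) : cancel s s' -> cancel h h' ->
    (forall x, ~ Z x -> ~ Z (h x)) ->
    (forall x, ~ Z x -> F x = h x) -> (forall j x, B j x -> F x = q (s j) (q' j x)) ->
    (forall x, Z x -> (forall j, ~ B j x) -> F x = x) ->
    (forall x, ~ Z x -> F' x = h' x) -> (forall j x, B j x -> F' x = q (s' j) (q' j x)) ->
    (forall x, Z x -> (forall j, ~ B j x) -> F' x = x) -> cancel F F'.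
  move=> sK hK hZ F1 F2 F3 F1' F2' F3' x.
  case: (cases x) => [nZ|[[j Bj]|[Zx nB]]].
  - by rewrite F1// F1' ?hK//; exact: hZ.
  - rewrite (F2 j)// (F2' (s j)); last exact: qB.
    by rewrite q'q// sK (pisoVK (pq j)).
  - by rewrite F3// F3'.
have /choice[g' g'P] : forall i, exists U : nsaut mu, [/\ orbital T U,
    forall x, ~ Z x -> U x = g i x,
    forall j x, B j x -> U x = q (sg i j) (q' j x) &
    forall x, Z x -> (forall j, ~ B j x) -> U x = x].
  move=> i.
  have [F [mF F1 F2 F3]] := movable (sg i) (g i) (measurable_aut (g i)).
  have [F' [mF' F1' F2' F3']] := movable (sgV i) (autV (g i)) (measurable_autV (g i)).
  have oF : orbital T F.
    move=> x; case: (cases x) => [nZ|[[j Bj]|[Zx nB]]].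
    - by rewrite F1//; exact: og.
    - rewrite (F2 j)//; apply: (same_orbit_trans (piso_orbit (piso_sym (pq j)) Bj)).
      by apply: (piso_orbit (pq _)); exact: (piso_inv (pq j)).
    - by rewrite F3//; exact: same_orbit_refl.
  have [||U [UE _]] := aut_builder mF mF' oF.
  - apply: (moveK (sg i) (sgV i) (g i) (autV (g i))) => //; first exact: autK.
    by move=> x nZ; rewrite Zg.
  - apply: (moveK (sgV i) (sg i) (autV (g i)) (g i)) => //; first exact: autVK.
    by move=> x nZ; rewrite -(Zg i) autVK.
  by exists U; rewrite UE; split.
have act_out w x : ~ Z x -> act g' w x = act g w x /\ ~ Z (act g w x).
  move=> nZ; elim: w => //= i w [-> nZw]; split; last by rewrite Zg.
  by case: (g'P i) => _ h _ _; exact: h.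
have act_copy w c a x : B (j0 c a) x ->
    act g' w x = q (j0 c (code_act c w a)) (q' (j0 c a) x).
  move=> Bx; elim: w => [|i w IH] /=; first by rewrite (pisoVK (pq _)).
  rewrite IH; case: (g'P i) => _ _ h _.
  by rewrite (h (j0 c (code_act c w a))) ?q'q//; exact: qB.
have act_rest w x : Z x -> (forall j, ~ B j x) -> act g' w x = x.
  by move=> Zx nB; elim: w => //= i w ->; case: (g'P i) => _ _ _; apply.
exists g'; split.
- by move=> i; case: (g'P i).
- move=> i; apply: le_lt_trans Ze; apply: le_measure; rewrite ?inE//.
    exact: measurable_aut_neq.
  move=> x /= ne; apply: contrapT => nZ; apply: ne.
  by case: (g'P i) => _ h _ _; rewrite h.
- move=> x; apply: code_exists; first by move=> i; exact: can_inj (autK _).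
  case: (cases x) => [nZ|[[[c a] Bj]|[Zx nB]]].
  + by apply: sub_finite_set (fin x) => _ [w ->]; exists w; case: (act_out w x nZ).
  + apply: (@sub_finite_set _ _ ((fun b => q (j0 c b) (q' (j0 c a) x)) @` setT)).
      by move=> _ [w ->]; exists (code_act c w a) => //; rewrite (act_copy w c a x Bj).
    exact/finite_image/finite_finset.
  + apply: (@sub_finite_set _ _ [set x]); last exact: finite_set1.
    by move=> _ [w ->]; exact: act_rest.
move=> c gc0; have Bc0 : mu (B (j0 c ord0)) = 0%E.
  apply: null_subset gc0 => //; first exact: measurable_has_code.
  move=> x Bx w w'; rewrite (act_copy w _ _ _ Bx) (act_copy w' _ _ _ Bx); split=> [qe|->//].
  have Bq b : B (j0 c b) (q (j0 c b) (q' (j0 c ord0) x)) by exact: qB.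
  have := Bq (code_act c w' ord0); rewrite -qe => /(dB _ _ _ (Bq _)).
  by move=> /eqP; rewrite eq_Tagged /= => /eqP.
apply: C0; apply: equidec_null (equidec_sym _) Bc0.
by exists (q (j0 c ord0)), (q' (j0 c ord0)).
Qed.

End generic_perturbation.

(** * The full group is Polish *)

Section countable_approximation.
Context {R : realType} {d : measure_display} {X : measurableType d}.
Context {mu : probability X R} (hmu : standard_probability mu).

(* Trees code the algebra of sets generated by the sets [phi > r] with [r]
   rational: a node stands for the complement of the union of its children. *)
Fixpoint eval_tree (phi : X -> R) (t : GenTree.tree rat) (x : X) : bool :=
  match t with
  | GenTree.Leaf r => ratr r < phi x
  | GenTree.Node _ l => ~~ has (fun t => eval_tree phi t x) l
  end.

(** Structural induction whose hypothesis reaches through the list of children. *)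
Let tree_ind (P : GenTree.tree rat -> Prop) :
  (forall r, P (GenTree.Leaf r)) ->
  (forall k l, (forall t, t \in l -> P t) -> P (GenTree.Node k l)) ->
  forall t, P t.
Proof.
move=> HL HN; fix IH 1 => -[r|k l]; first exact: HL.
apply: HN; elim: l => [|t l IHl] t'; first (rewrite in_nil; discriminate).
by rewrite inE => /orP[/eqP ->|]; [exact: IH|exact: IHl].
Qed.

Lemma measurable_eval_tree phi t : measurable_fun setT phi ->
  measurable [set x | eval_tree phi t x].
Proof.
move=> mphi; elim/tree_ind: t => [r|k l IH] /=.
  rewrite (_ : [set _ | _] = phi @^-1` `]ratr r, +oo[%classic).
    by rewrite -[_ @^-1` _]setTI; apply: mphi => //; exact: measurable_itv.
  by apply/seteqP; split=> x /=; rewrite in_itv /= andbT.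
rewrite (_ : [set _ | _] = ~` \big[setU/set0]_(t <- l) [set x | eval_tree phi t x]).
  apply: measurableC; rewrite big_seq; elim/big_ind: _ => //.
  exact: measurableU.
apply/seteqP; rewrite -bigcup_seq; split=> x /=.
  by move=> /hasPn nl [t tl] /=; apply/negP; exact: nl.
move=> nl; apply/hasPn => t tl; apply/negP => tx; apply: nl.
by exists t.
Qed.

(** The Borel subsets of the line whose preimages are approximable form a sigma-algebra containing
    the rays, hence are all the Borel sets. *)
Lemma tree_approximation : exists ev : GenTree.tree rat -> set X,
  (forall t, measurable (ev t)) /\
  forall A (e : R), measurable A -> 0 < e ->
    exists t, (mu [set x | ~ (A x <-> ev t x)] < e%:E)%E.
Proof.
have [phi [[_ phi_inj _] mphi mphiV _]] := hmu.
pose ev t := [set x | eval_tree phi t x].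
have mev t : measurable (ev t) by exact: measurable_eval_tree.
exists ev; split=> // A e mA e0; move: e e0.
pose diff (A B : set X) := [set x | ~ (A x <-> B x)].
have mdiff B C : measurable B -> measurable C -> measurable (diff B C).
  move=> mB mC; rewrite (_ : diff B C = (B `\` C) `|` (C `\` B)).
    by apply: measurableU; exact: measurableD.
  apply/seteqP; split=> x; rewrite /diff /=; last by tauto.
  by have [Bx|nB] := pselect (B x); have [Cx|nC] := pselect (C x); tauto.
pose good (B : set R) := measurable B /\ forall e : R, 0 < e ->
  exists t, (mu (diff (phi @^-1` B) (ev t)) < e%:E)%E.
have mpre B : measurable B -> measurable (phi @^-1` B).
  by move=> mB; rewrite -[_ @^-1` _]setTI; exact: mphi.
have goodU (F : nat -> set R) : (forall k, good (F k)) -> good (\bigcup_k F k).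
  move=> gF; have mF k : measurable (F k) by case: (gF k).
  split=> [|e e0]; first exact: bigcupT_measurable.
  pose S := phi @^-1` \bigcup_k F k.
  pose P k := S `\` \bigcup_(i in [set i | (i < k)%N]) (phi @^-1` F i).
  have mS : measurable S by apply: mpre; exact: bigcupT_measurable.
  have mP k : measurable (P k).
    by apply: measurableD => //; apply: bigcup_measurable => i _; exact: mpre.
  have e2 : 0 < e / 2 by rewrite divr_gt0.
  have [j k jk x [Sx nx]||N NP] := @decreasing_small _ _ _ mu P (e / 2) mP _ _ e2.
  - split=> // -[i /= ij Fi]; apply: nx; exists i => //=; exact: leq_trans jk.
  - suff -> : \bigcap_k P k = set0 by exact: measure0.
    apply/seteqP; split=> // x Px; have [[i _ Fi] _] := Px 0%N I.
    by have [_] := Px i.+1 I; apply; exists i => /=.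
  have /choice[q qP] : forall i, exists t,
      (mu (diff (phi @^-1` F i) (ev t)) < (e / 2 / (2 ^ i.+1)%:R)%:E)%E.
    by move=> i; case: (gF i) => _; apply; rewrite divr_gt0// ltr0n expn_gt0.
  (* Two nested nodes: the complement of the complement of a finite union. *)
  pose t := GenTree.Node 0 [:: GenTree.Node 0 (map q (iota 0 N))].
  have tE x : ev t x <-> exists2 i, (i < N)%N & ev (q i) x.
    rewrite /ev /= orbF negbK; split=> [/hasP[_ /mapP[i + ->] qx]|[i iN qx]].
      by rewrite mem_iota add0n => /andP[_ iN]; exists i.
    by apply/hasP; exists (q i) => //; apply: map_f; rewrite mem_iota add0n.
  exists t; pose Q := \bigcup_i (diff (phi @^-1` F i) (ev (q i))).
  have mQi i : measurable (diff (phi @^-1` F i) (ev (q i))).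
    by apply: mdiff => //; exact: mpre.
  have mQ : measurable Q by exact: bigcupT_measurable.
  have sub : diff S (ev t) `<=` P N `|` Q.
    move=> x nx; have [Px|nP] := pselect (P N x); [by left|right].
    apply: contrapT => nQ; apply: nx.
    have agree i : F i (phi x) <-> ev (q i) x.
      by apply: contrapT => ni; apply: nQ; exists i.
    rewrite tE; split=> [Sx|[i iN /agree Fi]]; last by exists i.
    have [i /= iN Fi] : (\bigcup_(i in [set i | (i < N)%N]) (phi @^-1` F i)) x.
      by apply: contrapT => ni; apply: nP.
    by exists i => //; apply/agree.
  have Qe : (mu Q <= (e / 2)%:E)%E.
    apply: (@geometric_cover _ _ _ _ _ Q _ (ltW e2) mQ mQi) => // i.
    exact/ltW/qP.
  apply: (@le_lt_trans _ _ (mu (P N) + mu Q)%E).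
    have h := @measureU2 _ _ _ mu _ _ (mP N) mQ.
    apply: le_trans h; apply: le_measure; rewrite ?inE//; last exact: measurableU.
    exact: mdiff.
  by rewrite [e in (_ < e%:E)%E]splitr EFinD; apply: lte_leD => //; [exact: fin_num_measure|exact: NP].
have goodC B : good B -> good (~` B).
  move=> [mB gB]; split; first exact: measurableC.
  move=> e e0; have [t te] := gB e e0; exists (GenTree.Node 0 [:: t]).
  rewrite (_ : diff _ _ = diff (phi @^-1` B) (ev t))//.
  have tE x : ev (GenTree.Node 0 [:: t]) x <-> ~ ev t x.
    by rewrite /ev /= orbF; split=> /negP.
  apply/predeqP => x; have := tE x.
  rewrite -[diff (_ @^-1` ~` _) _ x]/(~ (~ B (phi x) <-> ev (GenTree.Node 0 [:: t]) x)).
  rewrite -[diff _ _ x]/(~ (B (phi x) <-> ev t x)).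
  by have [Bx|nB] := pselect (B (phi x)); have [tx|ntx] := pselect (ev t x); tauto.
have good0 : good set0.
  split=> // e e0; exists (GenTree.Node 0 [:: GenTree.Node 0 [::]]).
  rewrite (_ : diff _ _ = set0) ?measure0 ?lte_fin//.
  by apply/seteqP; split=> // x nx; exfalso; apply: nx; split.
have good_ray (r : R) : good `]r, +oo[%classic.
  pose F k := if unpickle k is Some q then
    (if r <= ratr q then `](ratr q : R), +oo[%classic else set0) else set0.
  have -> : `]r, +oo[%classic = \bigcup_k F k.
    apply/seteqP; split=> x /=.
      rewrite in_itv /= andbT => rx; have [q] := rat_in_itvoo rx.
      rewrite in_itv /= => /andP[rq qx]; exists (pickle q); first exact: I.
      rewrite /F pickleK (ltW rq).
      have : x \in `](ratr q : R), +oo[ by rewrite in_itv /= qx.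
      exact.
    move=> [k _]; rewrite /F; case: unpickle => // q; case: ifP => // rq.
    by rewrite /= !in_itv /= !andbT; exact: le_lt_trans.
  apply: goodU => k; rewrite /F; case: unpickle => // q; case: ifP => // _.
  split; first exact: measurable_itv.
  move=> e e0; exists (GenTree.Leaf q).
  rewrite (_ : diff _ _ = set0) ?measure0 ?lte_fin//.
  apply/seteqP; split=> // x; rewrite /diff /ev /= in_itv /= andbT.
  by apply.
have goodB (B : set R) : measurable B -> good B.
  rewrite -[measurable B]/((@ocitv R).-sigma.-measurable B) RGenOInfty.measurableE.
  apply: smallest_sub => [|_ [r ->]//]; split=> // B'.
  by rewrite setTD; exact: goodC.
have [_ gA] := goodB _ (mphiV A mA).
move=> e e0; have [t te] := gA e e0; exists t.
(* A measurable set is the preimage of its Borel image because [phi] is injective. *)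
suff <- : phi @^-1` (phi @` A) = A by [].
apply/seteqP; split=> [x [y Ay /phi_inj <-]|x Ax]; rewrite ?inE//.
by exists x.
Qed.

End countable_approximation.

(** * Everywhere orbital representatives and continuity of the group operations *)

Section full_group_representatives.
Context {R : realType} {d : measure_display} {X : measurableType d}.
Context {mu : probability X R} (hmu : standard_probability mu) (T : nsaut mu).
Local Notation fg := (full_group hmu T).
Implicit Types (S U V : nsaut mu) (s t : fg).

(** On the core of the set where both [S] and its inverse follow the orbits nothing is changed; the
    map becomes the identity on the null rest. *)
Lemma orbital_representative S : preserves_orbits T S ->
  exists U, orbital T U /\ \forall x \ae mu, U x = S x.
Proof.
move=> [N [mN N0 NP]].
pose C := ~` N `&` (autV S @^-1` ~` N).
have mNV : measurable (autV S @^-1` N) by exact: measurable_preimage_autV.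
have mC : measurable C.
  by apply: measurableI; [exact: measurableC|apply: measurable_preimage_autV; exact: measurableC].
have C0 : mu (~` C) = 0%E.
  rewrite setCI -preimage_setC !setCK; apply: nullU => //.
  exact/preimage_autV_null.
have orb x : ~ N x -> same_orbit T x (S x).
  by move=> nN; apply: contrapT => nx; apply: nN; exact: NP.
have mG := measurable_core T mC.
have [||x _|x _|U [oU US _ _]] := aut_builder_on mG (@invariant_core _ _ _ _ T C)
  (measurable_aut S) (measurable_autV S).
- by move=> x /core_sub[/orb].
- move=> x Gx; apply: invariant_core (Gx); apply: same_orbit_sym.
  by have [_ /= /orb] := core_sub Gx; rewrite autVK.
- exact: autK.
- exact: autVK.
exists U; split=> //; exists (~` core T C); split; [exact: measurableC|exact: null_core|].
by move=> x /= ne Gx; apply: ne; exact: US.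
Qed.

Lemma representative_exists s : exists U, orbital T U /\ \pi_(Aut mu) U = val s.
Proof.
have hs : preserves_orbits T (repr (val s)).
  by apply/in_full_groupP; rewrite reprK; exact: valP.
have [U [oU US]] := orbital_representative hs; exists U; split=> //.
by rewrite -[RHS]reprK; apply/AutP.
Qed.

(** Unlike [repr], this representative preserves the orbit of every point. *)
Definition rep s : nsaut mu := sval (cid (representative_exists s)).

Lemma orbital_rep s : orbital T (rep s).
Proof. by rewrite /rep; case: cid => U []. Qed.

Lemma pi_rep s : \pi_(Aut mu) (rep s) = val s.
Proof. by rewrite /rep; case: cid => U []. Qed.

Lemma full_group_intro U : orbital T U -> exists s, val s = \pi_(Aut mu) U.
Proof.
move=> oU; have sP : \pi_(Aut mu) U \in in_full_group T.
  by apply/in_full_groupP; apply: aeW => x; exact: oU.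
by exists (Sub (\pi_(Aut mu) U) sP : fg); rewrite SubK.
Qed.

Lemma mdistE s t U V : \pi_(Aut mu) U = val s -> \pi_(Aut mu) V = val t ->
  mdist s t = fine (mu [set x | U x <> V x]).
Proof.
move=> Us Vt; rewrite -(uniform_distE U V hmu) Us Vt.
by [].
Qed.

Lemma mdist_lt s t U V (e : R) : \pi_(Aut mu) U = val s -> \pi_(Aut mu) V = val t ->
  (mdist s t < e) = (mu [set x | U x <> V x] < e%:E)%E.
Proof.
move=> Us Vt; rewrite (mdistE Us Vt) -lte_fin fineK// fin_num_measure//.
exact: measurable_aut_neq.
Qed.

Lemma pi_repM s t : \pi_(Aut mu) (aut_comp (rep s) (rep t)) = val (s * t)%g.
Proof. by rewrite -Defs.pi_mul !pi_rep. Qed.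

Lemma pi_repV s : \pi_(Aut mu) (aut_inv (rep s)) = val s^-1%g.
Proof. by rewrite -Defs.pi_inv pi_rep. Qed.

(** Right translations and inversion do not preserve the uniform metric when [mu] is not invariant;
    absolute continuity of a fixed automorphism controls them. *)
Lemma aut_small (f : X -> X) (e : R) (U : nsaut mu) : f = U \/ f = autV U -> 0 < e ->
  exists2 r : R, 0 < r & forall A, measurable A -> (mu A < r%:E)%E ->
    (mu (f @^-1` A) < e%:E)%E.
Proof.
move=> fU e0; apply: null_preserving_small => //.
  by case: fU => ->; [exact: measurable_aut|exact: measurable_autV].
by move=> A mA A0; case: fU => ->; [exact/preimage_aut_null|exact/preimage_autV_null].
Qed.

Lemma continuous_mulg : continuous (fun p : fg * fg => (p.1 * p.2)%g).
Proof.
move=> [s t]; apply/cvg_ballP => e e0 /=.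
have e2 : 0 < e / 2 by rewrite divr_gt0.
have [r r0 rP] := aut_small (or_introl (erefl (aut (rep t)))) e2.
exists (ball s r, ball t (e / 2)) => /=.
  by split; exact: nbhsx_ballx.
move=> [s' t'] /= []; rewrite !ballEmdist /= => ss' tt'.
rewrite (mdist_lt _ (pi_repM s t) (pi_repM s' t')).
rewrite (mdist_lt _ (pi_rep s) (pi_rep s')) in ss'.
rewrite (mdist_lt _ (pi_rep t) (pi_rep t')) in tt'.
have mst := measurable_aut_neq (rep s) (rep s') hmu.
have mt := measurable_aut_neq (rep t) (rep t') hmu.
have mp := measurable_preimage_aut (rep t) mst.
apply: (@le_lt_trans _ _ (mu (rep t @^-1` [set x | rep s x <> rep s' x]) +
    mu [set x | rep t x <> rep t' x])%E).
  have h := @measureU2 _ _ _ mu _ _ mp mt; apply: le_trans h.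
  apply: le_measure; rewrite ?inE; [exact: measurable_aut_neq|exact: measurableU|].
  move=> x /= ne; have [e1|] := pselect (rep t x = rep t' x); last by right.
  by left => e3; apply: ne; rewrite -e1.
by rewrite [e]splitr EFinD; apply: lteD => //; exact: rP.
Qed.

Lemma continuous_invg : continuous (fun s : fg => s^-1%g).
Proof.
move=> s A /nbhs_ballP[e e0 eA].
have [r r0 rP] := aut_small (or_intror (erefl (autV (rep s)))) e0.
rewrite /fmap /=; apply/nbhs_ballP; exists r => // s'; rewrite ballEmdist /= => ss'.
apply: eA; rewrite ballEmdist /=.
rewrite (mdist_lt _ (pi_repV s) (pi_repV s')).
rewrite (mdist_lt _ (pi_rep s) (pi_rep s')) in ss'.
have mst := measurable_aut_neq (rep s) (rep s') hmu.
apply: le_lt_trans (rP _ mst ss'); apply: le_measure; rewrite ?inE.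
- exact: (measurable_aut_neq (aut_inv (rep s)) (aut_inv (rep s'))).
- exact: measurable_preimage_autV.
move=> y /= ne e1; apply: ne; rewrite autVK in e1.
by rewrite [y in RHS]e1 autK.
Qed.

End full_group_representatives.

(** * Completeness *)

Section full_group_polish.
Context {R : realType} {d : measure_display} {X : measurableType d}.
Context {mu : probability X R} (hmu : standard_probability mu) (T : nsaut mu).
Local Notation fg := (full_group hmu T).
Implicit Types (S U V : nsaut mu) (s t : fg).

(** The second term makes the inverses converge as well, and their limit inverts the limit of the
    maps. *)
Let rho s t : R := mdist s t + mdist s^-1%g t^-1%g.

Lemma measurable_neq (f g : X -> X) : measurable_fun setT f ->
  measurable_fun setT g -> measurable [set x | f x <> g x].
Proof.
move=> mf mg; have := measurableC (measurable_eqset hmu mf mg).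
by congr measurable; apply/seteqP; split.
Qed.

Let measurable_eventually (h : nat -> X -> X) :
  (forall k, measurable_fun setT (h k)) -> exists F, measurable_fun setT F /\
  forall x K, (forall k, (K <= k)%N -> h k x = h K x) -> F x = h K x.
Proof.
move=> mh; pose C K := [set x | forall k, h (K + k)%N x = h K x].
have mC K : measurable (C K).
  by apply: measurable_forall => k; apply: (measurable_eqset hmu).
have [//|//|i j x Ci Cj|F [mF FC _]] := @measurable_glue _ X _ C h.
  by have := Ci j; have := Cj i; rewrite addnC => -> ->.
exists F; split=> // x K hK; apply: FC => k.
by rewrite hK// leq_addr.
Qed.

Let summable_stable (h : nat -> X -> X) :
  (forall k, measurable_fun setT (h k)) ->
  (forall k, (mu [set x | h k x <> h k.+1 x] <= (1 / (2 ^ k.+1)%:R)%:E)%E) ->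
  exists L, [/\ measurable L, mu L = 0%E &
    forall x, ~ L x -> exists K, forall k, (K <= k)%N -> h k x = h K x].
Proof.
move=> mh hsmall; pose E k := [set x | h k x <> h k.+1 x].
have mE k : measurable (E k) by exact: measurable_neq.
exists (lim_sup_set E); split.
- by apply: bigcap_measurable => // k _; exact: bigcup_measurable.
- exact: limsup_null.
move=> x nL; have [K nK] : exists K, ~ (\bigcup_(j in [set j | (K <= j)%N]) E j) x.
  by apply: contrapT => nK; apply: nL => K _; apply: contrapT => nKx; apply: nK; exists K.
exists K => k Kk; rewrite -(subnKC Kk); elim: (k - K)%N => [|m IH].
  by rewrite addn0.
rewrite -IH addnS; apply/esym; apply: contrapT => ne; apply: nK.
by exists (K + m)%N => //=; exact: leq_addr.
Qed.

Lemma full_group_complete (u : nat -> fg) :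
  (forall e, 0 < e -> exists N, forall m n, (N <= m)%N -> (N <= n)%N ->
    rho (u m) (u n) < e) -> exists l : fg, u @ \oo --> l.
Proof.
move=> cauchy; have /choice[N NP] : forall k : nat, exists N, forall m n,
    (N <= m)%N -> (N <= n)%N -> rho (u m) (u n) < 1 / (2 ^ k.+1)%:R.
  by move=> k; apply: cauchy; rewrite divr_gt0// ltr0n expn_gt0.
(* Partial sums of [(N i).+1]: nondecreasing, at least [N k] and at least [k], so that [v] is a
   subsequence with summable increments. *)
pose M k := (\sum_(i < k.+1) (N i).+1)%N.
have MS k : (M k <= M k.+1)%N by rewrite /M [leqRHS]big_ord_recr leq_addr.
have NM k : (N k <= M k)%N.
  by rewrite /M big_ord_recr /=; apply: leq_trans (leq_addl _ _).
have Mk k : (k <= M k)%N.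
  elim: k => // k IH; apply: (leq_ltn_trans IH).
  by rewrite /M [ltnRHS]big_ord_recr /= addnS ltnS leq_addr.
pose v k := u (M k); pose V k := rep (v k).
have v_rho k : rho (v k) (v k.+1) < 1 / (2 ^ k.+1)%:R.
  by apply: NP; [exact: NM|exact: leq_trans (NM k) (MS k)].
have V1 k : mdist (v k) (v k.+1) < 1 / (2 ^ k.+1)%:R.
  by apply: le_lt_trans (v_rho k); rewrite lerDl mdist_ge0.
have V2 k : mdist (v k)^-1%g (v k.+1)^-1%g < 1 / (2 ^ k.+1)%:R.
  by apply: le_lt_trans (v_rho k); rewrite lerDr mdist_ge0.
have mV k : measurable_fun setT (V k) by exact: measurable_aut.
have mVV k : measurable_fun setT (autV (V k)) by exact: measurable_autV.
have V1' k : (mu [set x | V k x <> V k.+1 x] <= (1 / (2 ^ k.+1)%:R)%:E)%E.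
  by apply/ltW; rewrite -(mdist_lt _ (pi_rep (v k)) (pi_rep (v k.+1))).
have V2' k : (mu [set x | autV (V k) x <> autV (V k.+1) x] <= (1 / (2 ^ k.+1)%:R)%:E)%E.
  by apply/ltW; have := V2 k; rewrite (mdist_lt _ (pi_repV (v k)) (pi_repV (v k.+1))).
have [L1 [mL1 L10 L1P]] := summable_stable mV V1'.
have [L2 [mL2 L20 L2P]] := summable_stable mVV V2'.
have [F [mF FP]] := measurable_eventually mV.
have [F' [mF' F'P]] := measurable_eventually mVV.
pose C := ~` (L1 `|` L2); have mC : measurable C.
  by apply: measurableC; exact: measurableU.
have C0 : mu (~` C) = 0%E by rewrite setCK; exact: nullU.
pose G := core T C; have mG : measurable G by exact: measurable_core.
have iG : invariant_set T G by exact: invariant_core.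
have GL1 x : G x -> exists K, forall k, (K <= k)%N -> V k x = F x.
  move=> /core_sub nL; have [|K KP] := L1P x; first by move=> Lx; apply: nL; left.
  by exists K => k Kk; rewrite (FP x K KP); exact: KP.
have GL2 x : G x -> exists K, forall k, (K <= k)%N -> autV (V k) x = F' x.
  move=> /core_sub nL; have [|K KP] := L2P x; first by move=> Lx; apply: nL; right.
  by exists K => k Kk; rewrite (F'P x K KP); exact: KP.
have oF x : G x -> same_orbit T x (F x).
  by move=> /GL1[K KP]; rewrite -(KP K)//; exact: orbital_rep.
have oF' x : G x -> same_orbit T x (F' x).
  by move=> /GL2[K KP]; rewrite -(KP K)//; apply: orbital_autV; exact: orbital_rep.
have GF' x : G x -> G (F' x) by move=> Gx; exact: iG (oF' x Gx) Gx.
have FK x : G x -> F' (F x) = x.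
  move=> Gx; have [K KP] := GL1 x Gx; have [K' KP'] := GL2 _ (iG _ _ (oF x Gx) Gx).
  by rewrite -(KP' (maxn K K')) ?leq_maxr// -(KP (maxn K K')) ?leq_maxl// autK.
have FVK x : G x -> F (F' x) = x.
  move=> Gx; have [K KP] := GL2 x Gx; have [K' KP'] := GL1 _ (GF' x Gx).
  by rewrite -(KP' (maxn K K')) ?leq_maxr// -(KP (maxn K K')) ?leq_maxl// autVK.
have [S [oS SF _ _]] := aut_builder_on mG iG mF mF' oF GF' FK FVK.
have [l lS] := full_group_intro hmu oS.
exists l; apply/cvg_ballP => e e0.
have e2 : 0 < e / 2 by rewrite divr_gt0.
pose D k := \bigcup_(j in [set j | (k <= j)%N]) [set x | V j x <> S x].
have mD k : measurable (D k).
  by apply: bigcup_measurable => j _; exact: measurable_aut_neq.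
have [i j ij x [k /= jk Vk]||k0 k0P] := @decreasing_small _ _ _ mu D (e / 2) mD _ _ e2.
- by exists k => //=; exact: leq_trans jk.
- apply: null_subset (null_core T mC C0); [exact: bigcapT_measurable|exact: measurableC|].
  move=> x Dx Gx; have [K KP] := GL1 x Gx.
  by have [k /= Kk] := Dx K I; apply; rewrite KP// SF.
have [N0 N0P] := cauchy _ e2.
pose k := maxn k0 N0.
have vl : mdist (v k) l < e / 2.
  rewrite (mdist_lt _ (pi_rep (v k)) (esym lS)).
  apply: le_lt_trans (k0P k (leq_maxl _ _)); apply: le_measure; rewrite ?inE//.
    exact: measurable_aut_neq.
  by move=> x ne; exists k => /=.
exists N0 => // m /= N0m; apply: ball_sym; rewrite ballEmdist /=.
apply: le_lt_trans (metric_triangle _ (v k) _) _; rewrite [e]splitr ltrD//.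
apply: le_lt_trans (N0P m (M k) N0m _); first by rewrite lerDl mdist_ge0.
by apply: leq_trans (Mk k); exact: leq_maxr.
Qed.

End full_group_polish.

(** * Separability *)

Section full_group_separable.
Context {R : realType} {d : measure_display} {X : measurableType d}.
Context {mu : probability X R} (hmu : standard_probability mu) (T : nsaut mu).
Local Notation fg := (full_group hmu T).
Implicit Types (S U V : nsaut mu) (s t : fg).

(** A list of pairs (exponent, tree) codes the map that applies to [x] the power of [T] attached to
    the first tree containing [x]. These countably many maps need not be bijective. *)
Lemma orbital_approximation : exists (W : countType) (F : W -> X -> X),
  (forall w, measurable_fun setT (F w)) /\
  forall S (e : R), orbital T S -> 0 < e ->
    exists w, (mu [set x | S x <> F w x] < e%:E)%E.
Proof.
have [ev [mev evP]] := tree_approximation hmu.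
pose F (w : seq (int * GenTree.tree rat)) x :=
  foldr (fun p y => if `[< ev p.2 x >] then aut_iter T p.1 x else y) x w.
have mF w : measurable_fun setT (F w).
  elim: w => [|p w IH]; first exact: measurable_id.
  move=> _ B mB; rewrite setTI.
  rewrite (_ : _ @^-1` _ = (ev p.2 `&` aut_iter T p.1 @^-1` B) `|`
    (~` ev p.2 `&` F w @^-1` B)).
    apply: measurableU; apply: measurableI; [exact: mev|exact: measurable_preimage_iter
      |apply: measurableC; exact: mev|exact: measurable_preimage].
  apply/seteqP; split=> x /=; rewrite /F /=; case: asboolP => [ex|nx] /=.
  - by left.
  - by right.
  - by case=> -[].
  - by case=> -[].
exists (seq (int * GenTree.tree rat) : countType), F; split=> // S e oS e0.
pose z k : int := odflt 0 (unpickle k).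
pose A i := [set x | S x = aut_iter T (z i) x].
have mA i : measurable (A i).
  by apply: (measurable_eqset hmu); [exact: measurable_aut|exact: measurable_aut_iter].
pose A' i := A i `\` \bigcup_(j in [set j | (j < i)%N]) A j.
have mA' i : measurable (A' i) by apply: measurableD => //; exact: bigcup_measurable.
have dA' i j x : A' i x -> A' j x -> i = j.
  move=> [Ei ni] [Ej nj]; case: (ltngtP i j) => // ij.
    by case: nj; exists i.
  by case: ni; exists j.
have A'P x i : A i x -> exists2 j, (j <= i)%N & A' j x.
  move=> Ai; have exk : exists k, `[< A k x >] by exists i; apply/asboolP.
  case: (ex_minnP exk) => m /asboolP Am mmin; exists m; first exact/mmin/asboolP.
  split=> // -[j /= jm Aj].
  by have := mmin j; rewrite leqNgt jm => /(_ _)/negP; apply; first exact/asboolP.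
have e2 : 0 < e / 2 by rewrite divr_gt0.
pose P k := ~` \bigcup_(i in [set i | (i < k)%N]) A' i.
have mP k : measurable (P k) by apply: measurableC; exact: bigcup_measurable.
have [j k jk x nx||N NP] := @decreasing_small _ _ _ mu P (e / 2) mP _ _ e2.
- by move=> [i /= ij Ai]; apply: nx; exists i => //=; exact: leq_trans jk.
- suff -> : \bigcap_k P k = set0 by exact: measure0.
  apply/seteqP; split=> // x Px; have [n Sx] := oS x.
  have Ai : A (pickle n) x by rewrite /A /= /z pickleK.
  have [i _ A'i] := A'P x _ Ai.
  by have := Px i.+1 I; apply; exists i => /=.
have /choice[q qP] : forall i, exists b,
    (mu [set x | ~ (A' i x <-> ev b x)] < (e / 2 / (2 ^ i.+1)%:R)%:E)%E.
  by move=> i; apply: evP; rewrite ?divr_gt0// ltr0n expn_gt0.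
pose Q i := [set x | ~ (A' i x <-> ev (q i) x)].
have mQ i : measurable (Q i).
  rewrite (_ : Q i = (A' i `\` ev (q i)) `|` (ev (q i) `\` A' i)).
    by apply: measurableU; apply: measurableD.
  apply/predeqP => x; rewrite -[Q i x]/(~ (A' i x <-> ev (q i) x)).
  rewrite -[(_ `|` _) x]/((A' i x /\ ~ ev (q i) x) \/ (ev (q i) x /\ ~ A' i x)).
  by have [a|na] := pselect (A' i x); have [b|nb] := pselect (ev (q i) x); tauto.
have mUQ : measurable (\bigcup_i Q i) by exact: bigcupT_measurable.
exists [seq (z i, q i) | i <- iota 0 N].
set w := map _ _.
have Fw (l : seq nat) x i : (forall j, ev (q j) x <-> j = i) -> i \in l ->
    F [seq (z i, q i) | i <- l] x = aut_iter T (z i) x.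
  move=> evi; elim: l => // j l IH; rewrite inE /F /=.
  case: asboolP => [/evi -> //|nj] /orP[/eqP ij|il]; last exact: IH.
  by case: nj; apply/evi.
have sub : [set x | S x <> F w x] `<=` P N `|` \bigcup_i Q i.
  move=> x /= ne; have [Px|nP] := pselect (P N x); [by left|right].
  apply: contrapT => nQ; apply: ne.
  have evA j : A' j x <-> ev (q j) x by apply: contrapT => nj; apply: nQ; exists j.
  have [i /= iN A'i] : (\bigcup_(i in [set i | (i < N)%N]) A' i) x.
    by apply: contrapT => ni; apply: nP.
  rewrite (Fw _ _ i); first by case: A'i.
    move=> j; split=> [/evA A'j|->]; [exact: dA' A'j A'i|exact/evA].
  by rewrite mem_iota add0n iN.
have Qe : (mu (\bigcup_i Q i) <= (e / 2)%:E)%E.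
  apply: (@geometric_cover _ _ _ _ Q _ _ (ltW e2) mUQ mQ) => // i.
  exact/ltW/qP.
apply: (@le_lt_trans _ _ (mu (P N) + mu (\bigcup_i Q i))%E).
  have h := @measureU2 _ _ _ mu _ _ (mP N) mUQ.
  apply: le_trans h; apply: le_measure; rewrite ?inE//; last exact: measurableU.
  by apply: (measurable_neq hmu) => //; exact: measurable_aut.
by rewrite [e in (_ < e%:E)%E]splitr EFinD; apply: lte_leD => //;
  [exact: fin_num_measure|exact: NP].
Qed.

(** The approximating maps may lie outside the full group, so for each map and each radius one
    element of the group within that radius is picked, if any; 1 is the default value. *)
Lemma full_group_separable : exists2 D : set fg, countable D & dense D.
Proof.
have [W [F [mF FP]]] := orbital_approximation.
pose close s (p : W * nat) := (mu [set x | rep s x <> F p.1 x] < (p.2.+1%:R^-1)%:E)%E.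
have /choice[pick pickP] : forall p, exists s, (exists t, close t p) -> close s p.
  move=> p; have [[t tp]|nt] := pselect (exists t, close t p); first by exists t.
  by exists 1%g => -[t tp]; case: nt; exists t.
exists (range pick).
  exact: sub_countable (card_image_le _ _) (countableP _).
move=> O [s Os] oO.
have /nbhs_ballP[e /= e0 eO] : nbhs s O by exact: open_nbhs_nbhs.
have e2 : 0 < e / 2 by rewrite divr_gt0.
pose k := Num.bound (e / 2)^-1.
have ke : k.+1%:R^-1 < e / 2.
  rewrite invf_plt ?posrE//.
  by apply: lt_trans (archi_boundP _) _; rewrite ?invr_ge0 ?ltW// ltr_nat.
have k0 : 0 < k.+1%:R^-1 :> R by rewrite invr_gt0.
have [w sk] : exists w, close s (w, k) := FP (rep s) _ (orbital_rep s) k0.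
have tk : close (pick (w, k)) (w, k) by apply: pickP; exists s.
exists (pick (w, k)); split; last by exists (w, k).
apply: eO; rewrite ballEmdist /= (mdist_lt _ (pi_rep s) (pi_rep (pick (w, k)))).
have m1 : measurable [set x | rep s x <> F w x].
  by apply: (measurable_neq hmu) => //; exact: measurable_aut.
have m2 : measurable [set x | rep (pick (w, k)) x <> F w x].
  by apply: (measurable_neq hmu) => //; exact: measurable_aut.
have h := @measureU2 _ _ _ mu _ _ m1 m2.
apply: (@le_lt_trans _ _ (mu [set x | rep s x <> F w x] +
    mu [set x | rep (pick (w, k)) x <> F w x])%E).
  apply: le_trans h; apply: le_measure; rewrite ?inE;
    [exact: measurable_aut_neq|exact: measurableU|].
  move=> x /= ne; have [e1|] := pselect (rep s x = F w x); last by left.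
  by right => e3; apply: ne; rewrite e1 e3.
rewrite [e]splitr EFinD; apply: lteD.
  by apply: lt_trans sk _; rewrite lte_fin.
by apply: lt_trans tk _; rewrite lte_fin.
Qed.

Lemma full_group_polish : polish_group R fg.
Proof.
split; [|exact: continuous_mulg|exact: continuous_invg].
split; first exact: full_group_separable.
exists (fun s t => mdist s t + mdist s^-1%g t^-1%g); split.
- move=> s t; split=> [/eqP|->]; last by rewrite !mdistxx addr0.
  by rewrite paddr_eq0 ?mdist_ge0// => /andP[/eqP/mdist_positivity].
- by move=> s t; rewrite metric_sym [X in _ + X]metric_sym.
- move=> s t u; rewrite addrACA; apply: lerD; exact: metric_triangle.
- move=> s U; split=> [/nbhs_ballP[e e0 eU]|[e e0 eU]].
    exists e => // t /= st; apply: eU; rewrite ballEmdist /=.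
    by apply: le_lt_trans st; rewrite lerDl mdist_ge0.
  have e2 : 0 < e / 2 by rewrite divr_gt0.
  (* Continuity of inversion makes the balls of the new metric neighbourhoods, so the second term
     does not change the topology. *)
  have /nbhs_ballP[r r0 rP] := @continuous_invg _ _ _ _ hmu T s _ (nbhsx_ballx _ _ e2).
  apply/nbhs_ballP; exists (Num.min r (e / 2)); first by rewrite /= lt_min r0.
  move=> t; rewrite ballEmdist /= lt_min => /andP[str ste].
  apply: eU => /=; rewrite [e]splitr ltrD//.
  by have := rP t; rewrite !ballEmdist /=; apply.
- exact: full_group_complete.
Qed.

End full_group_separable.

(** * Comeager conjugacy classes *)

Section product_balls.
Context {R : realType} (n : nat) (M : pseudoMetricType R).

(** If no ball fitted inside [U], points of shrinking balls chosen outside [U] would converge to [x]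
    coordinatewise, hence in the pointwise topology. *)
Lemma ptws_nbhs_ball (x : {ptws 'I_n -> M}) (U : set {ptws 'I_n -> M}) :
  nbhs x U <-> exists2 e : R, 0 < e &
    forall y : {ptws 'I_n -> M}, (forall i, ball (x i) e (y i)) -> U y.
Proof.
split=> [xU|[e e0 eU]].
  apply: contrapT => nU.
  have /choice[u uP] : forall k : nat, exists y : {ptws 'I_n -> M},
      (forall i, ball (x i) k.+1%:R^-1 (y i)) /\ ~ U y.
    move=> k; apply: contrapT => ny; apply: nU; exists k.+1%:R^-1.
      by rewrite invr_gt0.
    by move=> y xy; apply: contrapT => nUy; apply: ny; exists y.
  have ux : u @ \oo --> x.
    apply/cvg_sup => i V [V' [[W] oW <-] Wx WV]; apply: (filterS WV).
    have /nbhs_ballP[e e0 eW] : nbhs (x i) W by exact: open_nbhs_nbhs.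
    exists (Num.bound e^-1) => // k /= ek; apply: eW.
    apply: le_ball (proj1 (uP k) i); rewrite invf_ple ?posrE//.
    apply: le_trans (ltW (archi_boundP _)) _; first by rewrite invr_ge0 ltW.
    by rewrite ler_nat; exact: leq_trans ek _.
  have [k _ kU] := ux _ xU.
  by case: (uP k) => _; apply; exact: (kU k (leqnn k)).
have xi i : nbhs x [set y : {ptws 'I_n -> M} | ball (x i) e (y i)].
  exact: (@proj_continuous _ (fun=> M) i x _ (nbhsx_ballx _ _ e0)).
have : nbhs x [set y : {ptws 'I_n -> M} | forall i, ball (x i) e (y i)].
  exact: filter_forall xi.
exact: filterS.
Qed.

Lemma ptws_open_ball (U : set {ptws 'I_n -> M}) :
  (forall x, U x -> exists2 e : R, 0 < e &
    forall y : {ptws 'I_n -> M}, (forall i, ball (x i) e (y i)) -> U y) ->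
  open U.
Proof. by move=> hU; rewrite openE => x /hU/ptws_nbhs_ball. Qed.

End product_balls.

(** * The G-delta set of generic tuples *)

Section generic_tuples.
Context {R : realType} {d : measure_display} {X : measurableType d}.
Context {mu : probability X R} (hmu : standard_probability mu) (T : nsaut mu).
Context (n : nat).
Local Notation fg := (full_group hmu T).
Local Notation fgn := {ptws 'I_n -> fg}.
Implicit Types (x y : fgn) (c : code n) (s : seq (code n)).

Definition generators x : 'I_n -> nsaut mu := fun i => rep (x i).

Definition coded s x : set X :=
  \big[setU/set0]_(c <- s) has_code c (generators x).

Lemma measurable_coded s x : measurable (coded s x).
Proof.
rewrite /coded; elim/big_ind: _ => //; first exact: measurableU.
by move=> c _; exact: measurable_has_code.
Qed.

Lemma orbital_generators x i : orbital T (generators x i).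
Proof. exact: orbital_rep. Qed.

(* [has_code c] only involves the generators at the finitely many points
   reached by words representing the elements of the code. *)
Lemma has_code_perturb x c : exists v : 'I_(tag c).+1 -> seq 'I_n, forall y,
  has_code c (generators x) `\` has_code c (generators y) `<=`
  \big[setU/set0]_(p <- enum {: 'I_n * 'I_(tag c).+1})
    (act (generators x) (v p.2) @^-1`
      [set z | generators x p.1 z <> generators y p.1 z]).
Proof.
have /choice[v vP] : forall a : 'I_(tag c).+1, exists w,
    forall w', code_act c w' ord0 = a -> code_act c w ord0 = a.
  move=> a; have [[w wa]|na] := pselect (exists w, code_act c w ord0 = a).
    by exists w.
  by exists [::] => w' w'a; case: na; exists w'.
exists v => y z [xz nyz]; apply: contrapT => nz; apply: nyz.
have eqg i a : generators x i (act (generators x) (v a) z) =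
    generators y i (act (generators x) (v a) z).
  apply: contrapT => ne; apply: nz; rewrite -bigcup_seq.
  by exists (i, a); first exact: mem_enum.
have acty w : act (generators y) w z = act (generators x) w z.
  elim: w => //= i w ->; have e : act (generators x) w z =
      act (generators x) (v (code_act c w ord0)) z.
    by apply/xz; apply/esym; exact: (vP _ w).
  by rewrite e eqg.
by move=> w w'; rewrite !acty.
Qed.

(** Only the loss of coded points is bounded, which is what openness of a strict lower bound
    requires. The loss lies in finitely many preimages, under fixed words in the generators of [x],
    of the sets where [x] and [y] differ. *)
Lemma coded_perturb x s (e : R) : 0 < e -> exists2 r : R, 0 < r &
  forall y, (forall i, ball (x i) r (y i)) ->
    (mu (coded s x `\` coded s y) < e%:E)%E.
Proof.
have small (J : Type) (l : seq J) (f : J -> 'I_n * seq 'I_n) (e' : R) : 0 < e' ->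
    exists2 r : R, 0 < r & forall A : 'I_n -> set X,
      (forall i, measurable (A i)) -> (forall i, (mu (A i) < r%:E)%E) ->
      measurable (\big[setU/set0]_(j <- l) (act (generators x) (f j).2 @^-1` A (f j).1)) /\
      (mu (\big[setU/set0]_(j <- l) (act (generators x) (f j).2 @^-1` A (f j).1)) < e'%:E)%E.
  elim: l e' => [|j l IH] e' e'0.
    by exists 1 => // A _ _; rewrite big_nil measure0 lte_fin.
  have e20 : 0 < e' / 2 by rewrite divr_gt0.
  have [r r0 rP] := IH _ e20.
  have [U UE] := act_aut (generators x) (f j).2.
  have [r' r'0 r'P] := aut_small (or_introl (erefl (aut U))) e20.
  exists (Num.min r r'); first by rewrite lt_min r0.
  move=> A mA Ar; have [|mI I2] := rP A mA.
    by move=> i; have := Ar i; rewrite EFin_min lt_min => /andP[].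
  rewrite !big_cons; set I := \big[_/_]_(_ <- l) _ in mI I2 *.
  have mf : measurable (act (generators x) (f j).2 @^-1` A (f j).1).
    by apply: measurable_preimage => //; exact: measurable_act.
  split; first exact: measurableU.
  have h := @measureU2 _ _ _ mu _ _ mf mI; apply: le_lt_trans h _.
  rewrite [e']splitr EFinD; apply: lteD => //; rewrite -UE; apply: r'P => //.
  by have := Ar (f j).1; rewrite EFin_min lt_min => /andP[].
have single c (e' : R) : 0 < e' -> exists2 r : R, 0 < r &
    forall y, (forall i, ball (x i) r (y i)) ->
    (mu (has_code c (generators x) `\` has_code c (generators y)) < e'%:E)%E.
  move=> e'0; have [v vP] := has_code_perturb x c.
  have [r r0 rP] := small _ (enum {: 'I_n * 'I_(tag c).+1}) (fun p => (p.1, v p.2)) _ e'0.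
  exists r => // y xy.
  have [||mI Ie] := rP (fun i => [set z | generators x i z <> generators y i z]).
  - by move=> i; exact: measurable_aut_neq.
  - move=> i; have := xy i; rewrite ballEmdist /=.
    by rewrite (mdist_lt _ (pi_rep (x i)) (pi_rep (y i))).
  apply: le_lt_trans Ie; apply: le_measure; rewrite ?inE//.
  by apply: measurableD; exact: measurable_has_code.
elim: s e => [|c s IH] e e0.
  by exists 1 => // y _; rewrite /coded big_nil set0D measure0 lte_fin.
have e20 : 0 < e / 2 by rewrite divr_gt0.
have [r r0 rP] := IH _ e20; have [r' r'0 r'P] := single c _ e20.
exists (Num.min r r'); first by rewrite lt_min r0.
move=> y xy.
have ry i : ball (x i) r (y i) by apply: le_ball (xy i); rewrite ge_min lexx.
have r'y i : ball (x i) r' (y i) by apply: le_ball (xy i); rewrite ge_min lexx orbT.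
have m1 : measurable (has_code c (generators x) `\` has_code c (generators y)).
  by apply: measurableD; exact: measurable_has_code.
have m2 : measurable (coded s x `\` coded s y).
  by apply: measurableD; exact: measurable_coded.
have h := @measureU2 _ _ _ mu _ _ m1 m2.
apply: (@le_lt_trans _ _ (mu (has_code c (generators x) `\` has_code c (generators y)) +
    mu (coded s x `\` coded s y))%E); last first.
  by rewrite [e]splitr EFinD; apply: lteD; [exact: r'P|exact: rP].
apply: le_trans h; apply: le_measure; rewrite ?inE; last 1 first.
- rewrite /coded !big_cons => z [[cz|sz] nz].
    by left; split=> // yz; apply: nz; left.
  by right; split=> // yz; apply: nz; right.
- by apply: measurableD; exact: measurable_coded.
- exact: measurableU.
Qed.

Lemma open_coded s (r : R) : open [set x | (r%:E < mu (coded s x))%E].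
Proof.
apply: ptws_open_ball => x /= rx.
have mx := measurable_coded s x.
have xE : mu (coded s x) = (fine (mu (coded s x)))%:E by rewrite fineK// fin_num_measure.
set a := fine (mu (coded s x)) in xE; rewrite xE lte_fin in rx.
have e0 : 0 < a - r by rewrite subr_gt0.
have [r' r'0 r'P] := coded_perturb x s e0; exists r' => // y xy /=.
have my := measurable_coded s y.
have mD : measurable (coded s x `\` coded s y) by exact: measurableD.
rewrite ltNge; apply/negP => yr.
have h := @measureU2 _ _ _ mu _ _ mD my.
suff : (mu (coded s x) < a%:E)%E by rewrite xE ltxx.
apply: (@le_lt_trans _ _ (mu (coded s x `\` coded s y) + mu (coded s y))%E).
  apply: le_trans h; apply: le_measure; rewrite ?inE//; first exact: measurableU.
  by move=> z xz; have [yz|nyz] := pselect (coded s y z); [right|left].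
rewrite -[a](subrK r) EFinD; apply: lte_leD => //; last exact: r'P.
exact: fin_num_measure.
Qed.

Definition generic x :=
  mu (~` [set z | exists c, has_code c (generators x) z]) = 0%E /\
  forall c, mu (has_code c (generators x)) <> 0%E.

Lemma Gdelta_generic : Gdelta [set x | generic x].
Proof.
(* One open condition per index: for [inl m], finitely many codes cover more than [1 - m.+1%:R^-1]
   of the space; for [inr c], the code [c] has positive measure. Finite lists are what makes the
   covering condition open. *)
pose F (k : nat) : set fgn := match (unpickle k : option (nat + code n)) with
  | Some (inl m) => \bigcup_s [set x | ((1 - m.+1%:R^-1)%:E < mu (coded s x))%E]
  | Some (inr c) => [set x | (0%:E < mu (coded [:: c] x))%E]
  | None => setT end.
exists F.
  move=> k; rewrite /F; case: unpickle => [[m|c]|]; last exact: openT.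
    by apply: bigcup_open => s _; exact: open_coded.
  exact: open_coded.
have coded1 c x : coded [:: c] x = has_code c (generators x).
  by rewrite /coded big_seq1.
pose C x := [set z | exists c, has_code c (generators x) z].
have mC x : measurable (C x).
  by apply: measurable_exists => c; exact: measurable_has_code.
have coded_sub s x : coded s x `<=` C x.
  by rewrite /coded -bigcup_seq => z [c _ cz]; exists c.
apply/seteqP; split=> [x [C0 cpos] k _|x Fx].
  rewrite /F; case: unpickle => [[m|c]|] //; last first.
    by rewrite /= coded1 lt0e measure_ge0 andbT; exact/eqP.
  pose s N := pmap (fun k => unpickle k : option (code n)) (iota 0 N).
  pose D N := ~` coded (s N) x.
  have mD N : measurable (D N) by apply: measurableC; exact: measurable_coded.
  have memD N z : coded (s N) x z <-> exists2 k, (k < N)%N &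
      exists2 c, unpickle k = Some c & has_code c (generators x) z.
    rewrite /coded -bigcup_seq; split=> [[c /= + cz]|[j jN [c jc cz]]].
      rewrite mem_pmap => /mapP[j]; rewrite mem_iota add0n => /andP[_ jN] jc.
      by exists j => //; exists c.
    exists c => //=; rewrite mem_pmap; apply/mapP; exists j => //.
    by rewrite mem_iota add0n.
  have m0 : 0 < m.+1%:R^-1 :> R by rewrite invr_gt0.
  have [i j ij z nz||N NP] := @decreasing_small _ _ _ mu D m.+1%:R^-1 mD _ _ m0.
  - move=> /memD[k' k'i cz]; apply: nz; apply/memD; exists k' => //.
    exact: leq_trans ij.
  - apply: null_subset C0; [exact: bigcapT_measurable|apply: measurableC; exact: mC|].
    move=> z Dz [c cz]; apply: (Dz (pickle c).+1 I); apply/memD.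
    by exists (pickle c) => //; exists c => //; rewrite pickleK.
  exists (s N) => //=; have := NP N (leqnn _).
  rewrite /D probability_setC; last exact: measurable_coded.
  have mx := measurable_coded (s N) x.
  rewrite -[mu (coded _ _)]fineK ?fin_num_measure// -EFinB !lte_fin.
  by rewrite ltrBlDr addrC -ltrBlDr.
split.
  have mCx := mC x.
  suff C1 : mu (C x) = 1%E by rewrite probability_setC// C1 subee.
  apply/eqP; rewrite eq_le probability_le1//=.
  apply/lee_subgt0Pr => e e0.
  have := Fx (pickle (inl (Num.bound e^-1) : nat + code n)) I.
  rewrite /F pickleK => -[s _ /= /ltW h].
  apply: (@le_trans _ _ (mu (coded s x))); last first.
    by apply: le_measure; rewrite ?inE//; exact: measurable_coded.
  apply: le_trans h; rewrite -EFinB lee_fin lerD2l lerN2.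
  rewrite invf_ple ?posrE//; apply: le_trans (ltW (archi_boundP _)) _.
    by rewrite invr_ge0 ltW.
  by rewrite ler_nat.
move=> c c0; have := Fx (pickle (inr c : nat + code n)) I.
by rewrite /F pickleK /= coded1 c0 ltxx.
Qed.

End generic_tuples.

(** * Density of the generic tuples and the comeager orbit *)

Section ample_generics_type_III.
Context {R : realType} {d : measure_display} {X : measurableType d}.
Context {mu : probability X R} (hmu : standard_probability mu) (T : nsaut mu).
Hypotheses (erg : ergodic T) (hIII : type_III T).
Context (n : nat).
Local Notation fg := (full_group hmu T).
Local Notation fgn := {ptws 'I_n -> fg}.
Implicit Types (x y : fgn) (c : code n).

(** On the core of the set where the tuples agree, whole orbits of [g] stay inside, so all words
    agree as well. *)
Lemma has_code_ae (g h : 'I_n -> nsaut mu) :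
  (forall i, orbital T (g i)) -> (forall i, \forall z \ae mu, g i z = h i z) ->
  exists G, [/\ measurable G, mu (~` G) = 0%E &
    forall z c, G z -> has_code c g z <-> has_code c h z].
Proof.
move=> og gh; pose C := [set z | forall i, g i z = h i z].
have mgh i : measurable [set z | g i z = h i z].
  by apply: (measurable_eqset hmu); exact: measurable_aut.
have mC : measurable C by exact: measurable_forall.
have C0 : mu (~` C) = 0%E.
  have -> : ~` C = \bigcup_i ~` [set z | g i z = h i z].
    by apply/seteqP; split=> z /= => [/existsNP[i ni]|[i _ ni] Cz]; [exists i|exact: ni].
  apply: null_bigcup => i; first exact: measurableC.
  have [N [mN N0 NP]] := gh i.
  by apply: null_subset N0; [exact: measurableC| |exact: NP].
exists (core T C); split; [exact: measurable_core|exact: null_core|].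
move=> z c Gz; have actE w : act g w z = act h w z /\ core T C (act g w z).
  elim: w => //= i w [<- Gw]; split; first exact: (core_sub Gw).
  exact: invariant_core (og i _) Gw.
by split=> cz w w'; have := cz w w'; rewrite !(actE _).1.
Qed.

Lemma dense_generic : dense [set x : fgn | generic x].
Proof.
move=> O [x Ox] oO; have /ptws_nbhs_ball[e e0 eO] : nbhs x O by exact: open_nbhs_nbhs.
have e2 : 0 < e / 2 by rewrite divr_gt0.
have [g [og xg fin]] := finite_approximation hmu erg hIII (orbital_generators x) e2.
have [h [oh gh hcode hpos]] := generic_perturbation hmu erg hIII og fin e2.
have /choice[y yP] := fun i => full_group_intro hmu (oh i).
have yh i : \forall z \ae mu, rep (y i) z = h i z.
  by apply/AutP; rewrite pi_rep yP.
exists (y : fgn); split.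
  apply: eO => i; rewrite ballEmdist /= (mdist_lt _ (pi_rep (x i)) (esym (yP i))).
  have m1 := measurable_aut_neq (rep (x i)) (g i) hmu.
  have m2 := measurable_aut_neq (g i) (h i) hmu.
  have k := @measureU2 _ _ _ mu _ _ m1 m2.
  apply: (@le_lt_trans _ _ (mu [set z | rep (x i) z <> g i z] +
      mu [set z | g i z <> h i z])%E).
    apply: le_trans k; apply: le_measure; rewrite ?inE;
      [exact: measurable_aut_neq|exact: measurableU|].
    move=> z /= ne; have [e1|] := pselect (rep (x i) z = g i z); last by left.
    by right => e3; apply: ne; rewrite e1.
  by rewrite [e]splitr EFinD; apply: lteD; [exact: xg|exact: gh].
have [G [mG G0 GP]] := has_code_ae (orbital_generators (y : fgn)) yh.
have mGC : measurable (~` G) by exact: measurableC.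
split=> [|c c0].
  apply: null_subset G0 => //.
    by apply: measurableC; apply: measurable_exists => c; exact: measurable_has_code.
  move=> z nz Gz; apply: nz; have [c cz] := hcode z.
  by exists c; apply/GP.
apply: (hpos c).
have mc : measurable (has_code c (generators (y : fgn))) by exact: measurable_has_code.
apply: null_subset (nullU mc mGC c0 G0); [exact: measurable_has_code|exact: measurableU|].
by move=> z cz; have [Gz|nG] := pselect (G z); [left; apply/GP|right].
Qed.

Lemma generic_conj_orbit x y : generic x -> generic y -> conj_orbit x y.
Proof.
move=> [x0 xpos] [y0 ypos].
have [U [oU [G [mG G0 GP]]]] := generic_conjugate hmu erg hIII
  (orbital_generators x) (orbital_generators y) x0 y0 xpos ypos.
have [a aU] := full_group_intro hmu oU.
exists a; apply/funext => i; apply: val_inj.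
rewrite -(pi_rep (y i)).
transitivity (\pi_(Aut mu) (aut_comp (aut_comp U (rep (x i))) (aut_inv U))); last first.
  by rewrite -Defs.pi_mul -Defs.pi_mul -Defs.pi_inv -aU pi_rep.
apply/AutP.
have aeG : \forall z \ae mu, G z.
  by exists (~` G); split; [exact: measurableC|exact: G0|].
apply: filterS (ae_autV U aeG) => z Gz /=.
by have /esym := GP _ i Gz; rewrite autVK.
Qed.

End ample_generics_type_III.

Theorem theorem3 (R : realType) (d : measure_display) (X : measurableType d)
    (mu : probability X R) (hmu : standard_probability mu) (T : nsaut mu)
    (hergodic : ergodic T) (hIII : type_III T) :
  ample_generics R (full_group hmu T).
Proof.
split=> [|n]; first exact: full_group_polish.
(* Density in the whole space, which contains the constant tuple 1, yields one generic tuple; its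
   orbit contains all the others. *)
have [|x [_ gx]] := @dense_generic _ _ _ _ hmu _ hergodic hIII n setT _ openT.
  by exists (fun=> 1%g).
exists x, [set y | generic y]; split.
- exact: Gdelta_generic.
- exact: dense_generic.
- by move=> y gy; exact: generic_conj_orbit.
Qed.
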